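(* Let $V:P\to B(K)$ be a pure strictly continuous isometric representation and let $\alpha^V$ be the CCR flow associated to $V$. Then the map $$\mathbb{C}^d\times\mathscr{A}^V(P)\ni(\mu,h)\mapsto T^{\mu,h}\in\mathfrak{U}_{\alpha^V}$$ is a bijection, where $T^{\mu,h}=\{T^{\mu,h}_x\}_{x\in P}$ is given by $T^{\mu,h}_x=e^{\langle x,\mu\rangle}R^{e(h_x)}$, $x\in P$.
   Context: $P\subset\mathbb{R}^d$ is a closed convex cone, spanning ($P-P=\mathbb{R}^d$) and pointed ($P\cap-P=\{0\}$), with interior $\Omega$. Inner products are linear in the second variable; $\langle x,\mu\rangle=\sum_j x_j\mu_j$ for $x\in\mathbb{R}^d,\mu\in\mathbb{C}^d$. $K$ is a separable complex Hilbert space. An isometric representation of $P$ on $K$ is a map $V:P\to B(K)$ with each $V_x$ an isometry, $V_{x+y}=V_xV_y$, and $x\mapsto V_x\xi$ continuous for all $\xi\in K$. It is strictly continuous if also $x\mapsto V_x^*\xi$ is continuous for all $\xi\in K$; it is pure if $\bigcap_{t\ge0}V_{ta}K=\{0\}$ for all $a\in\Omega$. $\Gamma(K)$ is the symmetric Fock space, $e(u)=\sum_{n\ge0}u^{\otimes n}/\sqrt{n!}$ are the exponential vectors, $W(u)$ is the Weyl unitary determined by $W(u)e(v)=e^{-\|u\|^2/2-\langle u|v\rangle}e(u+v)$, and for an isometry $V$, $\Gamma(V)$ is its second quantization, $\Gamma(V)e(v)=e(Vv)$. $\Gamma(K_1\oplus K_2)$ is identified with $\Gamma(K_1)\otimes\Gamma(K_2)$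 via $e(u\oplus v)\mapsto e(u)\otimes e(v)$. An $\mathrm{E}_0$-semigroup over $P$ on $B(H)$ is a family $\{\alpha_x\}_{x\in P}$ of unital normal $*$-endomorphisms with $\alpha_0=\mathrm{Id}$, $\alpha_x\alpha_y=\alpha_{x+y}$, and $x\mapsto\rho(\alpha_x(m))$ continuous for all $\rho\in B(H)_*$, $m\in B(H)$. The CCR flow $\alpha^V$ is the unique $\mathrm{E}_0$-semigroup on $B(\Gamma(K))$ with $\alpha^V_x(W(u))=W(V_xu)$ for all $x\in P,u\in K$. A unit of an $\mathrm{E}_0$-semigroup $\alpha$ on $B(H)$ is a strongly continuous family $\{u_x\}_{x\in P}$ of bounded operators on $H$ such that $\alpha_x(T)u_x=u_xT$ for all $x\in P$, $T\in B(H)$; $u_{x+y}=u_xu_y$ for all $x,y\in P$; and $u_x\ne0$ for some $x\in P$. $\mathfrak{U}_\alpha$ is the set of all units of $\alpha$. A ($P$-)additive cocycle for $V$ is a continuous function $h:P\to K$ with $h_x\in\ker(V_x^* )$ and $h_x+V_xh_y=h_{x+y}$ for all $x,y\in P$; $\mathscr{A}^V(P)$ is the set of these. For $x\in P$ and $\xi\in\Gamma(\ker V_x^* )$, $R^{\xi}\in B(\Gamma(K))$ is defined by $R^{\xi}(\eta)=\xi\otimes\Gamma(V_x)\eta$, using $\Gamma(K)=\Gamma(\ker V_x^* )\otimes\Gamma(V_xK)$. *)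

(* Defs.v *)
From HB Require Import structures.
From mathcomp Require Import all_boot all_order all_algebra all_fingroup.
From mathcomp Require Import complex.
From mathcomp Require Import all_classical all_reals all_analysis.

Set Implicit Arguments.
Unset Strict Implicit.
Unset Printing Implicit Defensive.

Import Order.TTheory GRing.Theory Num.Theory.
Import numFieldNormedType.Exports.

Local Open Scope classical_set_scope.
Local Open Scope ring_scope.
Local Open Scope complex_scope.

(* Conventions.
   - A function on the cone P, such as V, a semigroup, a cocycle or a unit, is
     encoded as a total function on R^d.  When such functions are collected
     into a set, they are normalized to vanish outside P, so that equality of
     total functions is equality on P.
   - Operators are plain functions, with linearity and boundedness as
     predicates.
   - Objects determined by a defining property (adjoint, Weyl unitaries, second
     quantization, tensor decomposition of the Fock space) are given by the
     classical choice operator get applied to that property.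
   - R[i] carries its topology through the regular module R[i]^o. *)

(* ip is linear in the second variable. *)
HB.mixin Record isHilbert (R : realType) H of CompleteNormedModule R[i] H := {
  ip : H -> H -> R[i] ;
  ip_linearr : forall u (a : R[i]) v w, ip u (a *: v + w) = a * ip u v + ip u w ;
  ip_conj : forall u v, ip v u = (ip u v)^* ;
  ip_norm : forall u, ip u u = `|u| ^+ 2 }.

#[short(type="hilbertType")]
HB.structure Definition Hilbert (R : realType) :=
  { H of isHilbert R H & CompleteNormedModule R[i] H }.

Section HilbertSpaces.
Variables (R : realType) (H : hilbertType R).
Implicit Types (A : set H) (T : H -> H).

Definition separable := exists A, countable A /\ dense A.

Definition lin_span A : set H :=
  [set x | exists n (c : 'I_n -> R[i]) (a : 'I_n -> H),
     (forall i, A (a i)) /\ x = \sum_(i < n) c i *: a i].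

Definition bounded_op T :=
  linear T /\ exists M : R, forall u, `|T u| <= M%:C * `|u|.

Definition isometry_op T := linear T /\ forall u, `|T u| = `|u|.

Definition unitary_op T := isometry_op T /\ range T = setT.

Definition adjoint T : H -> H :=
  get [set S : H -> H | forall u v, ip (T u) v = ip u (S v)].

Definition ker_op T : set H := [set u | T u = 0].

(* The elements of the predual of B(H):
   rho(A) = sum_n <xi_n | A eta_n>, with sum_n |xi_n|^2 < oo and
   sum_n |eta_n|^2 < oo. *)
Definition normal_functional (rho : (H -> H) -> R[i]^o) :=
  exists xi eta : nat -> H,
    [/\ cvgn (series (fun n => `|xi n| ^+ 2 : R[i]^o)),
        cvgn (series (fun n => `|eta n| ^+ 2 : R[i]^o)) &
        forall T, bounded_op T ->
          series (fun n => ip (xi n) (T (eta n)) : R[i]^o) @ \oo --> rho T].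

Definition normal_star_endomorphism (a : (H -> H) -> H -> H) :=
  [/\ forall T, bounded_op T -> bounded_op (a T),
      forall (c : R[i]) S T, bounded_op S -> bounded_op T ->
        a (c *: S + T) = c *: a S + a T,
      forall S T, bounded_op S -> bounded_op T -> a (S \o T) = a S \o a T,
      forall T, bounded_op T -> a (adjoint T) = adjoint (a T) &
      forall rho, normal_functional rho -> normal_functional (rho \o a)].

End HilbertSpaces.

Definition cexp (R : realType) (z : R[i]) : R[i] :=
  (expR (complex.Re z))%:C * (cos (complex.Im z) +i* sin (complex.Im z)).

Section Cone.
Variables (R : realType) (d : nat) (P : set 'rV[R]_d).

Definition pairing (x : 'rV[R]_d) (mu : 'rV[R[i]]_d) : R[i] :=
  \sum_(j < d) (x 0 j)%:C * mu 0 j.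

Definition closed_convex_cone :=
  [/\ closed P, P 0, (forall x y, P x -> P y -> P (x + y)) &
      forall (t : R) x, 0 <= t -> P x -> P (t *: x)].

Definition spanning_cone := forall z, exists x y, [/\ P x, P y & z = x - y].

Definition pointed_cone := forall x, P x -> P (- x) -> x = 0.

Section Representations.
Variables (H : hilbertType R).

Definition isometric_rep (V : 'rV[R]_d -> H -> H) :=
  [/\ forall x, P x -> isometry_op (V x),
      forall x y, P x -> P y -> V (x + y) = V x \o V y &
      forall xi, {within P, continuous (fun x => V x xi)}].

Definition strictly_continuous (V : 'rV[R]_d -> H -> H) :=
  forall xi, {within P, continuous (fun x => adjoint (V x) xi)}.

Definition pure (V : 'rV[R]_d -> H -> H) :=
  forall a, interior P a ->
    \bigcap_(t in [set t : R | 0 <= t]) range (V (t *: a)) = [set 0].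

Definition additive_cocycles (V : 'rV[R]_d -> H -> H) : set ('rV[R]_d -> H) :=
  [set h | [/\ {within P, continuous h},
      forall x, P x -> ker_op (adjoint (V x)) (h x),
      forall x y, P x -> P y -> h x + V x (h y) = h (x + y) &
      forall x, ~ P x -> h x = 0]].

Definition E0_semigroup (alpha : 'rV[R]_d -> (H -> H) -> H -> H) :=
  [/\ forall x, P x ->
        normal_star_endomorphism (alpha x) /\ alpha x idfun = idfun,
      forall T, bounded_op T -> alpha 0 T = T,
      forall x y T, P x -> P y -> bounded_op T ->
        alpha x (alpha y T) = alpha (x + y) T &
      forall rho T, normal_functional rho -> bounded_op T ->
        {within P, continuous (fun x => rho (alpha x T))}].

Definition units (alpha : 'rV[R]_d -> (H -> H) -> H -> H) :
    set ('rV[R]_d -> H -> H) :=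
  [set u | [/\ (forall x, P x -> bounded_op (u x)) /\
               (forall xi, {within P, continuous (fun x => u x xi)}),
      forall x T, P x -> bounded_op T -> alpha x T \o u x = u x \o T,
      forall x y, P x -> P y -> u (x + y) = u x \o u y,
      exists2 x, P x & u x <> 0 &
      forall x, ~ P x -> u x = 0]].

End Representations.
End Cone.

(* A symmetric Fock space over K, i.e. a Hilbert space direct sum of the
   symmetric tensor powers of K.  stens u is the symmetrization
   (1/n!) sum_s u_(s 1) (x) ... (x) u_(s n) of the elementary tensor
   u_1 (x) ... (x) u_n.  The inner products and the totality of these vectors
   determine the pair (fock, stens) up to a unique unitary. *)
Record symFock (R : realType) (K : hilbertType R) := SymFock {
  fock :> hilbertType R ;
  stens : forall n, ('I_n -> K) -> fock ;
  ip_stens : forall n (u v : 'I_n -> K),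
    ip (stens u) (stens v) =
    (n`!%:R)^-1 * \sum_(s : 'S_n) \prod_(i < n) ip (u i) (v (s i)) ;
  ip_stens_neq : forall m n (u : 'I_m -> K) (v : 'I_n -> K),
    m <> n -> ip (stens u) (stens v) = 0 ;
  stens_total : closure (lin_span
    [set x | exists n (u : 'I_n -> K), x = stens u]) = setT }.

Section Fock.
Variables (R : realType) (K : hilbertType R) (G : symFock K).

Definition expv (u : K) : G :=
  limn (series (fun n => ((Num.sqrt n`!%:R)^-1 : R)%:C *:
                         stens G (fun _ : 'I_n => u))).

Definition weyl (u : K) : G -> G :=
  get [set W : G -> G | unitary_op W /\ forall v,
    W (expv v) = cexp (- (`|u| ^+ 2 / 2) - ip u v) *: expv (u + v)].

Definition second_quant (V : K -> K) : G -> G :=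
  get [set S : G -> G | bounded_op S /\ forall v, S (expv v) = expv (V v)].

(* For a closed subspace S of K, the Fock space of S as a subspace of G. *)
Definition fock_sub (S : set K) : set G :=
  closure (lin_span [set x | exists n (u : 'I_n -> K),
    (forall i, S (u i)) /\ x = stens G u]).

(* For orthogonal closed subspaces S1 and S2 of K, the tensor product of
   vectors of fock_sub S1 and fock_sub S2, read in G through the identification
   of the Fock space of S1 (+) S2 with the tensor product of the Fock spaces of
   S1 and S2.  It is determined on fock_sub S1 x fock_sub S2. *)
Definition is_fock_tensor (S1 S2 : set K) (m : G -> G -> G) :=
  [/\ forall (c : R[i]) x x' y, fock_sub S1 x -> fock_sub S1 x' ->
        fock_sub S2 y -> m (c *: x + x') y = c *: m x y + m x' y,
      forall (c : R[i]) x y y', fock_sub S1 x -> fock_sub S2 y ->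
        fock_sub S2 y' -> m x (c *: y + y') = c *: m x y + m x y',
      forall x x' y y', fock_sub S1 x -> fock_sub S1 x' ->
        fock_sub S2 y -> fock_sub S2 y' ->
        ip (m x y) (m x' y') = ip x x' * ip y y' &
      forall u v, S1 u -> S2 v -> m (expv u) (expv v) = expv (u + v)].

Definition fock_tensor (S1 S2 : set K) : G -> G -> G :=
  get (is_fock_tensor S1 S2).

(* The operator R^xi of an isometry V, for xi in the Fock space of ker V^*. *)
Definition creation (V : K -> K) (xi : G) : G -> G :=
  fun eta => fock_tensor (ker_op (adjoint V)) (range V) xi (second_quant V eta).

Variables (d : nat) (P : set 'rV[R]_d) (V : 'rV[R]_d -> K -> K).

Definition is_ccr_flow (alpha : 'rV[R]_d -> (G -> G) -> G -> G) :=
  E0_semigroup P alpha /\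
  forall x u, P x -> alpha x (weyl u) = weyl (V x u).

Definition ccr_unit (mu : 'rV[R[i]]_d) (h : 'rV[R]_d -> K) :
    'rV[R]_d -> G -> G :=
  fun x => if x \in P then cexp (pairing x mu) *: creation (V x) (expv (h x))
           else 0.

End Fock.

Arguments expv {R K} G u.
Arguments weyl {R K} G u.
Arguments second_quant {R K} G V.
Arguments fock_sub {R K} G S.
Arguments fock_tensor {R K} G S1 S2.
Arguments creation {R K} G V xi.
Arguments is_ccr_flow {R K} G {d} P V alpha.
Arguments ccr_unit {R K} G {d} P V mu h.

(* Main.v *)
Require Import Defs.
From mathcomp Require Import all_boot all_order all_algebra all_fingroup.
From mathcomp Require Import complex ring lra.
From mathcomp Require Import all_classical all_reals all_analysis.

Set Implicit Arguments.
Unset Strict Implicit.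
Unset Printing Implicit Defensive.

Import Order.TTheory GRing.Theory Num.Theory.
Import numFieldNormedType.Exports.

Local Open Scope classical_set_scope.
Local Open Scope ring_scope.
Local Open Scope complex_scope.

(** Let [e(u)] denote the exponential vectors.  A form on the Fock space that is
    invariant under [W(V v)] in the first argument and [W(v)] in the second is
    determined on exponential vectors by [f(w) = B(e(w), e(0))], and
    [f(w - x V v)] is at once holomorphic and antiholomorphic in [x]; hence [f]
    does not see the range of [V].

    For [V = 1] this says that the Weyl operators act irreducibly, and it lets
    one pass from [alpha_x(W(u)) R = R W(u)] to [alpha_x(T) R = R T] for all
    bounded [T]: the maps [y |-> alpha_x(|y><e(0)|) l] intertwine by
    construction, their ranges span the Fock space because [alpha_x] is normal
    and unital, and [R] must be one of them.

    For a unit [u] it gives [<e(w), u_x y> = f_x(w) <e(V_x^* w), y>] and the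
    cocycle identity [f_(x+y)(w) = f_x(w) f_y(V_x^* w)].  The function [f_x(0)]
    is a continuous character of the cone.  After dividing by it, cut [x] into
    [n] equal steps, which splits [w] into mutually orthogonal pieces [w_k]
    modulo the range of [V_x]; then [f_x(w)] is the product of the [f_x(w_k)],
    and by strict continuity the contributions of second and higher order in
    [w_k] vanish as [n] grows.  So [f_x(w) = exp <w, h_x>], where [h_x] is the
    one-particle component of [u_x e(0)]. *)

(** * Real-valued norms and sequential convergence *)

(** The obstacle in cutting [x] into [n] steps is that the squared norms of the pieces [w_k] add up
    to a quantity that is bounded by [|w|^2] but need not become small. The norm bound [O(|w_k|^2)]
    on [e(w_k) - e(0) - w_k] therefore only bounds the total second-order contribution. Smallness is
    weak: against a fixed [e(v)] the remainder is [O(|<w_k, v>|^2)], and these squares sum to at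
    most [max_k |w_k|^2] times [|v|^2], where the maximum is controlled by the modulus of continuity
    of [t |-> |V_(t x)^* w|^2]. The uniform norm bound then carries this from exponential vectors to
    all of the Fock space.

    A second obstacle is that Weyl operators, second quantizations and the tensor decomposition are
    choices from a specification, so nothing is known about them until an instance is built. All
    instances come from one principle, extending a map whose Gram matrix on exponential vectors is
    prescribed, and it relies on the totality of these vectors, which is obtained by polarizing
    symmetric tensors. *)

Definition nrm (R : realType) (V : normedZmodType R[i]) (v : V) : R :=
  complex.Re `|v|.

Section RealNorm.
Variables (R : realType) (V : normedZmodType R[i]).
Implicit Types u v : V.

Lemma nrmE u : `|u| = (nrm u)%:C.
Proof. by rewrite /nrm RRe_real // normr_real. Qed.

Lemma nrm_ge0 u : 0 <= nrm u.
Proof. by rewrite -ler0c -nrmE. Qed.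

Lemma nrm0 : nrm (0 : V) = 0.
Proof. by apply: complexI; rewrite -nrmE normr0. Qed.

Lemma nrm_eq0 u : nrm u = 0 -> u = 0.
Proof. by move=> u0; apply/eqP; rewrite -normr_eq0 nrmE u0. Qed.

Lemma nrmN u : nrm (- u) = nrm u.
Proof. by rewrite /nrm normrN. Qed.

Lemma nrmBC u v : nrm (u - v) = nrm (v - u).
Proof. by rewrite /nrm distrC. Qed.

Lemma ler_nrmD u v : nrm (u + v) <= nrm u + nrm v.
Proof. by rewrite -lecR rmorphD /= -!nrmE ler_normD. Qed.

Lemma ler_nrmB u v : nrm (u - v) <= nrm u + nrm v.
Proof. by rewrite -(nrmN v) ler_nrmD. Qed.

Lemma nrm_le_dist u v : nrm u <= nrm (u - v) + nrm v.
Proof. by rewrite -{1}(subrK v u) ler_nrmD. Qed.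

Lemma ler_nrm_trans w u v : nrm (u - v) <= nrm (u - w) + nrm (w - v).
Proof. by rewrite -{1}(subrKA w u) ler_nrmD. Qed.

Lemma nrm_sum (I : Type) (r : seq I) (P : pred I) (F : I -> V) :
  nrm (\sum_(i <- r | P i) F i) <= \sum_(i <- r | P i) nrm (F i).
Proof.
elim/big_rec2: _ => [|i x y _ h]; first by rewrite nrm0.
by apply: (le_trans (ler_nrmD _ _)); rewrite lerD2l.
Qed.

End RealNorm.

Section ComplexNorm.
Variable R : realType.
Implicit Types z w : R[i].

Lemma nrmM z w : nrm (z * w) = nrm z * nrm w.
Proof. by apply: complexI; rewrite rmorphM /= -!nrmE normrM. Qed.

Lemma nrmZ (V : normedModType R[i]) z (v : V) : nrm (z *: v) = nrm z * nrm v.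
Proof. by apply: complexI; rewrite rmorphM /= -!nrmE normrZ. Qed.

Lemma nrm1 : nrm (1 : R[i]) = 1.
Proof. by apply: complexI; rewrite -nrmE normr1. Qed.

Lemma nrmX z n : nrm (z ^+ n) = nrm z ^+ n.
Proof. by elim: n => [|n IH]; rewrite ?expr0 ?nrm1 // !exprS nrmM IH. Qed.

Lemma nrmR (x : R) : nrm (x%:C) = `|x|.
Proof.
rewrite /nrm normc_def /= expr0n /= addr0.
exact: sqrtr_sqr.
Qed.

Lemma rcD (x y : R) : (x + y)%:C = x%:C + y%:C.
Proof. exact: rmorphD. Qed.

Lemma rcB (x y : R) : (x - y)%:C = x%:C - y%:C.
Proof. exact: rmorphB. Qed.

Lemma rcM (x y : R) : (x * y)%:C = x%:C * y%:C.
Proof. exact: rmorphM. Qed.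

Lemma rcX (x : R) n : (x ^+ n)%:C = x%:C ^+ n.
Proof. exact: rmorphXn. Qed.

Lemma rcV (x : R) : (x^-1)%:C = x%:C^-1.
Proof. exact: fmorphV. Qed.

Lemma rc_nat n : (n%:R : R)%:C = n%:R.
Proof. exact: rmorph_nat. Qed.

Lemma conjR (x : R) : conjc (x%:C) = x%:C.
Proof. by rewrite /conjc /= oppr0. Qed.

Lemma nrmV z : nrm (z^-1) = (nrm z)^-1.
Proof. by apply: complexI; rewrite fmorphV /= -!nrmE normfV. Qed.

Lemma nrmJ z : nrm (conjc z) = nrm z.
Proof. by rewrite /nrm normcJ. Qed.

Lemma nrm_sqr z : ((nrm z) ^+ 2)%:C = z * conjc z.
Proof. by rewrite rmorphXn /= -nrmE sqr_normc. Qed.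

Lemma nrm_sqrE z : nrm z ^+ 2 = complex.Re z ^+ 2 + complex.Im z ^+ 2.
Proof. by apply: complexI; rewrite rmorphXn /= -nrmE -add_Re2_Im2. Qed.

Lemma normRe_le z : `|complex.Re z| <= nrm z.
Proof. by rewrite -lecR -nrmE normc_ge_Re. Qed.

Lemma Re_le z : complex.Re z <= nrm z.
Proof. exact: le_trans (ler_norm _) (normRe_le z). Qed.

Lemma normIm_le z : `|complex.Im z| <= nrm z.
Proof.
rewrite -(@ler_pXn2r _ 2) ?nnegrE ?nrm_ge0 // nrm_sqrE.
by rewrite real_normK ?num_real // lerDr sqr_ge0.
Qed.

Lemma nrm_le_ReIm z : nrm z <= `|complex.Re z| + `|complex.Im z|.
Proof.
rewrite -(@ler_pXn2r _ 2) ?nnegrE ?nrm_ge0 ?addr_ge0 // nrm_sqrE sqrrD.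
by rewrite !real_normK ?num_real // lerD2r lerDl mulrn_wge0.
Qed.

End ComplexNorm.

(** Phrased through real distances, so that error bounds are squeezed in [R], and so that it also
    applies to [R[i]], whose topology is carried by [R[i]^o]. *)
Definition nconv (R : realType) (V : normedZmodType R[i]) (u : nat -> V) (l : V) :=
  (fun n => nrm (u n - l)) @ \oo --> (0 : R).

Section Conv.
Variable R : realType.

Lemma squeeze0 (u v : nat -> R) :
  (forall n, 0 <= u n) -> (forall n, u n <= v n) ->
  v @ \oo --> (0 : R) -> u @ \oo --> (0 : R).
Proof.
move=> u0 uv v0; apply: (squeeze_cvgr _ _ v0); last exact: cvg_cst.
by apply: nearW => n; rewrite u0 uv.
Qed.

Section Normed.
Variable V : normedZmodType R[i].
Implicit Types (u v : nat -> V) (l m : V).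

Lemma convP u l : nconv u l <->
  forall e : R, 0 < e -> exists N, forall n, (N <= n)%N -> nrm (u n - l) < e.
Proof.
split=> [/cvgrPdist_lt h e /h [N _ hN]|h].
  exists N => n /hN /=; rewrite sub0r normrN ger0_norm ?nrm_ge0 //.
apply/cvgrPdist_lt => e /h [N hN]; exists N => // n /hN /=.
by rewrite sub0r normrN ger0_norm ?nrm_ge0.
Qed.

Lemma conv_cst l : nconv (fun=> l) l.
Proof. by rewrite /nconv subrr nrm0; apply: cvg_cst. Qed.

Lemma conv_squeeze u l (b : nat -> R) :
  (forall n, nrm (u n - l) <= b n) -> b @ \oo --> (0 : R) -> nconv u l.
Proof. by move=> h; apply: squeeze0 => // n; apply: nrm_ge0. Qed.

Lemma conv_squeeze_sqr u l (b : nat -> R) :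
  (forall n, nrm (u n - l) ^+ 2 <= b n) -> b @ \oo --> (0 : R) -> nconv u l.
Proof.
move=> h /cvgrPdist_lt hb; apply/convP => e e0.
have [|N _ hN] := hb (e ^+ 2); first by rewrite exprn_gt0.
exists N => n /hN /=; rewrite sub0r normrN => hn.
rewrite -(@ltr_pXn2r _ 2) ?nnegrE ?nrm_ge0 ?(ltW e0) //.
exact: le_lt_trans (h n) (le_lt_trans (ler_norm _) hn).
Qed.

Lemma convD u v l m : nconv u l -> nconv v m -> nconv (fun n => u n + v n) (l + m).
Proof.
move=> hu hv; apply: (conv_squeeze (b := fun n => nrm (u n - l) + nrm (v n - m))).
  by move=> n; rewrite opprD addrACA ler_nrmD.
by rewrite -(addr0 0); apply: cvgD.
Qed.

Lemma convN u l : nconv u l -> nconv (fun n => - u n) (- l).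
Proof.
by move=> hu; apply: conv_squeeze hu => n; rewrite -opprD nrmN.
Qed.

Lemma convB u v l m : nconv u l -> nconv v m -> nconv (fun n => u n - v n) (l - m).
Proof. by move=> hu hv; apply: convD hu (convN hv). Qed.

Lemma conv_nrm u l : nconv u l -> (fun n => nrm (u n)) @ \oo --> nrm l.
Proof.
move=> hu; apply/cvgrPdist_le => e e0; move/cvgrPdist_le: hu => /(_ _ e0).
apply: filterS => n; rewrite sub0r normrN ger0_norm ?nrm_ge0 // => h.
apply: le_trans h; rewrite ler_norml; apply/andP; split.
  by rewrite lerNl opprB lerBlDr nrm_le_dist.
by rewrite lerBlDr nrmBC nrm_le_dist.
Qed.

Lemma conv_unique u l m : nconv u l -> nconv u m -> l = m.
Proof.
move=> hl hm; apply/eqP; rewrite -subr_eq0; apply/eqP/nrm_eq0.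
have := convB hl hm; rewrite /nconv => h.
have : (fun n : nat => nrm (l - m)) @ \oo --> (0 : R).
  by apply: squeeze0 h => n; rewrite ?nrm_ge0 // subrr sub0r nrmN.
by move/(cvg_unique _ (cvg_cst _)); apply; apply: norm_hausdorff.
Qed.

Lemma conv_shift u l k : nconv u l -> nconv (fun n => u (n + k)%N) l.
Proof. by move=> h; rewrite /nconv (cvg_shiftn k (fun n => nrm (u n - l))). Qed.

End Normed.

Lemma convZ (V : normedModType R[i]) (a : nat -> R[i]) b (u : nat -> V) l :
  nconv a b -> nconv u l -> nconv (fun n => a n *: u n) (b *: l).
Proof.
move=> ha hu.
pose c n := nrm (a n - b) * nrm (u n) + nrm b * nrm (u n - l).
apply: (conv_squeeze (b := c)).
  move=> n; rewrite /c -!nrmZ.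
  have -> : a n *: u n - b *: l = (a n - b) *: u n + b *: (u n - l).
    by rewrite scalerBl scalerBr addrA subrK.
  exact: ler_nrmD.
have -> : (0 : R) = 0 * nrm l + nrm b * 0 by rewrite mul0r mulr0 addr0.
by apply: cvgD; apply: cvgM => //; [apply: conv_nrm | apply: cvg_cst].
Qed.

Lemma convZr (V : normedModType R[i]) (a : R[i]) (u : nat -> V) l :
  nconv u l -> nconv (fun n => a *: u n) (a *: l).
Proof. exact: convZ (conv_cst _). Qed.

Lemma convM (a c : nat -> R[i]) b d :
  nconv a b -> nconv c d -> nconv (fun n => a n * c n) (b * d).
Proof. exact: (@convZ R[i]^o). Qed.

Lemma conv_complex (a : nat -> R[i]) z :
  nconv a z <-> ((fun n => complex.Re (a n)) @ \oo --> complex.Re z /\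
                (fun n => complex.Im (a n)) @ \oo --> complex.Im z).
Proof.
split=> [h|[hr hi]].
  split; apply/cvgrPdist_le => e e0; move/cvgrPdist_le: h => /(_ _ e0);
    apply: filterS => n; rewrite sub0r normrN ger0_norm ?nrm_ge0 // => h;
    apply: le_trans h; rewrite nrmBC.
    by have := normRe_le (z - a n); rewrite raddfB.
  by have := normIm_le (z - a n); rewrite raddfB.
have h0 : (fun n => `|complex.Re (a n) - complex.Re z| +
   `|complex.Im (a n) - complex.Im z|) @ \oo --> (0 : R).
  have -> : (0 : R) = `|complex.Re z - complex.Re z| +
   `|complex.Im z - complex.Im z| by rewrite !subrr normr0 addr0.
  by apply: cvgD; apply: cvg_norm; apply: cvgB => //; apply: cvg_cst.
apply: conv_squeeze h0 => n.
by have := nrm_le_ReIm (a n - z); rewrite !raddfB.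
Qed.

Lemma cvgn_conv (V : normedModType R[i]) (u : nat -> V) l :
  u @ \oo --> l <-> nconv u l.
Proof.
split=> [/cvgrPdist_lt h|/convP h].
  apply/convP => e e0; have [|N _ hN] := h e%:C; first by rewrite ltcR.
  by exists N => n /hN /=; rewrite distrC nrmE ltcR.
apply/cvgrPdist_lt => e e0.
have /complex_realP[r er] : e \is Num.real by apply: gtr0_real.
have [|N hN] := h r; first by rewrite -ltcR -er.
by exists N => // n /= /hN; rewrite er distrC nrmE ltcR.
Qed.

Lemma cauchy_conv (V : completeNormedModType R[i]) (u : nat -> V) :
  (forall e : R, 0 < e -> exists N, forall m n, (N <= m)%N -> (N <= n)%N ->
     nrm (u m - u n) < e) -> exists l, nconv u l.
Proof.
move=> h; suff /cauchy_cvgP/cvg_ex[l hl] : cauchy (u @ \oo).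
  by exists l; apply/cvgn_conv.
apply: cauchy_exP => e e0.
have /complex_realP[r er] : e \is Num.real by apply: gtr0_real.
have [|N hN] := h r; first by rewrite -ltcR -er.
exists (u N), N => // n /= Nn.
by rewrite -ball_normE /ball_ /= er nrmE ltcR hN.
Qed.

Lemma closureP (V : normedModType R[i]) (A : set V) x :
  closure A x <-> exists u : nat -> V, (forall n, A (u n)) /\ nconv u x.
Proof.
split=> [cl|[u [hA /cvgn_conv hu]] B /hu [N _ hN]]; last first.
  by exists (u N); split => //; apply: hN => /=.
have h (n : nat) : exists y, A y /\ nrm (y - x) < n.+1%:R^-1.
  have [] := cl (ball x ((n.+1%:R^-1 : R)%:C)).
    by apply: nbhsx_ballx; rewrite ltcR invr_gt0 ltr0n.
  move=> y [Ay]; rewrite -ball_normE /ball_ /= nrmE ltcR nrmBC => h.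
  by exists y.
have [u hu] := choice h; exists u; split=> [n|]; first by case: (hu n).
apply: (conv_squeeze (b := @harmonic R)); last exact: cvg_harmonic.
by move=> n; apply: ltW; case: (hu n).
Qed.

End Conv.

(** * Hilbert spaces *)

Section InnerProduct.
Variables (R : realType) (H : hilbertType R).
Implicit Types (u v w : H) (a : R[i]).

Lemma ipDr u v w : ip u (v + w) = ip u v + ip u w.
Proof. by have := ip_linearr u 1 v w; rewrite scale1r mul1r. Qed.

Lemma ip0r u : ip u 0 = 0.
Proof. by apply: (addrI (ip u 0)); rewrite -ipDr !addr0. Qed.

Lemma ipZr u a v : ip u (a *: v) = a * ip u v.
Proof. by have := ip_linearr u a v 0; rewrite addr0 ip0r addr0. Qed.

Lemma ipNr u v : ip u (- v) = - ip u v.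
Proof. by rewrite -scaleN1r ipZr mulN1r. Qed.

Lemma ipBr u v w : ip u (v - w) = ip u v - ip u w.
Proof. by rewrite ipDr ipNr. Qed.

Lemma ipDl u v w : ip (u + v) w = ip u w + ip v w.
Proof. by rewrite ip_conj ipDr rmorphD /= -!ip_conj. Qed.

Lemma ip0l u : ip 0 u = 0.
Proof. by rewrite ip_conj ip0r conjc0. Qed.

Lemma ipZl u a v : ip (a *: u) v = conjc a * ip u v.
Proof. by rewrite ip_conj ipZr rmorphM /= -ip_conj. Qed.

Lemma ipNl u v : ip (- u) v = - ip u v.
Proof. by rewrite ip_conj ipNr rmorphN /= -ip_conj. Qed.

Lemma ipBl u v w : ip (u - v) w = ip u w - ip v w.
Proof. by rewrite ipDl ipNl. Qed.

Lemma ip_sumr (I : Type) (r : seq I) (P : pred I) (F : I -> H) u :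
  ip u (\sum_(i <- r | P i) F i) = \sum_(i <- r | P i) ip u (F i).
Proof.
by elim/big_rec2: _ => [|i x y _ <-]; rewrite ?ip0r // ipDr.
Qed.

Lemma ip_suml (I : Type) (r : seq I) (P : pred I) (F : I -> H) u :
  ip (\sum_(i <- r | P i) F i) u = \sum_(i <- r | P i) ip (F i) u.
Proof.
by elim/big_rec2: _ => [|i x y _ <-]; rewrite ?ip0l // ipDl.
Qed.

Lemma ipnn u : ip u u = (nrm u ^+ 2)%:C.
Proof. by rewrite ip_norm nrmE rmorphXn. Qed.

Lemma ipnn_eq0 u : ip u u = 0 -> u = 0.
Proof.
rewrite ipnn => /complexI/eqP; rewrite sqrf_eq0 => /eqP; exact: nrm_eq0.
Qed.

Lemma ip_ext u v : (forall w, ip w u = ip w v) -> u = v.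
Proof.
move=> h; apply/eqP; rewrite -subr_eq0; apply/eqP/ipnn_eq0.
by rewrite ipBr h subrr.
Qed.

Lemma CauchySchwarz u v : nrm (ip u v) <= nrm u * nrm v.
Proof.
have [->|v0] := eqVneq v 0; first by rewrite ip0r !nrm0 mulr0.
have nv : 0 < nrm v.
  by rewrite lt_neqAle nrm_ge0 andbT eq_sym; apply: contra v0 => /eqP/nrm_eq0 ->.
have [N defN] : exists N, nrm v ^+ 2 = N by exists (nrm v ^+ 2).
set c := ip v u; have N0 : 0 < N by rewrite -defN exprn_gt0.
(* The residual of projecting [u] onto [v], multiplied by [N] to avoid a division. *)
have : 0 <= (nrm (N%:C *: u - c *: v)) ^+ 2 by rewrite sqr_ge0.
have -> : (nrm (N%:C *: u - c *: v)) ^+ 2 = N * (N * nrm u ^+ 2 - nrm c ^+ 2).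
  apply: complexI; rewrite -ipnn !(ipBl, ipBr, ipZl, ipZr) conjR.
  rewrite (ip_conj v u) -/c !ipnn defN [in RHS]rcM [in RHS]rcB [in RHS]rcM nrm_sqr.
  by ring.
rewrite pmulr_rge0 // subr_ge0 => h.
rewrite -(@ler_pXn2r _ 2) ?nnegrE ?nrm_ge0 ?mulr_ge0 ?nrm_ge0 //.
by rewrite ip_conj nrmJ exprMn defN mulrC.
Qed.

Lemma nrm_sqrD u v :
  nrm (u + v) ^+ 2 = nrm u ^+ 2 + nrm v ^+ 2 + 2 * complex.Re (ip u v).
Proof.
apply: complexI; rewrite -ipnn ipDl !ipDr !ipnn (ip_conj u v) 2!rcD [in RHS]rcM.
have := addcJ (ip u v); rewrite -(rmorph_nat (real_complex R)) /= => <-.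
by rewrite addrACA [RHS]addrAC [in RHS]addrA addrAC -!addrA; congr (_ + _); ring.
Qed.

Lemma parallelogram u v :
  nrm (u + v) ^+ 2 + nrm (u - v) ^+ 2 = 2 * (nrm u ^+ 2 + nrm v ^+ 2).
Proof. by rewrite !nrm_sqrD nrmN ipNr raddfN /=; ring. Qed.

Lemma conv_ip (x y : nat -> H) u v :
  nconv x u -> nconv y v -> nconv (fun n => ip (x n) (y n)) (ip u v).
Proof.
move=> hx hy.
pose c n := nrm (x n - u) * nrm (y n) + nrm u * nrm (y n - v).
apply: (conv_squeeze (b := c)).
  move=> n; rewrite /c.
  have -> : ip (x n) (y n) - ip u v = ip (x n - u) (y n) + ip u (y n - v).
    by rewrite ipBl ipBr addrA subrK.
  by apply: (le_trans (ler_nrmD _ _)); apply: lerD; apply: CauchySchwarz.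
have -> : (0 : R) = 0 * nrm v + nrm u * 0 by rewrite mul0r mulr0 addr0.
by apply: cvgD; apply: cvgM => //; [apply: conv_nrm | apply: cvg_cst].
Qed.

(** Variational proof: if [k] represents [f], then [J u = |u|^2 - 2 Re (f u)] equals
    [|u - k|^2 - |k|^2], so [k] is found as the minimizer of [J]. The parallelogram law makes
    minimizing sequences Cauchy. *)
Lemma riesz (f : H -> R[i]) (M : R) :
  (forall a u v, f (a *: u + v) = a * f u + f v) ->
  (forall u, nrm (f u) <= M * nrm u) ->
  exists k, forall u, f u = ip k u.
Proof.
move=> flin fM.
have fD u v : f (u + v) = f u + f v by rewrite -[u]scale1r flin mul1r scale1r.
have f0 : f 0 = 0 by apply: (addrI (f 0)); rewrite -fD !addr0.
have fZ a u : f (a *: u) = a * f u by rewrite -[_ *: _]addr0 flin f0 addr0.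
pose J (u : H) : R := nrm u ^+ 2 - 2 * complex.Re (f u).
have J_lb u : - M ^+ 2 <= J u.
  rewrite /J; have := fM u; have := Re_le (f u); have := sqr_ge0 (nrm u - M).
  by rewrite sqrrB; nra.
have hasJ : has_inf (range J).
  by split; [exists (J 0), 0 | exists (- M ^+ 2) => _ [u _ <-]].
pose m : R := inf (range J).
have Jm u : m <= J u by apply: (ge_inf hasJ.2); exists u.
have Jdist u v : nrm (u - v) ^+ 2 <= 2 * (J u - m) + 2 * (J v - m).
  have := Jm (2^-1 *: (u + v)); rewrite /J nrmZ fZ fD.
  have -> : (2^-1 : R[i]) = (2^-1 : R)%:C by rewrite fmorphV rmorph_nat.
  have -> : complex.Re ((2^-1 : R)%:C * (f u + f v)) =
     2^-1 * (complex.Re (f u) + complex.Re (f v)).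
    by case: (f u) => a b; case: (f v) => c d /=; ring.
  rewrite nrmR ger0_norm ?invr_ge0 // exprMn.
  by have := parallelogram u v; set p := nrm (u + v) ^+ 2; lra.
have hu (n : nat) : exists u, J u < m + n.+1%:R^-1.
  have [|_ [u _ <-] h] := inf_adherent (_ : 0 < n.+1%:R^-1 :> R) hasJ.
    by rewrite invr_gt0.
  by exists u.
have [u uJ] := choice hu.
have [k uk] : exists k, nconv u k.
  apply: cauchy_conv => e e0.
  have e4 : 0 < e ^+ 2 / 4 by rewrite divr_gt0 // exprn_gt0.
  have [N hN] : exists N, forall n, (N <= n)%N -> n.+1%:R^-1 < e ^+ 2 / 4.
    have /cvgrPdist_lt/(_ _ e4)[N _ hN] := @cvg_harmonic R.
    exists N => n /hN /=; rewrite sub0r normrN ger0_norm ?invr_ge0 //.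
  exists N => p q /hN hp /hN hq.
  rewrite -(@ltr_pXn2r _ 2) ?nnegrE ?nrm_ge0 ?(ltW e0) //.
  apply: (le_lt_trans (Jdist _ _)).
  move: hp hq (uJ p) (uJ q); set a : R := p.+1%:R^-1; set b : R := q.+1%:R^-1.
  by move: (J (u p)) (J (u q)) (m) (a) (b) (e ^+ 2) => *; lra.
have fc : nconv (fun n => f (u n)) (f k).
  apply: (conv_squeeze (b := fun n => M * nrm (u n - k))).
    by move=> n; have := fM (u n - k); rewrite -scaleN1r fD fZ mulN1r.
  by rewrite -(mulr0 M); apply: cvgM => //; apply: cvg_cst.
have Jc : (fun n => J (u n)) @ \oo --> J k.
  apply: cvgB; first by apply: cvgM; apply: conv_nrm.
  by apply: cvgM; [apply: cvg_cst | have [] := (conv_complex _ _).1 fc].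
have Jkm : J k = m.
  apply: (cvg_unique _ Jc); first exact: Rhausdorff.
  apply: (@squeeze_cvgr _ _ _ _ (fun=> m) (fun n => m + n.+1%:R^-1)).
  - by apply: nearW => n; rewrite Jm ltW.
  - exact: cvg_cst.
  - rewrite -[X in _ --> X]addr0; apply: cvgD; first exact: cvg_cst.
    exact: cvg_harmonic.
exists k => w; apply/eqP; rewrite eq_sym -subr_eq0; apply/eqP/nrm_eq0.
have [c defc] : exists c, ip k w - f w = c by exists (ip k w - f w).
rewrite defc.
(* Moving from [k] by [- t conj(c) w] changes [J] by [t |c|^2 (t |w|^2 - 2)]. This choice of [t]
   gives [t |w|^2 < 1], so minimality forces [c = 0]. *)
pose t := (1 + nrm w ^+ 2)^-1.
have t1 : t * (1 + nrm w ^+ 2) = 1.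
  by rewrite mulVf // gt_eqF // ltr_pwDl // sqr_ge0.
have t0 : 0 < t by rewrite invr_gt0 ltr_pwDl // sqr_ge0.
have := Jm (k + (- t%:C * conjc c) *: w); rewrite -Jkm /J.
rewrite nrm_sqrD fD fZ ipZr nrmZ nrmM nrmN nrmJ nrmR.
rewrite [`|t|]ger0_norm ?(ltW t0) //.
set x := complex.Re (_ * _ * ip k w).
rewrite [complex.Re (f k + _)]raddfD /=.
set y := complex.Re (_ * _ * f w) => h.
have h2 : x - y = - t * nrm c ^+ 2.
  rewrite /x /y -raddfB /= -mulrBr defc -mulrA [conjc _ * _]mulrC -nrm_sqr.
  by rewrite mulNr -rcM raddfN /= mulNr.
have h3 : 0 <= nrm c ^+ 2 * t * (t * nrm w ^+ 2 - 2).
  move: h h2; move: (x) (y) (complex.Re (f k)).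
  move: (nrm k ^+ 2) (nrm c) (nrm w) (t) => *; nra.
apply/eqP; rewrite -sqrf_eq0; apply/eqP/le_anti; rewrite sqr_ge0 andbT.
rewrite leNgt; apply/negP => c0; move: h3.
by rewrite leNgt pmulr_rlt0 ?mulr_gt0 // ; nra.
Qed.

End InnerProduct.

(** * Bounded operators, isometries and adjoints *)

Section Operators.
Variables (R : realType) (H : hilbertType R).
Implicit Types (u v : H) (T S : H -> H).

Lemma linear_mapD T u v : linear T -> T (u + v) = T u + T v.
Proof. by move=> h; rewrite -[u]scale1r h !scale1r. Qed.

Lemma linear_map0 T : linear T -> T 0 = 0.
Proof. by move=> h; apply: (addrI (T 0)); rewrite -linear_mapD // !addr0. Qed.

Lemma linear_mapZ T (a : R[i]) u : linear T -> T (a *: u) = a *: T u.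
Proof. by move=> h; rewrite -[_ *: u]addr0 h linear_map0 // addr0. Qed.

Lemma linear_mapB T u v : linear T -> T (u - v) = T u - T v.
Proof. by move=> h; rewrite linear_mapD // -scaleN1r linear_mapZ // scaleN1r. Qed.

Lemma bounded_opE T : bounded_op T <->
  linear T /\ exists M : R, 0 <= M /\ forall u, nrm (T u) <= M * nrm u.
Proof.
split=> [[lT [M hM]]|[lT [M [M0 hM]]]]; (split; first exact: lT).
  exists `|M|; split=> [|u]; first exact: normr_ge0.
  rewrite -lecR rcM -(nrmE (T u)) -(nrmE u); apply: (le_trans (hM u)).
  by apply: ler_wpM2r; [apply: normr_ge0 | rewrite lecR ler_norm].
by exists M => u; rewrite (nrmE (T u)) (nrmE u) -rcM lecR.
Qed.

Lemma isometry_nrm T u : isometry_op T -> nrm (T u) = nrm u.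
Proof. by move=> [_ h]; rewrite /nrm h. Qed.

Lemma isometry_bounded T : isometry_op T -> bounded_op T.
Proof.
move=> hT; apply/bounded_opE; split; first exact: hT.1.
by exists 1; split=> // u; rewrite (isometry_nrm _ hT) mul1r.
Qed.

Lemma isometry_ip T u v : isometry_op T -> ip (T u) (T v) = ip u v.
Proof.
move=> hT.
have hRe w z : complex.Re (ip (T w) (T z)) = complex.Re (ip w z).
  have := nrm_sqrD (T w) (T z); rewrite -(linear_mapD _ _ hT.1).
  rewrite !(isometry_nrm _ hT) nrm_sqrD; lra.
have := hRe u ('i%C *: v); rewrite linear_mapZ ?ipZr; last exact: hT.1.
rewrite ![_ * ip _ _]mulrC !ReiNIm => /oppr_inj hIm.
by apply/eqP; rewrite eq_complex hIm hRe !eqxx.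
Qed.

Lemma bounded_comp S T : bounded_op S -> bounded_op T -> bounded_op (S \o T).
Proof.
move=> /bounded_opE[lS [M [M0 hM]]] /bounded_opE[lT [N [N0 hN]]].
apply/bounded_opE; split; first by move=> a u v /=; rewrite lT lS.
exists (M * N); split=> [|u]; first exact: mulr_ge0.
by apply: (le_trans (hM _)); rewrite -mulrA ler_wpM2l.
Qed.

Lemma bounded_id : bounded_op (idfun : H -> H).
Proof.
by apply/bounded_opE; split=> //; exists 1; split=> // u; rewrite mul1r.
Qed.

Lemma bounded_lin (a : R[i]) S T :
  bounded_op S -> bounded_op T -> bounded_op (a *: S + T).
Proof.
move=> /bounded_opE[lS [M [M0 hM]]] /bounded_opE[lT [N [N0 hN]]].
apply/bounded_opE; split.
  move=> b u v; rewrite !fctE lT lS !scalerDr !scalerA [b * a]mulrC.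
  by rewrite addrACA.
exists (nrm a * M + N); split=> [|u].
  by rewrite addr_ge0 // mulr_ge0 // nrm_ge0.
rewrite !fctE; apply: (le_trans (ler_nrmD _ _)); rewrite mulrDl nrmZ.
by apply: lerD => //; rewrite -mulrA ler_wpM2l // nrm_ge0.
Qed.

Lemma bounded0 : bounded_op (0 : H -> H).
Proof.
apply/bounded_opE; split=> [a u v|].
  by change (0 = a *: (0 : H) + 0); rewrite scaler0 addr0.
exists 0; split=> // u; change (nrm (0 : H) <= 0 * nrm u).
by rewrite nrm0 mul0r.
Qed.

Lemma bounded_scale (a : R[i]) S : bounded_op S -> bounded_op (a *: S).
Proof. by move=> hS; rewrite -[_ *: _]addr0; apply: bounded_lin bounded0. Qed.

Lemma conv_bounded T (x : nat -> H) u :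
  bounded_op T -> nconv x u -> nconv (fun n => T (x n)) (T u).
Proof.
move=> /bounded_opE[lT [M [M0 hM]]] hx.
apply: (conv_squeeze (b := fun n => M * nrm (x n - u))).
  by move=> n; rewrite -linear_mapB.
by rewrite -(mulr0 M); apply: cvgM => //; apply: cvg_cst.
Qed.

Lemma adjoint_unique T S :
  (forall u v, ip (T u) v = ip u (S v)) -> adjoint T = S.
Proof.
move=> hS; have hT : exists S, forall u v, ip (T u) v = ip u (S v) by exists S.
have {}hT := getPex hT; apply/funext => v; apply: ip_ext => u.
by rewrite -hS -hT.
Qed.

Lemma adjointP T u v : bounded_op T -> ip (T u) v = ip u (adjoint T v).
Proof.
move=> /bounded_opE[lT [M [M0 hM]]].
have h w : exists k, forall u, ip (T u) w = ip u k.
  have [|x|k hk] := @riesz _ _ (fun x => ip w (T x)) (nrm w * M).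
  - by move=> a x y; rewrite lT ipDr ipZr.
  - apply: (le_trans (CauchySchwarz _ _)); rewrite -mulrA.
    by rewrite ler_wpM2l ?nrm_ge0.
  - by exists k => x; rewrite ip_conj hk -ip_conj.
have [S hS] := choice h.
by rewrite (adjoint_unique (S := S)).
Qed.

Lemma adjointP' T u v : bounded_op T -> ip (adjoint T u) v = ip u (T v).
Proof. by move=> hT; rewrite ip_conj -adjointP // -ip_conj. Qed.

Lemma bounded_adjoint T : bounded_op T -> bounded_op (adjoint T).
Proof.
move=> hT; have /bounded_opE[lT [M [M0 hM]]] := hT.
apply/bounded_opE; split.
  move=> a u v; apply: ip_ext => w.
  by rewrite -adjointP // !ipDr !ipZr !adjointP.
exists M; split=> // u.
have [->|n0] := eqVneq (adjoint T u) 0; first by rewrite nrm0 mulr_ge0 ?nrm_ge0.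
have p0 : 0 < nrm (adjoint T u).
  by rewrite lt_neqAle nrm_ge0 andbT eq_sym; apply: contra n0 => /eqP/nrm_eq0 ->.
rewrite -(ler_pM2l p0) -[_ * nrm (adjoint T u)]expr2.
have -> : nrm (adjoint T u) ^+ 2 = nrm (ip (adjoint T u) (adjoint T u)).
  by rewrite ipnn nrmR ger0_norm // sqr_ge0.
rewrite adjointP' //; apply: (le_trans (CauchySchwarz _ _)).
have -> : nrm (adjoint T u) * (M * nrm u) = nrm u * (M * nrm (adjoint T u)).
  by ring.
by rewrite ler_wpM2l ?nrm_ge0.
Qed.

Lemma isometry_adjointK T u : isometry_op T -> adjoint T (T u) = u.
Proof.
move=> hT; apply: ip_ext => v.
by rewrite -adjointP ?isometry_ip //; apply: isometry_bounded.
Qed.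

End Operators.

(** * Closed linear spans and density arguments *)

Section Spans.
Variables (R : realType) (H : hilbertType R).
Implicit Types (A S : set H).

Definition subspace S :=
  S 0 /\ forall (c : R[i]) x y, S x -> S y -> S (c *: x + y).

Definition closed_subspace S :=
  subspace S /\ forall u l, (forall n : nat, S (u n)) -> nconv u l -> S l.

Lemma lin_span_cons A c x y : A x -> lin_span A y -> lin_span A (c *: x + y).
Proof.
move=> Ax [n [k [a [Aa ->]]]]; exists n.+1.
exists (fun i => if unlift ord0 i is Some j then k j else c).
exists (fun i => if unlift ord0 i is Some j then a j else x).
split=> [i|]; first by case: unliftP => [j|] _.
rewrite big_ord_recl unlift_none; congr (_ + _).
by apply: eq_bigr => i _; rewrite liftK.
Qed.

Lemma lin_span_ind A (Q : H -> Prop) :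
  Q 0 -> (forall c x y, A x -> lin_span A y -> Q y -> Q (c *: x + y)) ->
  forall x, lin_span A x -> Q x.
Proof.
move=> Q0 QD _ [n [k [a [Aa ->]]]].
elim: n k a Aa => [|n IH] k a Aa; first by rewrite big_ord0.
rewrite big_ord_recl; apply: QD => //; last by apply: IH.
exists n, (k \o lift ord0), (a \o lift ord0); split=> // i; exact: Aa.
Qed.

Lemma lin_span_subspace A : subspace (lin_span A).
Proof.
split.
  by exists 0%N, (fun=> 0), (fun=> 0); split=> [[]//|]; rewrite big_ord0.
move=> c x y + hy; elim/lin_span_ind => [|d z x' Az _ IH].
  by rewrite scaler0 add0r.
by rewrite scalerDr scalerA -addrA; apply: lin_span_cons.
Qed.

Lemma sub_lin_span A : A `<=` lin_span A.
Proof.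
move=> x Ax; have := lin_span_cons 1 Ax (lin_span_subspace A).1.
by rewrite scale1r addr0.
Qed.

Lemma sub_clspan A : A `<=` closure (lin_span A).
Proof. exact: subset_trans (@sub_lin_span A) (@subset_closure _ _). Qed.

Lemma clspan_closed_subspace A : closed_subspace (closure (lin_span A)).
Proof.
split; first split.
- by apply: subset_closure; apply: (lin_span_subspace A).1.
- move=> c x y /closureP[u [Au ux]] /closureP[v [Av vy]]; apply/closureP.
  exists (fun n => c *: u n + v n); split=> [n|].
    exact: (lin_span_subspace A).2.
  by apply: convD vy; apply: convZr.
- move=> u l hu ul; rewrite ((closure_id _).1 (@closed_closure _ (lin_span A))).
  by apply/closureP; exists u.
Qed.

Lemma clspan_min A S :
  closed_subspace S -> A `<=` S -> closure (lin_span A) `<=` S.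
Proof.
move=> [[S0 SD] Sc] AS x /closureP[u [Au ux]]; apply: Sc ux => n.
move: (Au n); elim/lin_span_ind => // c y z Ay _ Sz; apply: SD => //.
exact: AS.
Qed.

Lemma subspaceD S x y : subspace S -> S x -> S y -> S (x + y).
Proof. by move=> [_ h] Sx Sy; rewrite -[x]scale1r; apply: h. Qed.

Lemma subspaceZ S (c : R[i]) x : subspace S -> S x -> S (c *: x).
Proof. by move=> [S0 h] Sx; rewrite -[_ *: _]addr0; apply: h. Qed.

Lemma subspaceB S x y : subspace S -> S x -> S y -> S (x - y).
Proof.
by move=> h Sx Sy; apply: subspaceD => //; rewrite -scaleN1r; apply: subspaceZ.
Qed.

Lemma subspace_sum S (I : Type) (r : seq I) (P : pred I) (F : I -> H) :
  subspace S -> (forall i, P i -> S (F i)) -> S (\sum_(i <- r | P i) F i).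
Proof.
move=> hS h; elim/big_rec: _ => [|i x Pi Sx]; first exact: hS.1.
by apply: subspaceD => //; apply: h.
Qed.

Lemma orth_closed_subspace (x : H) : closed_subspace [set y | ip x y = 0].
Proof.
split; first split=> [|c y z /= hy hz]; rewrite /= ?ip0r //.
  by rewrite ipDr ipZr hy hz mulr0 addr0.
move=> u l hu ul /=; have := conv_ip (conv_cst x) ul.
rewrite (_ : (fun n => _) = fun=> 0); last by apply/funext => n; apply: hu.
by move/(conv_unique (conv_cst 0)).
Qed.

Lemma total_ip_ext A x y : closure (lin_span A) = setT ->
  (forall a, A a -> ip a x = ip a y) -> x = y.
Proof.
move=> hA h; apply/eqP; rewrite -subr_eq0; apply/eqP/ipnn_eq0.
have hc := orth_closed_subspace (x - y).
have : closure (lin_span A) (x - y) by rewrite hA.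
apply: (clspan_min hc) => a Aa /=.
by rewrite ip_conj ipBr h // subrr conjc0.
Qed.

Lemma bounded_ext A T T' : bounded_op T -> bounded_op T' ->
  closure (lin_span A) = setT -> (forall a, A a -> T a = T' a) -> T = T'.
Proof.
move=> hT hT' hA h; apply/funext => x.
suff : closure (lin_span A) `<=` [set x | T x = T' x] by rewrite hA; apply.
apply: clspan_min => //; have [[lT _] [lT' _]] := (hT, hT'); split; first split.
- by rewrite /= !linear_map0.
- by move=> c y z /= hy hz; rewrite lT lT' hy hz.
- move=> u l hu ul /=; apply: (conv_unique (conv_bounded hT ul)).
  rewrite (_ : (fun n => _) = fun n => T' (u n)); last by apply/funext.
  exact: conv_bounded.
Qed.

End Spans.

(** * Linear extension with a prescribed Gram matrix *)

Section Extension.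
Variables (R : realType) (H1 H2 : hilbertType R) (I : Type).
Variables (a : I -> H1) (b : I -> H2) (c : R[i]).

(** A relation rather than a function, because the vectors [a i] may be linearly dependent; the Gram
    identity makes it single valued. The factor [c] is [1] for isometries of the Fock space and
    [ip y y] for the map tensoring with [y]. *)
Inductive span_graph : H1 -> H2 -> Prop :=
| span_graph0 : span_graph 0 0
| span_graphD k i x y : span_graph x y -> span_graph (k *: a i + x) (k *: b i + y).

Lemma span_graph_lin k x y x' y' :
  span_graph x y -> span_graph x' y' -> span_graph (k *: x + x') (k *: y + y').
Proof.
move=> h h'; elim: h => [|l i z w _ IH]; first by rewrite !scaler0 !add0r.
by rewrite !scalerDr !scalerA -!addrA; apply: span_graphD.
Qed.

Lemma span_graph_total x : lin_span (range a) x -> exists y, span_graph x y.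
Proof.
elim/lin_span_ind => [|k _ z [i _ <-] _ [y h]]; first by exists 0; apply: span_graph0.
by exists (k *: b i + y); apply: span_graphD.
Qed.

Lemma span_graph_range x y : span_graph x y -> lin_span (range b) y.
Proof.
elim=> [|k i z w _ h]; first exact: (lin_span_subspace _).1.
by apply: lin_span_cons => //; exists i.
Qed.

Hypothesis ab : forall i j, ip (b i) (b j) = c * ip (a i) (a j).

Lemma span_graph_ip x y x' y' : span_graph x y -> span_graph x' y' ->
  ip y y' = c * ip x x'.
Proof.
elim=> [|k i z w _ IH] h'; first by rewrite !ip0l mulr0.
rewrite !ipDl !ipZl IH // mulrDr; congr (_ + _).
rewrite mulrCA; congr (_ * _).
elim: h' => [|l j z' w' _ IH']; first by rewrite !ip0r mulr0.
by rewrite !ipDr !ipZr IH' ab; ring.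
Qed.

Let closed_graph x y := exists u v,
  [/\ forall n : nat, span_graph (u n) (v n), nconv u x & nconv v y].

Let closed_graph_ip x y x' y' : closed_graph x y -> closed_graph x' y' ->
  ip y y' = c * ip x x'.
Proof.
move=> [u [v [uv ux vy]]] [u' [v' [uv' ux' vy']]].
apply: (conv_unique (conv_ip vy vy')).
have -> : (fun n => ip (v n) (v' n)) = fun n => c * ip (u n) (u' n).
  by apply/funext => n; apply: span_graph_ip.
by apply: convM; [apply: conv_cst | apply: conv_ip].
Qed.

Let closed_graph_lin k x y x' y' :
  closed_graph x y -> closed_graph x' y' -> closed_graph (k *: x + x') (k *: y + y').
Proof.
move=> [u [v [uv ux vy]]] [u' [v' [uv' ux' vy']]].
exists (fun n => k *: u n + u' n), (fun n => k *: v n + v' n).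
by split=> [n||]; [apply: span_graph_lin|apply: convD => //; apply: convZr..].
Qed.

Let closed_graph_unique x y y' : closed_graph x y -> closed_graph x y' -> y = y'.
Proof.
move=> h h'; have := closed_graph_lin (-1) h h'; rewrite !scaleN1r addNr => h0.
have := closed_graph_ip h0 h0; rewrite ip0l mulr0 => /ipnn_eq0/eqP.
by rewrite addrC subr_eq0 => /eqP.
Qed.

Let closed_graph_total x : closure (lin_span (range a)) x -> exists y, closed_graph x y.
Proof.
move=> /closureP[u [hu ux]].
have [v uv] := choice (fun n => span_graph_total (hu n)).
suff [y vy] : exists y, nconv v y by exists y, u, v.
apply: cauchy_conv => e e0.
(* The summand [1] keeps the division meaningful when [c = 0]. *)
pose M := 1 + nrm c.
have M0 : 0 < M by rewrite ltr_pwDl // nrm_ge0.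
have eM : 0 < e / (2 * M) by rewrite divr_gt0 // mulr_gt0.
have [N hN] := (convP _ _).1 ux _ eM.
exists N => m n hm hn.
have cd : span_graph (u m - u n) (v m - v n).
  by rewrite ![_ m - _]addrC -(scaleN1r (u n)) -(scaleN1r (v n)); apply: span_graph_lin.
have := span_graph_ip cd cd; rewrite !ipnn => h.
have {}h : nrm (v m - v n) ^+ 2 = nrm c * nrm (u m - u n) ^+ 2.
  have := congr1 (@nrm R _) h; rewrite nrmM !nrmR !ger0_norm ?sqr_ge0 //.
have d : nrm (u m - u n) < e / M.
  have := ler_nrm_trans x (u m) (u n); rewrite (nrmBC x).
  have := hN _ hm; have := hN _ hn.
  have -> : e / M = e / (2 * M) + e / (2 * M) by field; rewrite gt_eqF.
  by move=> *; lra.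
rewrite -(@ltr_pXn2r _ 2) ?nnegrE ?nrm_ge0 ?(ltW e0) // h.
have d2 : nrm (u m - u n) ^+ 2 < (e / M) ^+ 2.
  by rewrite ltr_pXn2r ?nnegrE ?nrm_ge0 // ltW // divr_gt0.
apply: (@le_lt_trans _ _ (M * nrm (u m - u n) ^+ 2)).
  by rewrite ler_wpM2r ?sqr_ge0 // /M lerDr.
apply: (@lt_le_trans _ _ (M * (e / M) ^+ 2)); first by rewrite ltr_pM2l.
have -> : M * (e / M) ^+ 2 = e ^+ 2 / M by field; rewrite gt_eqF.
rewrite ler_pdivrMr // ler_peMr ?sqr_ge0 // /M lerDl nrm_ge0 //.
Qed.

Lemma isometric_extension : exists T : H1 -> H2,
  [/\ forall i, T (a i) = b i,
      forall k x y, closure (lin_span (range a)) x ->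
        closure (lin_span (range a)) y -> T (k *: x + y) = k *: T x + T y,
      forall x y, closure (lin_span (range a)) x ->
        closure (lin_span (range a)) y -> ip (T x) (T y) = c * ip x y &
      forall x, closure (lin_span (range a)) x ->
        closure (lin_span (range b)) (T x)].
Proof.
pose D := closure (lin_span (range a)).
(* Off the closed span the value is the default [0], so linearity and the inner product formula are
   claimed on the closed span only. *)
have hT x : exists y, D x -> closed_graph x y.
  have [/closed_graph_total[y h]|h] := pselect (D x); first by exists y.
  by exists 0 => /h.
have [T {}hT] := choice hT.
have Da i : D (a i) by apply: sub_clspan; exists i.
exists T; split.
- move=> i; apply: (closed_graph_unique (hT _ (Da i))).
  exists (fun=> a i), (fun=> b i); split; try exact: conv_cst.
  move=> _; have := span_graphD 1 i span_graph0; by rewrite !scale1r !addr0.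
- move=> k x y Dx Dy.
  apply: (closed_graph_unique (hT _ _)); last by apply: closed_graph_lin; apply: hT.
  by apply: (clspan_closed_subspace _).1.2.
- by move=> x y Dx Dy; apply: closed_graph_ip; apply: hT.
- move=> x /hT[u [v [uv _ vy]]]; apply/closureP; exists v; split=> // n.
  exact: span_graph_range (uv n).
Qed.

End Extension.

(** * The complex exponential *)

Section ComplexExponential.
Variable R : realType.
Implicit Types z w : R[i].

Lemma cexpD z w : cexp (z + w) = cexp z * cexp w.
Proof.
rewrite /cexp !raddfD /= expRD cosD sinD rcM.
move: (expR _) (expR _) (cos _) (cos _) (sin _) (sin _) => a b c d e f.
by apply/eqP; rewrite eq_complex /=; apply/andP; split; apply/eqP; ring.
Qed.

Lemma cexpR (x : R) : cexp x%:C = (expR x)%:C.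
Proof. by rewrite /cexp /= cos0 sin0 mulr1. Qed.

Lemma cexp0 : cexp (0 : R[i]) = 1.
Proof. by have := cexpR 0; rewrite expR0. Qed.

Lemma cexpNM z : cexp (- z) * cexp z = 1.
Proof. by rewrite -cexpD addNr cexp0. Qed.

Lemma cexp_neq0 z : cexp z != 0.
Proof.
by apply/eqP => h; have := cexpNM z; rewrite h mulr0 => /eqP; rewrite eq_sym oner_eq0.
Qed.

Lemma nrm_cexp z : nrm (cexp z) = expR (complex.Re z).
Proof.
rewrite /cexp nrmM nrmR ger0_norm ?expR_ge0 //.
rewrite (_ : nrm _ = 1) ?mulr1 //.
apply/eqP; rewrite -(@eqrXn2 _ 2) ?nrm_ge0 // nrm_sqrE /=.
by rewrite cos2Dsin2 expr1n.
Qed.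

Lemma conj_cexp z : conjc (cexp z) = cexp (conjc z).
Proof.
rewrite /cexp rmorphM /=; case: z => x y /=; rewrite cosN sinN.
by apply/eqP; rewrite eq_complex /=; apply/andP; split; apply/eqP; ring.
Qed.

(** Generic in the field, so that one algebraic identity serves both the complex partial sums and
    their real majorants. *)
Definition exp_psum (F : numFieldType) (z : F) n : F :=
  \sum_(0 <= k < n) z ^+ k / k`!%:R.

Lemma exp_psumD (F : numFieldType) (z w : F) n : exp_psum (z + w) n =
  \sum_(0 <= i < n) \sum_(0 <= j < n - i) z ^+ i / i`!%:R * (w ^+ j / j`!%:R).
Proof.
elim: n => [|n IH]; first by rewrite /exp_psum !big_nil.
rewrite /exp_psum big_nat_recr //= -/(exp_psum _ _) IH.
rewrite [RHS](eq_big_nat _ _ (F2 := fun i =>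
    \sum_(0 <= j < n - i) z ^+ i / i`!%:R * (w ^+ j / j`!%:R) +
    z ^+ i / i`!%:R * (w ^+ (n - i) / (n - i)`!%:R))); last first.
  by move=> i /andP[_ hi]; rewrite subSn // big_nat_recr.
rewrite big_split /= big_nat_recr //= subnn big_nil addr0; congr (_ + _).
rewrite addrC exprDn big_mkord mulr_suml; apply: eq_bigr => i _.
have hi : (i <= n)%N by rewrite -ltnS.
rewrite -(bin_fact hi) !natrM -mulr_natr.
have f0 k : (k`!%:R : F) != 0 by rewrite pnatr_eq0 -lt0n fact_gt0.
have b0 : ('C(n, i)%:R : F) != 0 by rewrite pnatr_eq0 -lt0n bin_gt0.
have f1 := f0 i; have f2 := f0 (n - i)%N.
by move: ('C(n, i)%:R : F) (i`!%:R : F) ((n - i)`!%:R : F) b0 f1 f2 => *; field;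
   apply/and3P.
Qed.

Lemma exp_psumM (F : numFieldType) (z w : F) n :
  exp_psum z n * exp_psum w n - exp_psum (z + w) n =
  \sum_(0 <= i < n) \sum_(n - i <= j < n) z ^+ i / i`!%:R * (w ^+ j / j`!%:R).
Proof.
rewrite exp_psumD /exp_psum mulr_suml -sumrB; apply: eq_big_nat => i /andP[_ hi].
rewrite mulr_sumr (big_cat_nat (n := n - i)) //= ?leq_subr //.
by rewrite addrAC subrr add0r.
Qed.

Lemma nrm_exp_term z k : nrm (z ^+ k / k`!%:R) = nrm z ^+ k / k`!%:R.
Proof.
rewrite nrmM nrmV nrmX; congr (_ / _).
by rewrite -rc_nat nrmR ger0_norm.
Qed.

(** The Cauchy product defect is a sum of monomials with positive coefficients, so its norm is at
    most the same defect at the norms. There it tends to zero by the addition law of [expR]. *)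
Lemma nrm_exp_psumM z w n :
  nrm (exp_psum z n * exp_psum w n - exp_psum (z + w) n) <=
  exp_psum (nrm z) n * exp_psum (nrm w) n - exp_psum (nrm z + nrm w) n.
Proof.
rewrite !exp_psumM; apply: (le_trans (nrm_sum _ _ _)); apply: ler_sum => i _.
apply: (le_trans (nrm_sum _ _ _)); apply: ler_sum => j _.
by rewrite nrmM !nrm_exp_term.
Qed.

Lemma cvg_exp_psum (x : R) : exp_psum x @ \oo --> expR x.
Proof.
rewrite /expR.
have -> : exp_psum x = series (exp_coeff x).
  by apply/funext => n; rewrite /exp_psum /series /=.
exact: is_cvg_series_exp_coeff.
Qed.

Lemma exp_psum_real (x : R) n : exp_psum x%:C n = (exp_psum x n)%:C.
Proof.
rewrite /exp_psum rmorph_sum; apply: eq_bigr => k _.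
by rewrite rmorphM fmorphV rmorphXn rmorph_nat.
Qed.

Lemma conv_exp_psumR (x : R) : nconv (exp_psum x%:C) (cexp x%:C).
Proof.
apply/conv_complex; rewrite cexpR.
have -> : (fun n => complex.Re (exp_psum x%:C n)) = exp_psum x.
  by apply/funext => n; rewrite exp_psum_real.
have -> : (fun n => complex.Im (exp_psum x%:C n)) = fun=> 0.
  by apply/funext => n; rewrite exp_psum_real.
by split; [apply: cvg_exp_psum | apply: cvg_cst].
Qed.

Lemma exp_term_im (y : R) k :
  ('i * y%:C) ^+ k / k`!%:R = cos_coeff y k +i* sin_coeff y k :> R[i].
Proof.
rewrite cos_coeffE sin_coeffE /=.
have -> : ('i * y%:C) ^+ k / k`!%:R = 'i ^+ k * (y ^+ k / k`!%:R : R)%:C :> R[i].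
  by rewrite rcM rcV rcX rc_nat exprMn mulrA.
rewrite -![_ / k`!%:R * y ^+ k]mulrA ![_^-1 * y ^+ k]mulrC.
set c : R := y ^+ k / _.
have -> : ('i : R[i]) ^+ k = 'i ^+ (odd k) * (-1) ^+ k./2.
  by rewrite -{1}(odd_double_half k) exprD -mul2n exprM sqr_i.
have -> : ((-1) ^+ k./2 : R[i]) = ((-1) ^+ k./2 : R)%:C.
  by rewrite rmorphXn rmorphN1.
case: (boolP (odd k)) => ok /=; rewrite ?expr1 ?expr0.
  have -> : k.-1./2 = k./2.
    by rewrite -[in LHS](odd_double_half k) ok add1n /= doubleK.
  by apply/eqP; rewrite eq_complex /=; apply/andP; split; apply/eqP; ring.
by apply/eqP; rewrite eq_complex /=; apply/andP; split; apply/eqP; ring.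
Qed.

Lemma conv_exp_psumI (y : R) : nconv (exp_psum ('i * y%:C)) (cexp ('i * y%:C)).
Proof.
have -> : cexp ('i * y%:C) = cos y +i* sin y.
  have -> : 'i * y%:C = 0 +i* y :> R[i].
    by apply/eqP; rewrite eq_complex /=; apply/andP; split; apply/eqP; ring.
  by rewrite /cexp /= expR0 mul1r.
apply/conv_complex => /=.
have -> : (fun n => complex.Re (exp_psum ('i * y%:C) n)) = series (cos_coeff y).
  apply/funext => n; rewrite /exp_psum /series /= raddf_sum.
  by apply: eq_bigr => k _; rewrite exp_term_im.
have -> : (fun n => complex.Im (exp_psum ('i * y%:C) n)) = series (sin_coeff y).
  apply/funext => n; rewrite /exp_psum /series /= raddf_sum.
  by apply: eq_bigr => k _; rewrite exp_term_im.
split; first by rewrite cos.unlock; apply: is_cvg_series_cos_coeff.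
by rewrite sin.unlock; apply: is_cvg_series_sin_coeff.
Qed.

(** Connects the definition of [cexp] through [expR], [cos] and [sin] with the power series that
    inner products of exponential vectors produce. The two axes come from the real series, and the
    Cauchy product estimate joins them. *)
Lemma conv_exp_psum z : nconv (exp_psum z) (cexp z).
Proof.
pose x := complex.Re z; pose y := complex.Im z.
have zE : z = x%:C + 'i * y%:C by rewrite /x /y -complexE.
rewrite zE cexpD.
have h := convM (conv_exp_psumR x) (conv_exp_psumI y).
pose d n := exp_psum x%:C n * exp_psum ('i * y%:C) n - exp_psum (x%:C + 'i * y%:C) n.
have hd : nconv d 0.
  pose a := nrm x%:C; pose b := nrm ('i * y%:C).
  apply: (conv_squeeze (b := fun n =>
     exp_psum a n * exp_psum b n - exp_psum (a + b) n)).
    by move=> n; rewrite subr0 nrm_exp_psumM.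
  rewrite -(subrr (expR (a + b))); apply: cvgB; last exact: cvg_exp_psum.
  by rewrite expRD; apply: cvgM; apply: cvg_exp_psum.
have := convB h hd; rewrite subr0.
by rewrite (_ : (fun n => _ ) = exp_psum (x%:C + 'i * y%:C)) //;
   apply/funext => n; rewrite /d opprB addrC subrK.
Qed.

(** Multiply [1 - t <= expR (- t)] by [expR t]. *)
Lemma expR_sub1_le (t : R) : 0 <= t -> expR t - 1 <= t * expR t.
Proof.
move=> t0; have := expR_ge1Dx (- t); have := expRxMexpNx_1 t.
by have := expR_gt0 t; nra.
Qed.

Lemma nrm_cexp_sub1 z : nrm (cexp z - 1) <= nrm z * expR (nrm z).
Proof.
apply: le_trans (expR_sub1_le (nrm_ge0 z)).
have h1 : (fun n => nrm (exp_psum z n.+1 - 1)) @ \oo --> nrm (cexp z - 1).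
  apply: conv_nrm; apply: convB (conv_cst _).
  by have := conv_shift 1 (conv_exp_psum z); under eq_fun do rewrite addn1.
have h2 : (fun n => exp_psum (nrm z) n.+1 - 1) @ \oo --> expR (nrm z) - 1.
  apply: cvgB (cvg_cst _); have := @cvg_exp_psum (nrm z).
  by rewrite -cvg_shiftS.
apply: (ler_cvg_to h1 h2); apply: nearW => n.
rewrite /exp_psum !big_nat_recl // !expr0 fact0 !divr1 ![1 + _]addrC !addrK.
by apply: (le_trans (nrm_sum _ _ _)); apply: ler_sum => i _; rewrite nrm_exp_term.
Qed.

Lemma nrm_cexp_sub2 z : nrm (cexp z - 1 - z) <= nrm z ^+ 2 * expR (nrm z).
Proof.
have hz := nrm_ge0 z.
have : expR (nrm z) - 1 - nrm z <= nrm z ^+ 2 * expR (nrm z).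
  by have := expR_sub1_le hz; have := expR_gt0 (nrm z); nra.
apply: le_trans.
have h1 : (fun n => nrm (exp_psum z n.+2 - 1 - z)) @ \oo --> nrm (cexp z - 1 - z).
  apply: conv_nrm; apply: convB (conv_cst _); apply: convB (conv_cst _).
  by have := conv_shift 2 (conv_exp_psum z); under eq_fun do rewrite addn2.
have h2 : (fun n => exp_psum (nrm z) n.+2 - 1 - nrm z) @ \oo -->
    expR (nrm z) - 1 - nrm z.
  apply: cvgB (cvg_cst _); apply: cvgB (cvg_cst _).
  have := @cvg_exp_psum (nrm z).
  by rewrite -(cvg_shiftn 2); under eq_fun do rewrite addn2.
apply: (ler_cvg_to h1 h2); apply: nearW => n.
have e (F : numFieldType) (x : F) : exp_psum x n.+2 - 1 - x =
    \sum_(0 <= i < n) x ^+ i.+2 / i.+2`!%:R.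
  rewrite /exp_psum !big_nat_recl // expr0 fact0 divr1 expr1 (_ : 1`! = 1%N) // divr1.
  by ring.
rewrite !e.
by apply: (le_trans (nrm_sum _ _ _)); apply: ler_sum => i _; rewrite nrm_exp_term.
Qed.

(* Compares the two products factor by factor; [1 + a] and [cexp a] are both
   bounded by [expR |a|]. *)
Lemma prod_near_cexp n (a : 'I_n -> R[i]) :
  nrm (\prod_(k < n) (1 + a k) - cexp (\sum_(k < n) a k)) <=
  expR (\sum_(k < n) nrm (a k)) * \sum_(k < n) nrm (a k) ^+ 2.
Proof.
elim: n a => [|n IH] a.
  by rewrite !big_ord0 cexp0 subrr nrm0 mulr0.
rewrite !big_ord_recl; move: (IH (a \o lift ord0)) => /=.
set p := \prod_(i < n) _; set s := \sum_(i < n) a _.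
set t := \sum_(i < n) nrm (a _); set q := \sum_(i < n) nrm (a _) ^+ 2.
move: (a ord0) => b h.
have -> : (1 + b) * p - cexp (b + s) =
   (1 + b) * (p - cexp s) + (- (cexp b - 1 - b)) * cexp s.
  by rewrite cexpD; ring.
apply: (le_trans (ler_nrmD _ _)).
have h1 : nrm (1 + b) <= expR (nrm b).
  apply: (le_trans (ler_nrmD _ _)); rewrite nrm1; exact: expR_ge1Dx.
have h2 : nrm (cexp s) <= expR t.
  rewrite nrm_cexp ler_expR; apply: (le_trans (Re_le _)); exact: nrm_sum.
have h3 := nrm_cexp_sub2 b.
rewrite expRD [leRHS]mulrDr [leRHS]addrC; apply: lerD.
  rewrite nrmM -mulrA; apply: ler_pM => //; exact: nrm_ge0.
rewrite nrmM nrmN [expR _ * _ * _]mulrAC [expR _ * nrm b ^+ 2]mulrC.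
by apply: ler_pM => //; exact: nrm_ge0.
Qed.

End ComplexExponential.

(** * Exponential vectors *)

(** Since [i! <= (i + n)!], the tail is dominated term by term by [t ^+ n] times the exponential
    series. *)
Lemma expR_remainder (R : realType) (t : R) n :
  0 <= t -> expR t - exp_psum t n <= t ^+ n * expR t.
Proof.
move=> t0.
have h1 : (fun m => exp_psum t (m + n) - exp_psum t n) @ \oo -->
    expR t - exp_psum t n.
  apply: cvgB (cvg_cst _).
  by have := @cvg_exp_psum _ t; rewrite -(cvg_shiftn n).
have h2 : (fun m => t ^+ n * exp_psum t m) @ \oo --> t ^+ n * expR t.
  by apply: cvgM; [apply: cvg_cst | apply: cvg_exp_psum].
apply: (ler_cvg_to h1 h2); apply: nearW => m.
rewrite /exp_psum [in leLHS](big_cat_nat (n := n)) ?leq_addl //=.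
rewrite addrAC subrr add0r -{1}[n]add0n big_addn addnK mulr_sumr.
apply: ler_sum => i _; rewrite exprD [t ^+ i * _]mulrC -mulrA.
rewrite ler_wpM2l ?exprn_ge0 // ler_wpM2l ?exprn_ge0 //.
rewrite lef_pV2 ?posrE ?ltr0n ?fact_gt0 // ler_nat.
by rewrite leq_fact ?leq_addr.
Qed.

Lemma conv_cexp (R : realType) (z : nat -> R[i]) w :
  nconv z w -> nconv (fun n => cexp (z n)) (cexp w).
Proof.
move=> h.
apply: (conv_squeeze (b := fun n =>
  nrm (cexp w) * (nrm (z n - w) * expR (nrm (z n - w))))).
  move=> n; have -> : cexp (z n) - cexp w = cexp w * (cexp (z n - w) - 1).
    by rewrite mulrBr mulr1 -cexpD [w + _]addrC subrK.
  by rewrite nrmM ler_wpM2l ?nrm_ge0 // nrm_cexp_sub1.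
have -> : (0 : R) = nrm (cexp w) * (0 * expR 0) by rewrite mul0r mulr0.
apply: cvgM; first exact: cvg_cst.
apply: cvgM => //.
by have := @continuous_expR R 0; apply: (cvg_comp _ _ h).
Qed.

Section FockBasics.
Variables (R : realType) (K : hilbertType R) (G : symFock K).
Implicit Types (u v w : K) (S : set K).

Local Notation e := (expv G).

Definition tpow u n : G := stens G (fun _ : 'I_n => u).

Lemma ip_stens_tpow n (z : 'I_n -> K) w :
  ip (stens G z) (tpow w n) = \prod_(i < n) ip (z i) w.
Proof.
by rewrite ip_stens sumr_const card_Sn mulrnAr -mulrnAl -[_ *+ _]mulr_natr
  mulVf ?mul1r // pnatr_eq0 -lt0n fact_gt0.
Qed.

Lemma ip_tpow u v n : ip (tpow u n) (tpow v n) = ip u v ^+ n.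
Proof. by rewrite ip_stens_tpow prodr_const card_ord. Qed.

Lemma ip_tpow_neq u v m n : m <> n -> ip (tpow u m) (tpow v n) = 0.
Proof. exact: ip_stens_neq. Qed.

(** [stens] is known only through its inner products, so homogeneity has to be recovered from the
    vanishing of a squared norm. *)
Lemma tpowZ (a : R[i]) u n : tpow (a *: u) n = a ^+ n *: tpow u n.
Proof.
apply/eqP; rewrite -subr_eq0; apply/eqP/ipnn_eq0.
rewrite !(ipBl, ipBr, ipZl, ipZr) !ip_tpow !ipZl !ipZr !exprMn rmorphXn /=.
by ring.
Qed.

Definition expv_coef n : R := (Num.sqrt n`!%:R)^-1.

Lemma expv_coef_sqr n : (expv_coef n)%:C * (expv_coef n)%:C = (n`!%:R)^-1.
Proof.
rewrite -rcM -invfM -expr2 sqr_sqrtr ?ler0n // rcV; congr (_^-1).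
exact: rc_nat.
Qed.

Lemma expv_coef_neq0 n : (expv_coef n)%:C != 0.
Proof.
apply/eqP => /complexI/eqP; rewrite invr_eq0 sqrtr_eq0 leNgt.
by rewrite ltr0n fact_gt0.
Qed.

Definition expv_psum u n : G :=
  \sum_(0 <= k < n) (expv_coef k)%:C *: tpow u k.

Lemma ip_tpow_psum u v j n : ip (tpow u j) (expv_psum v n) =
  if (j < n)%N then (expv_coef j)%:C * ip u v ^+ j else 0.
Proof.
rewrite /expv_psum; elim: n => [|n IH]; first by rewrite big_nil ip0r.
rewrite big_nat_recr //= ipDr ipZr IH ltnS.
case: (ltngtP j n) => [h|h|->].
- by rewrite ip_tpow_neq ?mulr0 ?addr0 // => jn; rewrite jn ltnn in h.
- by rewrite ip_tpow_neq ?mulr0 ?addr0 // => jn; rewrite jn ltnn in h.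
- by rewrite ip_tpow add0r.
Qed.

Lemma ip_psum u v m n : (m <= n)%N ->
  ip (expv_psum u m) (expv_psum v n) = exp_psum (ip u v) m.
Proof.
move=> mn; rewrite {1}/expv_psum ip_suml /exp_psum; apply: eq_big_nat => k /andP[_ km].
rewrite ipZl conjR ip_tpow_psum (leq_trans km mn) mulrA expv_coef_sqr.
by rewrite mulrC.
Qed.

Lemma exp_psum_ipnn u n : exp_psum (ip u u) n = (exp_psum (nrm u ^+ 2) n)%:C.
Proof. by rewrite ipnn exp_psum_real. Qed.

Lemma nrm_psumB u m n : (m <= n)%N -> nrm (expv_psum u n - expv_psum u m) ^+ 2 =
  exp_psum (nrm u ^+ 2) n - exp_psum (nrm u ^+ 2) m.
Proof.
move=> mn; apply: complexI; rewrite -ipnn !(ipBl, ipBr).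
rewrite (ip_conj (expv_psum u m) (expv_psum u n)) !ip_psum // !exp_psum_ipnn.
by rewrite conjR rcB subrr subr0.
Qed.

Lemma conv_expv u : nconv (expv_psum u) (e u).
Proof.
suff [l hl] : exists l, nconv (expv_psum u) l.
  have -> : e u = l; last by [].
  apply/cvg_lim; first exact: norm_hausdorff.
  exact/cvgn_conv.
apply: cauchy_conv => d d0.
have d2 : 0 < d ^+ 2 / 2 by rewrite divr_gt0 ?exprn_gt0.
have /cvgrPdist_lt/(_ _ d2)[N _ hN] := @cvg_exp_psum _ (nrm u ^+ 2).
have hm m n : (N <= m)%N -> (m <= n)%N ->
    nrm (expv_psum u n - expv_psum u m) < d.
  move=> Nm mn; rewrite -(@ltr_pXn2r _ 2) ?nnegrE ?nrm_ge0 ?(ltW d0) //.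
  rewrite nrm_psumB //.
  have := hN m Nm; have := hN n (leq_trans Nm mn); rewrite /= !ltr_norml.
  move: (expR _) (exp_psum _ m) (exp_psum _ n) => a b c /andP[? ?] /andP[? ?].
  by lra.
exists N => m n Nm Nn; case/orP: (leq_total m n) => h; last exact: hm.
by rewrite nrmBC; apply: hm.
Qed.

Lemma ip_expv u v : ip (e u) (e v) = cexp (ip u v).
Proof.
apply: (conv_unique (conv_ip (conv_expv u) (conv_expv v))).
rewrite (_ : (fun n => _) = exp_psum (ip u v)); first exact: conv_exp_psum.
by apply/funext => n; rewrite ip_psum.
Qed.

Lemma ip_tpow_expv u v n :
  ip (tpow u n) (e v) = (expv_coef n)%:C * ip u v ^+ n.
Proof.
have := conv_shift n.+1 (conv_ip (conv_cst (tpow u n)) (conv_expv v)).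
move/conv_unique; apply.
rewrite (_ : (fun m => _) = fun=> (expv_coef n)%:C * ip u v ^+ n).
  exact: conv_cst.
by apply/funext => m; rewrite ip_tpow_psum leq_addl.
Qed.

Lemma ip_psum_expv u v n : ip (expv_psum u n) (e v) = exp_psum (ip u v) n.
Proof.
rewrite /expv_psum ip_suml /exp_psum; apply: eq_big_nat => k _.
by rewrite ipZl conjR ip_tpow_expv mulrA expv_coef_sqr mulrC.
Qed.

Lemma nrm_expv_psumB u n :
  nrm (e u - expv_psum u n) ^+ 2 = expR (nrm u ^+ 2) - exp_psum (nrm u ^+ 2) n.
Proof.
apply: complexI; rewrite -ipnn !(ipBl, ipBr) ip_expv ip_psum // ip_psum_expv.
rewrite (ip_conj (expv_psum u n)) ip_psum_expv exp_psum_ipnn conjR ipnn cexpR.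
by rewrite rcB subrr subr0.
Qed.

Lemma expv_neq0 u : e u <> 0.
Proof.
move=> h; have := ip_expv u u; rewrite h ip0l => /esym/eqP.
by rewrite (negPf (cexp_neq0 _)).
Qed.

Lemma conv_expv_seq (x : nat -> K) u : nconv x u -> nconv (fun n => e (x n)) (e u).
Proof.
move=> h; have h2 : nconv (fun n => ip (e (x n) - e u) (e (x n) - e u)) 0.
  have -> : (0 : R[i]) = cexp (ip u u) - cexp (ip u u) - (cexp (ip u u) - cexp (ip u u)).
    by rewrite !subrr.
  have -> : (fun n => ip (e (x n) - e u) (e (x n) - e u)) = (fun n =>
     cexp (ip (x n) (x n)) - cexp (ip (x n) u) -
     (cexp (ip u (x n)) - cexp (ip u u))).
    by apply/funext => n; rewrite !(ipBl, ipBr) !ip_expv.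
  by apply: convB; apply: convB; apply: conv_cexp; apply: conv_ip;
    first [exact: h | exact: conv_cst].
apply: conv_squeeze_sqr h2 => n /=.
by rewrite subr0 ipnn nrmR ler_norm.
Qed.

(** The one-particle vector of [u], which is also the derivative of [e (x *: u)] in [x] at [0]. *)
Definition one u : G := tpow u 1.

Lemma ip_one u v : ip (one u) (one v) = ip u v.
Proof. by rewrite ip_tpow expr1. Qed.

Lemma nrm_one u : nrm (one u) = nrm u.
Proof.
apply/eqP; rewrite -(@eqrXn2 _ 2) ?nrm_ge0 //; apply/eqP/complexI.
by rewrite -!ipnn ip_one.
Qed.

Lemma ip_one_expv u v : ip (one u) (e v) = ip u v.
Proof.
rewrite ip_tpow_expv expr1 /expv_coef (_ : 1`! = 1%N) //.
by rewrite sqrtr1 invr1 mul1r.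
Qed.

Lemma one_linear (a : R[i]) u v : one (a *: u + v) = a *: one u + one v.
Proof.
apply/eqP; rewrite -subr_eq0; apply/eqP/ipnn_eq0.
by rewrite !(ipBl, ipBr, ipDl, ipDr, ipZl, ipZr) !ip_one
  !(ipDl, ipDr, ipZl, ipZr); ring.
Qed.

Lemma oneZ (a : R[i]) u : one (a *: u) = a *: one u.
Proof. by rewrite /one tpowZ expr1. Qed.

Lemma expv_inj : injective e.
Proof. by move=> u v h; apply: ip_ext => w; rewrite -!ip_one_expv h. Qed.

Lemma nrm_expv_sub2 v :
  nrm (e v - e 0 - one v) ^+ 2 <= nrm v ^+ 4 * expR (nrm v ^+ 2).
Proof.
have -> : nrm (e v - e 0 - one v) ^+ 2 =
    expR (nrm v ^+ 2) - exp_psum (nrm v ^+ 2) 2.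
  apply: complexI; rewrite -ipnn !(ipBl, ipBr) !ip_expv ip_one ip_one_expv.
  rewrite (ip_conj (one v) (e v)) (ip_conj (one v) (e 0)) !ip_one_expv.
  rewrite !ip0l !ip0r cexp0 conjc0 ipnn conjR cexpR rcB /exp_psum.
  rewrite !big_nat_recr // big_nil /= expr0 fact0 (_ : 1`! = 1%N) //.
  by rewrite !divr1 expr1 add0r rcD; ring.
by rewrite -[4%N]/(2 * 2)%N exprM; apply: expR_remainder; rewrite sqr_ge0.
Qed.

(** A divided difference: remove from [e (t u)] the lower tensor powers, which are in the span by
    induction, divide by [t ^+ n] and let [t] tend to zero. What remains is a nonzero multiple of
    the [n]-th tensor power. *)
Lemma tpow_clspan S u n : subspace S -> S u ->
  closure (lin_span (e @` S)) (tpow u n).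
Proof.
move=> hS Su; set E := closure _.
have [hE Ec] : closed_subspace E by exact: clspan_closed_subspace.
elim/ltn_ind: n => n IH.
pose t (m : nat) : R := m.+1%:R^-1.
have t0 m : 0 < t m by rewrite invr_gt0 ltr0n.
have t1 m : t m <= 1 by rewrite invf_le1 ?ltr0n // ler1n.
pose x m := (t m ^- n)%:C *: (e ((t m)%:C *: u) - expv_psum ((t m)%:C *: u) n).
have xE m : E (x m).
  apply: (subspaceZ _ hE); apply: (subspaceB hE).
    by apply: sub_clspan; exists ((t m)%:C *: u) => //; apply: subspaceZ.
  rewrite /expv_psum big_mkord; apply: (subspace_sum _ hE) => k _.
  by rewrite tpowZ scalerA; apply: (subspaceZ _ hE); apply: IH.
suff hx : nconv x ((expv_coef n)%:C *: tpow u n).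
  have := subspaceZ ((expv_coef n)%:C^-1) hE (Ec _ _ xE hx).
  by rewrite scalerA mulVf ?scale1r // expv_coef_neq0.
(* The squared norm of the remainder is of order [t ^+ (2 * n.+1)]; dividing by [t ^+ (2 * n)]
   leaves the factor [t ^+ 2] in front of [c]. *)
pose c : R := (nrm u ^+ 2) ^+ n.+1 * expR (nrm u ^+ 2).
have hb m : nrm (x m - (expv_coef n)%:C *: tpow u n) ^+ 2 <= t m ^+ 2 * c.
  have tn0 : t m ^+ n != 0 by rewrite expf_neq0 // gt_eqF.
  have -> : x m - (expv_coef n)%:C *: tpow u n =
     (t m ^- n)%:C *: (e ((t m)%:C *: u) - expv_psum ((t m)%:C *: u) n.+1).
    rewrite [in RHS]/expv_psum big_nat_recr //= opprD addrA [in RHS]scalerBr.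
    congr (_ - _); rewrite tpowZ !scalerA -rcX -!rcM; congr (_%:C *: _).
    by field.
  rewrite nrmZ nrmR exprMn nrm_expv_psumB.
  have -> : nrm ((t m)%:C *: u) ^+ 2 = t m ^+ 2 * nrm u ^+ 2.
    by rewrite nrmZ nrmR exprMn real_normK ?num_real.
  set s := t m ^+ 2 * nrm u ^+ 2.
  have s0 : 0 <= s by rewrite mulr_ge0 // sqr_ge0.
  have su : s <= nrm u ^+ 2.
    by rewrite ler_piMl ?sqr_ge0 // expr_le1 // ltW.
  apply: (@le_trans _ _ (`|t m ^- n| ^+ 2 * (s ^+ n.+1 * expR (nrm u ^+ 2)))).
    rewrite ler_wpM2l ?sqr_ge0 //; apply: (le_trans (expR_remainder _ s0)).
    by rewrite ler_wpM2l ?exprn_ge0 // ler_expR.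
  have tt : (t m ^- n) ^+ 2 * (t m ^+ 2) ^+ n.+1 = t m ^+ 2.
    rewrite exprVn [(t m ^+ n) ^+ 2]exprAC [X in _ * X]exprS mulrCA mulVf ?mulr1 //.
    by rewrite expf_neq0 // expf_neq0 // gt_eqF.
  by rewrite real_normK ?num_real // /s exprMn /c !mulrA tt.
apply: (conv_squeeze_sqr hb).
have -> : (0 : R) = 0 * 0 * c by rewrite !mul0r.
by apply: cvgM; [apply: cvgM; exact: cvg_harmonic | exact: cvg_cst].
Qed.

(** Ryser's formula for the permanent. Expanding the product gives a sum over maps [f], each
    weighted by a signed count of the sets [J] containing its image; the count vanishes unless [f]
    is onto, that is, a permutation. *)
Lemma sum_sets_prod n (a : 'I_n -> 'I_n -> R[i]) :
  \sum_(J : {set 'I_n}) (-1) ^+ #|~: J| * \prod_i \sum_(j in J) a i j =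
  \sum_(s : 'S_n) \prod_i a i (s i).
Proof.
have h (f : {ffun 'I_n -> 'I_n}) :
    \sum_(J : {set 'I_n} | [forall i, f i \in J]) (-1) ^+ #|~: J| =
    (injectiveb f)%:R :> R[i].
  (* Expanding this product picks [1] on [J] and the second summand off [J]; the latter is [0] at
     points of the image of [f], so only the sets [J] containing the image survive, with sign
     [(-1) ^+ #|~: J|]. *)
  have -> : (injectiveb f)%:R =
      \prod_(j : 'I_n) (1 + (if j \in codom f then 0 else -1)) :> R[i].
    have [fi|fi] := boolP (injectiveb f).
      rewrite big1 // => j _; rewrite (_ : j \in codom f) ?addr0 //.
      move/injectiveP: fi => fi; have [g gf fg] := injF_bij fi.
      by rewrite -(fg j) codom_f.
    have [j jf] : exists j, j \notin codom f.
      apply/existsP; apply: contraR fi; rewrite negb_exists => /forallP fs.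
      apply/card_uniqP; rewrite size_codom; apply: eq_card => j.
      by rewrite inE; have := fs j; rewrite negbK.
    by rewrite (bigD1 j) //= (negPf jf) subrr mul0r.
  rewrite bigA_distr /= [LHS]big_mkcond; apply: eq_bigr => J _.
  have [/forallP fJ|/forallPn[i fi]] := boolP [forall i, f i \in J].
    rewrite (bigID (mem J)) /= big1 ?mul1r => [|j ->//].
    rewrite (eq_bigr (fun=> -1)) => [|j /[dup] jJ /negPf ->].
      by rewrite prodr_const; congr (_ ^+ _); apply: eq_card => j; rewrite !inE.
    case: (boolP (_ \in _)) => // /codomP[i ji]; move: jJ; rewrite ji.
    by rewrite fJ.
  by rewrite (bigD1 (f i)) //= (negPf fi) codom_f mul0r.
under eq_bigr do rewrite bigA_distr_big mulr_sumr.
rewrite (exchange_big_dep predT) //=.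
under eq_bigr => f _ do rewrite -mulr_suml.
rewrite (bigID (fun f : {ffun 'I_n -> 'I_n} => injectiveb f)) /= addrC big1 ?add0r.
  rewrite (reindex (@pval _)) /=; last first.
    pose in_Sn := insubd (1%g : 'S_n).
    by exists in_Sn => /= f Uf; first apply: val_inj; apply: insubdK.
  apply: eq_big => [s|s /= si]; first exact: (valP s).
  rewrite (eq_bigl (fun J : {set 'I_n} => [forall i, pval s i \in J])).
    rewrite h si mul1r; apply: eq_bigr => i _; by rewrite pvalE.
  by move=> J; apply/ffun_onP/forallP.
move=> f fi.
rewrite (eq_bigl (fun J : {set 'I_n} => [forall i, f i \in J])).
  by rewrite h (negPf fi) mul0r.
by move=> J; apply/ffun_onP/forallP.
Qed.

(** Tested against a symmetric tensor of the same degree, the left side is a permanent divided by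
    [n!] and the right side is its inclusion-exclusion expansion. *)
Lemma stens_polarization n (u : 'I_n -> K) :
  stens G u = (n`!%:R)^-1 *: \sum_(J : {set 'I_n})
    (-1) ^+ #|~: J| *: tpow (\sum_(j in J) u j) n.
Proof.
apply: (total_ip_ext (stens_total G)) => _ [m [z ->]].
rewrite ipZr ip_sumr.
have [mn|/eqP mn] := eqVneq m n; last first.
  rewrite ip_stens_neq // big1 ?mulr0 // => J _.
  by rewrite ipZr ip_stens_neq ?mulr0.
subst m; rewrite ip_stens -(sum_sets_prod (fun i j => ip (z i) (u j))); congr (_ * _).
apply: eq_bigr => J _; rewrite ipZr ip_stens_tpow; congr (_ * _).
by apply: eq_bigr => i _; rewrite ip_sumr.
Qed.

(** Polarization reduces symmetric tensors to tensor powers, and divided differences reduce these to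
    exponential vectors. Hence later identities of bounded maps need checking on exponential vectors
    only. *)
Lemma fock_subE S : subspace S -> fock_sub G S = closure (lin_span (e @` S)).
Proof.
move=> hS; apply/seteqP; split.
  apply: clspan_min; first exact: clspan_closed_subspace.
  move=> _ [n [u [Su ->]]]; rewrite stens_polarization.
  have [hE _] := clspan_closed_subspace (e @` S).
  apply: (subspaceZ _ hE); apply: (subspace_sum _ hE) => J _.
  apply: (subspaceZ _ hE); apply: tpow_clspan => //.
  exact: subspace_sum.
apply: clspan_min; first exact: clspan_closed_subspace.
move=> _ [u Su <-].
have [hE Ec] := clspan_closed_subspace
  [set x : G | exists n (u : 'I_n -> K), (forall i, S (u i)) /\ x = stens G u].
apply: Ec (conv_expv u) => n.
apply: (subspace_sum _ hE) => k _; apply: (subspaceZ _ hE); apply: sub_clspan.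
by exists k, (fun=> u).
Qed.

Lemma expv_total : closure (lin_span (range e)) = setT.
Proof.
have hT : subspace [set: K] by [].
rewrite -(fock_subE hT) -(stens_total G) /fock_sub; congr (closure (lin_span _)).
apply/seteqP; split=> x [n [u]]; first by move=> [_ ->]; exists n, u.
by move=> ->; exists n, u.
Qed.

End FockBasics.

(** * Weyl operators, second quantization and tensor products *)

Section ClosedSpanMaps.
Variables (R : realType) (H1 H2 : hilbertType R) (A : set H1) (f : H1 -> H2).
Let D := closure (lin_span A).

(** For maps that are linear and bounded only on a closed span, such as the sections of a tensor
    product of Fock subspaces. *)
Lemma clspan_map_eq0 (C : R) :
  (forall k x y, D x -> D y -> f (k *: x + y) = k *: f x + f y) ->
  (forall x, D x -> nrm (f x) <= C * nrm x) ->
  (forall a, A a -> f a = 0) -> forall x, D x -> f x = 0.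
Proof.
move=> flin fC fA.
have [[D0 DD] Dc] : closed_subspace D by exact: clspan_closed_subspace.
have f0 : f 0 = 0.
  by apply: nrm_eq0; apply/le_anti; rewrite nrm_ge0 andbT;
    have := fC 0 D0; rewrite nrm0 mulr0.
suff : D `<=` [set x | D x /\ f x = 0] by move=> h x /h[].
apply: clspan_min; last by move=> a Aa; split; [apply: sub_clspan | apply: fA].
split; first split; first by [].
  move=> k x y [Dx fx] [Dy fy]; split; first exact: DD.
  by rewrite flin // fx fy scaler0 addr0.
move=> u l hu ul; have Dl : D l by apply: (Dc u) => // n; case: (hu n).
split=> //; apply: (conv_unique (u := fun=> f l)); first exact: conv_cst.
apply: (conv_squeeze (b := fun n => C * nrm (u n - l))).
  move=> n; have [Du fu] := hu n.
  have -> : f l - 0 = - f (-1 *: l + u n).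
    by rewrite flin // fu addr0 scaleN1r opprK subr0.
  rewrite nrmN scaleN1r addrC; apply: fC.
  by rewrite addrC -scaleN1r; apply: DD.
by rewrite -(mulr0 C); apply: cvgM => //; apply: cvg_cst.
Qed.

End ClosedSpanMaps.

Section FockOperators.
Variables (R : realType) (K : hilbertType R) (G : symFock K).
Implicit Types (u v w : K) (S : set K).

Local Notation e := (expv G).

Lemma expv_bounded_ext (T T' : G -> G) : bounded_op T -> bounded_op T' ->
  (forall v, T (e v) = T' (e v)) -> T = T'.
Proof.
move=> hT hT' h; apply: (bounded_ext hT hT' (expv_total G)) => _ [v _ <-].
exact: h.
Qed.

Lemma expv_ip_ext (x y : G) : (forall v, ip (e v) x = ip (e v) y) -> x = y.
Proof.
by move=> h; apply: (total_ip_ext (expv_total G)) => _ [v _ <-]; apply: h.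
Qed.

(** The common source of Weyl operators and second quantizations: only the Gram matrix of the images
    of exponential vectors has to be computed. *)
Lemma expv_isometric_ext (b : K -> G) :
  (forall u v, ip (b u) (b v) = cexp (ip u v)) ->
  exists T : G -> G, isometry_op T /\ forall v, T (e v) = b v.
Proof.
move=> hb; have [|T [Te Tlin Tip _]] := @isometric_extension _ _ _ _ e b 1.
  by move=> u v; rewrite hb ip_expv mul1r.
exists T; split=> //; have hD x : closure (lin_span (range e)) x.
  by rewrite expv_total.
split=> [k x y|x]; first exact: Tlin.
rewrite (nrmE (T x)) (nrmE x); congr (_%:C).
apply/eqP; rewrite -(@eqrXn2 _ 2) ?nrm_ge0 //; apply/eqP/complexI.
by rewrite -!ipnn Tip // mul1r.
Qed.

Definition weyl_phase u v : R[i] := cexp (- (`|u| ^+ 2 / 2) - ip u v).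

Lemma weyl_spec u :
  unitary_op (weyl G u) /\ forall v, weyl G u (e v) = weyl_phase u v *: e (u + v).
Proof.
have hex w : exists W : G -> G,
    isometry_op W /\ forall v, W (e v) = weyl_phase w v *: e (w + v).
  apply: expv_isometric_ext => v v'.
  rewrite ipZl ipZr ip_expv /weyl_phase conj_cexp -!cexpD; congr cexp.
  have h : conjc (`|w| ^+ 2 / 2) = `|w| ^+ 2 / 2.
    by rewrite (nrmE w) -rcX -(rc_nat R 2) -rcV -rcM conjR.
  rewrite rmorphB rmorphN /= h -(ip_conj w v) !(ipDl, ipDr) ip_norm.
  by field.
apply: (@getPex _ (fun W : G -> G => unitary_op W /\
  forall v, W (e v) = weyl_phase u v *: e (u + v))).
have [W [hW We]] := hex u; have [W' [hW' We']] := hex (- u).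
exists W; split=> //; split=> //; apply/seteqP; split=> // x _.
(* The operator of [- u] supplies preimages, since the two Weyl phases cancel. *)
exists (W' x) => //.
suff h : W \o W' = idfun by have := congr1 (fun T => T x) h.
apply: expv_bounded_ext => [||v /=]; last first.
- rewrite We' (linear_mapZ _ _ hW.1) We scalerA addNKr /weyl_phase -cexpD.
  rewrite normrN ipNl ipDr ipNr ip_norm.
  have -> : - (`|u| ^+ 2 / 2) - - ip u v +
    (- (`|u| ^+ 2 / 2) - (- `|u| ^+ 2 + ip u v)) = 0 by field.
  by rewrite cexp0 scale1r.
- exact: bounded_id.
- by apply: bounded_comp; apply: isometry_bounded.
Qed.

Lemma weyl_isometry u : isometry_op (weyl G u).
Proof. by have [[]] := weyl_spec u. Qed.

Lemma weyl_bounded u : bounded_op (weyl G u).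
Proof. exact/isometry_bounded/weyl_isometry. Qed.

Lemma weyl_expv u v : weyl G u (e v) = weyl_phase u v *: e (u + v).
Proof. by have [_] := weyl_spec u. Qed.

Section SecondQuantization.
Variable V : K -> K.
Hypothesis hV : isometry_op V.

Lemma second_quant_spec : isometry_op (second_quant G V) /\
  forall v, second_quant G V (e v) = e (V v).
Proof.
have [T [hT Te]] : exists T : G -> G, isometry_op T /\ forall v, T (e v) = e (V v).
  by apply: expv_isometric_ext => u v; rewrite ip_expv isometry_ip.
have [hS Se] : bounded_op (second_quant G V) /\
    forall v, second_quant G V (e v) = e (V v).
  apply: (@getPex _ (fun S : G -> G => bounded_op S /\
    forall v, S (e v) = e (V v))).
  by exists T; split=> //; apply: isometry_bounded.
suff -> : second_quant G V = T by [].
by apply: expv_bounded_ext => // [|v]; [apply: isometry_bounded|rewrite Se Te].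
Qed.

Lemma range_subspace : subspace (range V).
Proof.
split; first by exists 0 => //; apply: linear_map0; exact: hV.1.
move=> c _ _ [u _ <-] [v _ <-]; exists (c *: u + v) => //.
exact: hV.1.
Qed.

Lemma ker_adjoint_subspace : subspace (ker_op (adjoint V)).
Proof.
have [l _] := bounded_adjoint (isometry_bounded hV).
split; first exact: linear_map0.
by move=> c u v /= hu hv; rewrite /ker_op /= l hu hv scaler0 addr0.
Qed.

Lemma ker_adjoint_range u v : ker_op (adjoint V) u -> range V v -> ip u v = 0.
Proof.
move=> hu [w _ <-]; rewrite -adjointP'; last exact: isometry_bounded.
by rewrite hu ip0l.
Qed.

Lemma second_quant_range x : fock_sub G (range V) (second_quant G V x).
Proof.
rewrite (fock_subE G range_subspace).
have [hS Se] := second_quant_spec.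
have [[F0 FD] Fc] := clspan_closed_subspace (e @` range V).
suff : closure (lin_span (range e)) `<=`
    [set x | closure (lin_span (e @` range V)) (second_quant G V x)].
  by rewrite expv_total; apply.
apply: clspan_min.
  split; first split.
  - by rewrite /= linear_map0 //; exact: hS.1.
  - by move=> c y z /= hy hz; rewrite hS.1; apply: FD.
  - move=> u l hu ul; apply: Fc (conv_bounded (isometry_bounded hS) ul) => n.
    exact: hu.
by move=> _ [v _ <-] /=; rewrite Se; apply: sub_clspan; exists (V v) => //; exists v.
Qed.

End SecondQuantization.

(** * Tensor decomposition along orthogonal subspaces *)

Section FockTensor.
Variables S1 S2 : set K.
Hypotheses (sS1 : subspace S1) (sS2 : subspace S2).
Hypothesis S12 : forall u v, S1 u -> S2 v -> ip u v = 0.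

Let F1 := fock_sub G S1.
Let F2 := fock_sub G S2.

Lemma fock_sub_sig S : subspace S ->
  fock_sub G S = closure (lin_span (range (fun i : {u | S u} => e (sval i)))).
Proof.
move=> hS; rewrite (fock_subE G hS); congr (closure (lin_span _)).
apply/seteqP; split=> _ [u Su <-]; first by exists (exist _ u Su).
by exists (sval u) => //; apply: svalP.
Qed.

Lemma expv_fock_sub S u : subspace S -> S u -> fock_sub G S (e u).
Proof. by move=> hS Su; rewrite (fock_subE G hS); apply: sub_clspan; exists u. Qed.

(* [expv_tensor u] maps [e v] to [e (u + v)] when [v] is orthogonal to [u], so
   it is tensoring with [e u]; as a multiple of a Weyl operator it is bounded on
   all of the Fock space. *)
Definition expv_tensor u (y : G) : G := cexp (`|u| ^+ 2 / 2) *: weyl G u y.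

Lemma expv_tensor_bounded u : bounded_op (expv_tensor u).
Proof.
have -> : expv_tensor u = cexp (`|u| ^+ 2 / 2) *: weyl G u by [].
exact/bounded_scale/weyl_bounded.
Qed.

Lemma expv_tensor_expv u v : S1 u -> S2 v -> expv_tensor u (e v) = e (u + v).
Proof.
move=> Su Sv; rewrite /expv_tensor weyl_expv scalerA /weyl_phase S12 // -cexpD subr0.
by rewrite addrN cexp0 scale1r.
Qed.

Lemma expv_tensor_ip u u' y y' : S1 u -> S1 u' -> F2 y -> F2 y' ->
  ip (expv_tensor u y) (expv_tensor u' y') = cexp (ip u u') * ip y y'.
Proof.
move=> Su Su'.
have hF2 : F2 = closure (lin_span (e @` S2)) by apply: fock_subE.
have step (z z' : G) : F2 z' ->
    (forall v, S2 v ->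
      ip z (expv_tensor u' (e v)) = cexp (ip u u') * ip z' (e v)) ->
    forall x, F2 x -> ip z (expv_tensor u' x) = cexp (ip u u') * ip z' x.
  move=> _ h; rewrite hF2; apply: clspan_min; last first.
    by move=> _ [v Sv <-] /=; apply: h.
  split; first split.
  - by rewrite /= (linear_map0 (expv_tensor_bounded u').1) !ip0r mulr0.
  - move=> c x x' /= hx hx'.
    by rewrite (expv_tensor_bounded u').1 !ipDr (ipZr z) (ipZr z') hx hx'; ring.
  - move=> x l hx xl /=.
    have hc := conv_bounded (expv_tensor_bounded u') xl.
    apply: (conv_unique (conv_ip (conv_cst z) hc)).
    rewrite (_ : (fun n => _) = fun n => cexp (ip u u') * ip z' (x n)).
      by apply: convM; [apply: conv_cst | apply: conv_ip => //; apply: conv_cst].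
    by apply/funext => n; apply: hx.
move=> Fy Fy'; apply: step => // v' Sv'.
move: y Fy; rewrite hF2; apply: clspan_min; last first.
  move=> _ [v Sv <-] /=; rewrite !expv_tensor_expv // !ip_expv -cexpD !(ipDl, ipDr).
  by rewrite (S12 Su Sv') (ip_conj u' v) (S12 Su' Sv) conjc0 addr0 add0r.
split; first split.
- by rewrite /= (linear_map0 (expv_tensor_bounded u).1) !ip0l mulr0.
- move=> c x x' /= hx hx'.
  by rewrite (expv_tensor_bounded u).1 !ipDl !(ipZl _ c) hx hx'; ring.
- move=> x l hx xl /=.
  have hc := conv_bounded (expv_tensor_bounded u) xl.
  apply: (conv_unique (conv_ip hc (conv_cst _))).
  rewrite (_ : (fun n => _) = fun n => cexp (ip u u') * ip (x n) (e v')).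
    by apply: convM; [apply: conv_cst | apply: conv_ip => //; apply: conv_cst].
  by apply/funext => n; apply: hx.
Qed.

(** For fixed [y] the Gram matrix of the vectors [expv_tensor u y] is [ip y y] times that of the
    [e u], which gives the map [M y] by extension. Linearity in [y] holds on exponential vectors
    because [expv_tensor u] is linear, and it passes to their closed span; the inner product formula
    for two different [y] follows by polarization. *)
Lemma fock_tensor_exists : exists m : G -> G -> G, is_fock_tensor S1 S2 m.
Proof.
have h1 : F1 = closure (lin_span (range (fun i : {u | S1 u} => e (sval i)))).
  exact: fock_sub_sig.
have hM y : exists M : G -> G, F2 y ->
    [/\ forall u, S1 u -> M (e u) = expv_tensor u y,
        forall k x x', F1 x -> F1 x' -> M (k *: x + x') = k *: M x + M x' &
        forall x x', F1 x -> F1 x' -> ip (M x) (M x') = ip y y * ip x x'].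
  have [Fy|Fy] := pselect (F2 y); last by exists idfun.
  have [|M [Me Ml Mi _]] := @isometric_extension _ _ _ {u | S1 u}
    (fun i => e (sval i)) (fun i => expv_tensor (sval i) y) (ip y y).
    move=> [u Su] [u' Su'] /=; rewrite expv_tensor_ip // ip_expv mulrC //.
  by exists M => _; rewrite h1; split=> // u Su; rewrite (Me (exist _ u Su)).
have [M {}hM] := choice hM.
exists (fun x y => M y x).
have [cF1 _] : closed_subspace F1 by exact: clspan_closed_subspace.
have [cF2 _] : closed_subspace F2 by exact: clspan_closed_subspace.
have Mnrm y x : F2 y -> F1 x -> nrm (M y x) = nrm y * nrm x.
  move=> Fy Fx; have [_ _ h] := hM y Fy; have := h x x Fx Fx.
  rewrite !ipnn -rcM => /complexI; rewrite -exprMn => /eqP.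
  by rewrite eqrXn2 ?mulr_ge0 ?nrm_ge0 // => /eqP.
have Mlin c x y y' : F1 x -> F2 y -> F2 y' ->
    M (c *: y + y') x = c *: M y x + M y' x.
  move=> Fx Fy Fy'; have Fz : F2 (c *: y + y') by apply: cF2.2.
  have [e1 l1 _] := hM y Fy; have [e2 l2 _] := hM y' Fy'.
  have [e3 l3 _] := hM _ Fz.
  apply/eqP; rewrite -subr_eq0; apply/eqP.
  pose C := nrm (c *: y + y') + (nrm c * nrm y + nrm y').
  pose f z := M (c *: y + y') z - (c *: M y z + M y' z).
  move: x Fx; rewrite h1; apply: (@clspan_map_eq0 _ _ _ _ f C); rewrite -?h1.
  - move=> k z z' Fz1 Fz1'; rewrite /f l1 // l2 // l3 //.
    rewrite scalerBr !scalerDr !scalerA [k * c]mulrC.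
    by rewrite [X in _ - X]addrACA opprD addrACA.
  - move=> z Fz1; apply: (le_trans (ler_nrmB _ _)); rewrite Mnrm // mulrDl lerD2l.
    apply: (le_trans (ler_nrmD _ _)); rewrite nrmZ !Mnrm // mulrDl mulrA //.
  - move=> _ [[u Su] _ <-] /=; rewrite /f e1 // e2 // e3 //.
    by rewrite (expv_tensor_bounded u).1 subrr.
split.
- by move=> c x x' y Fx Fx' Fy; have [_ h _] := hM y Fy; apply: h.
- by move=> c x y y' Fx Fy Fy'; apply: Mlin.
- move=> x x' y y' Fx Fx' Fy Fy'.
  have diag z : F2 z -> ip (M z x) (M z x') = ip z z * ip x x'.
    by move=> Fz; have [_ _ h] := hM z Fz; apply: h.
  (* The diagonal formula at [c *: y + y'], with the two diagonal terms removed. The values [1] and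
     ['i] of [c] give the sum and the difference of the two mixed terms. *)
  have polar c : conjc c * ip (M y x) (M y' x') + c * ip (M y' x) (M y x') =
      (conjc c * ip y y' + c * ip y' y) * ip x x'.
    have := diag (c *: y + y') (cF2.2 _ _ _ Fy Fy').
    rewrite !Mlin // !(ipDl, ipDr, ipZl, ipZr) !diag // => h.
    have -> : conjc c * ip (M y x) (M y' x') + c * ip (M y' x) (M y x') =
      (conjc c * (c * (ip y y * ip x x')) + conjc c * ip (M y x) (M y' x') +
       (c * ip (M y' x) (M y x') + ip y' y' * ip x x')) -
      conjc c * c * ip y y * ip x x' - ip y' y' * ip x x' by ring.
    by rewrite h; ring.
  have p1 := polar 1; have pi := polar 'i; rewrite conjc1 !mul1r in p1.
  have ci : conjc 'i = - 'i :> R[i].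
    by apply/eqP; rewrite eq_complex /= oppr0 !eqxx.
  have ni : ('i : R[i]) != 0.
    by apply/eqP => -[] /eqP; rewrite oner_eq0.
  rewrite ci in pi.
  have {}pi : ip (M y' x) (M y x') - ip (M y x) (M y' x') =
      (ip y' y - ip y y') * ip x x'.
    by apply: (mulfI ni); rewrite mulrA !mulrBr; move: pi; rewrite !mulNr addrC => ->;
       rewrite addrC.
  apply: (mulIf (_ : 2 != 0)); first by rewrite pnatr_eq0.
  have -> : ip (M y x) (M y' x') * 2 = ip (M y x) (M y' x') +
    ip (M y' x) (M y x') - (ip (M y' x) (M y x') - ip (M y x) (M y' x')) by ring.
  by rewrite p1 pi; ring.
- move=> u v Su Sv; have [h _ _] := hM (e v) (expv_fock_sub sS2 Sv).
  by rewrite h // expv_tensor_expv.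
Qed.

Lemma fock_tensor_spec : is_fock_tensor S1 S2 (fock_tensor G S1 S2).
Proof. exact: (getPex fock_tensor_exists). Qed.

End FockTensor.

Section Creation.
Variables (V : K -> K) (h : K).
Hypotheses (hV : isometry_op V) (Vh : ker_op (adjoint V) h).

Let hm := fock_tensor_spec (ker_adjoint_subspace hV) (range_subspace hV)
  (ker_adjoint_range hV).
Let hh : fock_sub G (ker_op (adjoint V)) (e h).
Proof. by apply: expv_fock_sub => //; apply: ker_adjoint_subspace. Qed.

Lemma creation_expv v : creation G V (e h) (e v) = e (h + V v).
Proof.
have [_ _ _ m4] := hm; have [_ Se] := second_quant_spec hV.
by rewrite /creation Se m4 //; exists v.
Qed.

Lemma nrm_creation x : nrm (creation G V (e h) x) = nrm (e h) * nrm x.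
Proof.
have [_ _ m3 _] := hm; have hS := (second_quant_spec hV).1.
have := m3 _ _ _ _ hh hh (@second_quant_range _ hV x)
  (@second_quant_range _ hV x).
rewrite (isometry_ip _ _ hS) !ipnn -rcM -exprMn => /complexI/eqP.
by rewrite eqrXn2 ?mulr_ge0 ?nrm_ge0 // => /eqP.
Qed.

Lemma creation_bounded : bounded_op (creation G V (e h)).
Proof.
have [_ m2 _ _] := hm; have hS := (second_quant_spec hV).1.
apply/bounded_opE; split=> [c x y|].
  by rewrite /creation hS.1 m2 //; apply: second_quant_range.
exists (nrm (e h)); split=> [|x]; first exact: nrm_ge0.
by rewrite nrm_creation.
Qed.

End Creation.

End FockOperators.

(** * Rigidity of Weyl-invariant forms and normal endomorphisms *)

Section Jets.
Variable R : realType.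
Implicit Types (g : R[i] -> R[i]) (a b : R[i]).

(** A complex first-order expansion at [0] with an explicit quadratic error on the unit disc. It
    plays the role of holomorphy, is stable under products, and [b] is the derivative. *)
Definition jet1 g a b := exists C : R, 0 <= C /\ forall x : R[i], nrm x <= 1 ->
  nrm (g x - a - x * b) <= C * nrm x ^+ 2.

Lemma jet1_eq g g' a b : (forall x, g x = g' x) -> jet1 g a b -> jet1 g' a b.
Proof.
by move=> h [C [C0 hC]]; exists C; split=> // x hx; rewrite -h; apply: hC.
Qed.

Lemma jet1_bound g a b : jet1 g a b ->
  exists C : R, 0 <= C /\ forall x : R[i], nrm x <= 1 -> nrm (g x) <= C.
Proof.
move=> [C [C0 hC]]; exists (C + nrm a + nrm b); split.
  by rewrite !addr_ge0 // nrm_ge0.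
move=> x x1; have h0 := hC x x1.
have -> : g x = (g x - a - x * b) + (a + x * b) by ring.
have h1 := ler_nrmD a (x * b); rewrite nrmM in h1.
have h2 : nrm x * nrm b <= nrm b by rewrite ler_piMl ?nrm_ge0.
have h3 : C * nrm x ^+ 2 <= C by rewrite ler_piMr // expr_le1 ?nrm_ge0.
apply: (le_trans (ler_nrmD _ _)); rewrite -[leRHS]addrA; apply: lerD.
  exact: le_trans h0 h3.
by apply: (le_trans h1); rewrite lerD2l.
Qed.

Lemma jet1M g a b g' a' b' : jet1 g a b -> jet1 g' a' b' ->
  jet1 (fun x => g x * g' x) (a * a') (a * b' + b * a').
Proof.
move=> hg hg'; have [M [M0 hM]] := jet1_bound hg'.
have [C [C0 hC]] := hg; have [C' [C'0 hC']] := hg'.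
exists (C * M + (nrm a + nrm b) * C' + nrm b * nrm b').
split; first by rewrite !(addr_ge0, mulr_ge0) ?nrm_ge0.
move=> x x1; have x0 := nrm_ge0 x.
have -> : g x * g' x - a * a' - x * (a * b' + b * a') =
  (g x - a - x * b) * g' x + (a + x * b) * (g' x - a' - x * b') +
  x * x * b * b' by ring.
apply: (le_trans (ler_nrmD _ _)); rewrite [leRHS]mulrDl; apply: lerD.
  apply: (le_trans (ler_nrmD _ _)); rewrite [leRHS]mulrDl.
  apply: lerD; rewrite nrmM.
    rewrite [leRHS]mulrAC; apply: ler_pM; rewrite ?nrm_ge0 //;
      [exact: hC|exact: hM].
  rewrite -[leRHS]mulrA; apply: ler_pM; rewrite ?nrm_ge0 //; last exact: hC'.
  apply: (le_trans (ler_nrmD _ _)); rewrite nrmM lerD2l ler_piMl ?nrm_ge0 //.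
by rewrite !nrmM le_eqVlt; apply/orP; left; apply/eqP; ring.
Qed.

Lemma jet1_cst a : jet1 (fun=> a) a 0.
Proof.
exists 0; split=> // x _; rewrite mulr0 subr0 subrr nrm0 mul0r //.
Qed.

Lemma jet1_cexp (s : R[i]) : jet1 (fun x => cexp (x * s)) 1 s.
Proof.
exists (nrm s ^+ 2 * expR (nrm s)); split.
  by rewrite mulr_ge0 ?sqr_ge0 ?expR_ge0.
move=> x x1; apply: (le_trans (nrm_cexp_sub2 _)).
rewrite nrmM.
have -> : nrm s ^+ 2 * expR (nrm s) * nrm x ^+ 2 =
  (nrm x * nrm s) ^+ 2 * expR (nrm s) by ring.
by rewrite ler_wpM2l ?sqr_ge0 // ler_expR ler_piMl ?nrm_ge0.
Qed.

Lemma quadratic_small (d C : R) : 0 <= d ->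
  (forall t, 0 < t -> t <= 1 -> t * d <= C * t ^+ 2) -> d = 0.
Proof.
move=> d0 h; apply/le_anti; rewrite d0 andbT leNgt; apply/negP => dp.
have C0 : 0 < C by have := h 1 ltr01 (lexx _); nra.
(* Chosen so that [t <= 1] and [C * t < d / 2], which contradicts [d <= C * t]. *)
pose t := d / (2 * C + 2 * d).
have D0 : 0 < 2 * C + 2 * d by lra.
have tD : t * (2 * C + 2 * d) = d by rewrite mulfVK // gt_eqF.
have t0 : 0 < t by rewrite divr_gt0.
have t1 : t <= 1 by rewrite ler_pdivrMr // mul1r; lra.
have := h t t0 t1; rewrite expr2 mulrCA ler_pM2l // => h2.
by nra.
Qed.

(** The linear terms [x * b] and [conjc x * conjc b'] agree to second order. Real [x] gives
    [b = conjc b'], imaginary [x] gives [b = - conjc b']. *)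
Lemma jet1_antiholomorphic g a b a' b' :
  jet1 g a b -> jet1 (fun x => conjc (g x)) a' b' -> b = 0.
Proof.
move=> [C [C0 hC]] [C' [C'0 hC']].
have ga : g 0 = a.
  apply/eqP; rewrite -subr_eq0; apply/eqP/nrm_eq0/le_anti; rewrite nrm_ge0 andbT.
  have := hC 0; rewrite nrm0 mul0r subr0 expr0n mulr0; exact.
have ga' : conjc (g 0) = a'.
  apply/eqP; rewrite -subr_eq0; apply/eqP/nrm_eq0/le_anti; rewrite nrm_ge0 andbT.
  have := hC' 0; rewrite nrm0 mul0r subr0 expr0n mulr0; exact.
have key (x : R[i]) : nrm x <= 1 ->
    nrm (x * b - conjc x * conjc b') <= (C + C') * nrm x ^+ 2.
  move=> x1; have h1 := hC x x1; have h2 := hC' x x1.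
  rewrite -nrmJ !rmorphB /= rmorphM /= conjcK -ga' conjcK ga in h2.
  have -> : x * b - conjc x * conjc b' =
    (g x - a - conjc x * conjc b') - (g x - a - x * b) by ring.
  by apply: (le_trans (ler_nrmB _ _)); rewrite mulrDl addrC; apply: lerD.
have hr : nrm (b - conjc b') = 0.
  apply: (@quadratic_small _ (C + C')); first exact: nrm_ge0.
  move=> t t0 t1; have := key t%:C.
  rewrite nrmR (ger0_norm (ltW t0)) => /(_ t1); rewrite conjR -mulrBr nrmM nrmR.
  by rewrite (ger0_norm (ltW t0)).
have hi : nrm (b + conjc b') = 0.
  apply: (@quadratic_small _ (C + C')); first exact: nrm_ge0.
  move=> t t0 t1; have := key ('i * t%:C).
  have ni : nrm ('i : R[i]) = 1.
    apply/eqP; rewrite -(@eqrXn2 _ 2) ?nrm_ge0 // nrm_sqrE /=.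
    by rewrite expr0n add0r.
  rewrite nrmM nrmR ni mul1r (ger0_norm (ltW t0)) => /(_ t1).
  have -> : 'i * t%:C * b - conjc ('i * t%:C) * conjc b' =
     'i * t%:C * (b + conjc b').
    have -> : conjc ('i * t%:C) = - ('i * t%:C) :> R[i].
      by apply/eqP; rewrite eq_complex /=; apply/andP; split; apply/eqP; ring.
    by ring.
  by rewrite !nrmM ni nrmR mul1r (ger0_norm (ltW t0)).
have := congr2 +%R (nrm_eq0 hr) (nrm_eq0 hi); rewrite addr0.
rewrite (_ : _ + _ = 2 * b); last by ring.
by move/eqP; rewrite mulf_eq0 pnatr_eq0 /= => /eqP.
Qed.

Lemma flat_real_cst (f : R -> R) :
  (forall s, exists C : R, forall t, `|t| <= 1 -> `|f (s + t) - f s| <= C * t ^+ 2) ->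
  forall x y, f x = f y.
Proof.
move=> hf x y; apply: (@is_derive_0_is_cst R f x y) => s.
have [C hC] := hf s.
suff h : (fun h => h^-1 *: ((f \o shift s) (h *: 1) - f s)) @ 0^' --> (0 : R).
  by apply: DeriveDef; [apply/cvg_ex; exists 0 | apply: cvg_lim].
apply/cvgrPdist_le => e e0.
pose D := `|C| + 1.
have D0 : 0 < D by rewrite ltr_wpDl.
have [r [r0 r1 re]] : exists r, [/\ 0 < r, r <= 1 & r <= e / D].
  exists (Num.min 1 (e / D)); rewrite lt_min ltr01 divr_gt0 // !ge_min !lexx.
  by rewrite orbT.
exists r => // t /=; rewrite sub0r normrN => tr t0.
have t1 := lt_le_trans tr r1; have te := lt_le_trans tr re.
rewrite sub0r normrN normrM normfV.
have tp : 0 < `|t| by rewrite normr_gt0.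
rewrite ler_pdivrMl // /shift /= [_ + s]addrC [_%:A]mulr1.
apply: (le_trans (hC t (ltW t1))).
rewrite -[t ^+ 2]real_normK ?num_real // expr2 mulrA mulrC ler_pM2l //.
apply: (@le_trans _ _ (D * `|t|)).
  by rewrite ler_wpM2r // (le_trans (ler_norm C)) // lerDl.
by rewrite mulrC -ler_pdivlMr // ltW.
Qed.

Lemma flat_cst (f : R -> R[i]) :
  (forall s, exists C : R, forall t, `|t| <= 1 -> nrm (f (s + t) - f s) <= C * t ^+ 2) ->
  forall x y, f x = f y.
Proof.
move=> hf x y; apply/eqP; rewrite eq_complex; apply/andP; split; apply/eqP.
  apply: (@flat_real_cst (fun t => complex.Re (f t))) => s; have [C hC] := hf s.
  exists C => t t1; apply: le_trans (hC t t1).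
  by rewrite -raddfB normRe_le.
apply: (@flat_real_cst (fun t => complex.Im (f t))) => s; have [C hC] := hf s.
exists C => t t1; apply: le_trans (hC t t1).
by rewrite -raddfB normIm_le.
Qed.

End Jets.

(** * Forms invariant under Weyl operators *)

Section Rigidity.
Variables (R : realType) (K : hilbertType R) (G : symFock K).
Implicit Types (u v w : K).
Local Notation e := (expv G).

Lemma expv_first_order v (x : R[i]) : nrm x <= 1 ->
  nrm (e (x *: v) - e 0 - x *: one G v) <=
  (nrm v ^+ 2 * expR (nrm v ^+ 2)) * nrm x ^+ 2.
Proof.
move=> x1; pose b : R := nrm v ^+ 2 * expR (nrm v ^+ 2) * nrm x ^+ 2.
rewrite -/b.
have b0 : 0 <= b by rewrite /b !mulr_ge0 ?nrm_ge0 ?sqr_ge0 ?expR_ge0.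
rewrite -(@ler_pXn2r _ 2) ?nnegrE ?nrm_ge0 // -oneZ.
apply: (le_trans (nrm_expv_sub2 _ _)); rewrite nrmZ /b.
have x0 := nrm_ge0 x.
have -> : (nrm v ^+ 2 * expR (nrm v ^+ 2) * nrm x ^+ 2) ^+ 2 =
  (nrm x * nrm v) ^+ 4 * (expR (nrm v ^+ 2)) ^+ 2 by ring.
rewrite ler_wpM2l ?exprn_ge0 ?mulr_ge0 ?nrm_ge0 //.
apply: (@le_trans _ _ (expR (nrm v ^+ 2))).
  rewrite ler_expR exprMn ler_piMl ?sqr_ge0 //.
  by rewrite expr_le1.
by rewrite expr2 ler_peMr ?expR_ge0 // -expR0 ler_expR sqr_ge0.
Qed.

Lemma jet1_expv (f : G -> R[i]) (M : R) v : 0 <= M ->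
  (forall a x y, f (a *: x + y) = a * f x + f y) ->
  (forall x, nrm (f x) <= M * nrm x) ->
  jet1 (fun x => f (e (x *: v))) (f (e 0)) (f (one G v)).
Proof.
move=> M0 fl fM; exists (M * (nrm v ^+ 2 * expR (nrm v ^+ 2))); split.
  by rewrite !mulr_ge0 ?nrm_ge0 ?sqr_ge0 ?expR_ge0.
move=> x x1.
have -> : f (e (x *: v)) - f (e 0) - x * f (one G v) =
    f (e (x *: v) - e 0 - x *: one G v).
  have -> : e (x *: v) - e 0 - x *: one G v =
      (- x) *: one G v + (-1 *: e 0 + e (x *: v)).
    by rewrite scaleNr scaleN1r addrC [- e 0 + _]addrC.
  by rewrite !fl; ring.
apply: (le_trans (fM _)); rewrite -mulrA ler_wpM2l //.
exact: expv_first_order.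
Qed.

Lemma ip_bounded_map (A : G -> G) (z : G) : bounded_op A ->
  exists M : R, 0 <= M /\ forall x, nrm (ip z (A x)) <= M * nrm x.
Proof.
move=> /bounded_opE[_ [M [M0 hM]]]; exists (nrm z * M).
split=> [|x]; first by rewrite mulr_ge0 ?nrm_ge0.
by apply: (le_trans (CauchySchwarz _ _)); rewrite -mulrA ler_wpM2l ?nrm_ge0.
Qed.

Variables (V : K -> K) (A C : G -> G).
Hypotheses (hV : isometry_op V) (hA : bounded_op A) (hC : bounded_op C).
Hypothesis AC : forall v x y,
  ip (A (weyl G (V v) x)) (C (weyl G v y)) = ip (A x) (C y).

(** Two operators are kept apart to cover both uses: [A] the identity and [C] a unit, with [V] the
    isometry of the representation; and [A] an intertwiner [lift l] with [C] a difference of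
    intertwiners, where [V] is the identity. *)
Let f w := ip (A (e w)) (C (e 0)).

(** Invariance at the pair [e (w - V v)], [e 0], which the two Weyl operators carry to multiples of
    [e w] and [e v]; the phases combine to [cexp (ip w (V v))]. *)
Let form_expv w v : ip (A (e w)) (C (e v)) = cexp (ip w (V v)) * f (w - V v).
Proof.
have := AC v (e (w - V v)) (e 0).
rewrite !weyl_expv subrKC addr0 (linear_mapZ _ _ hA.1) (linear_mapZ _ _ hC.1).
rewrite ipZl ipZr mulrA /weyl_phase conj_cexp -cexpD => h.
rewrite /f -h mulrA -cexpD (_ : _ + _ = 0) ?cexp0 ?mul1r //.
rewrite ip0r ipBr ip_norm.
have -> : `|V v| = `|v| by rewrite hV.2.
have hn : conjc (`|v| ^+ 2 / 2) = `|v| ^+ 2 / 2.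
  by rewrite (nrmE v) -rcX -(rc_nat R 2) -rcV -rcM conjR.
have hn' : conjc (`|v| ^+ 2) = `|v| ^+ 2 by rewrite (nrmE v) -rcX conjR.
have -> : conjc (- (`|v| ^+ 2 / 2) - (ip (V v) w - `|v| ^+ 2)) =
    - (`|v| ^+ 2 / 2) - (ip w (V v) - `|v| ^+ 2).
  by rewrite 2!rmorphB rmorphN /= hn hn' -(ip_conj (V v) w).
by field.
Qed.

(* [f (w - x *: V v)] is holomorphic in [x] through the second argument of the
   form and antiholomorphic in [x] through the first one. *)
Let f_flat w v : exists D : R, forall t : R, `|t| <= 1 ->
  nrm (f (w - t%:C *: V v) - f w) <= D * t ^+ 2.
Proof.
pose g x := f (w - x *: V v).
have [M1 [M10 hM1]] := ip_bounded_map (A (e w)) hC.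
have hol : jet1 g (1 * f w) (1 * ip (A (e w)) (C (one G v)) + - ip w (V v) * f w).
  apply: (@jet1_eq _ (fun x => cexp (x * - ip w (V v)) * ip (A (e w)) (C (e (x *: v))))).
    move=> x; rewrite form_expv (linear_mapZ _ _ hV.1) ipZr mulrA -cexpD mulrN.
    by rewrite addNr cexp0 mul1r.
  apply: jet1M; first exact: jet1_cexp.
  apply: (@jet1_expv (fun z => ip (A (e w)) (C z)) M1 v M10) => // a x y.
  by rewrite hC.1 ipDr ipZr.
(* Up to a scalar, [e (w - x *: V v)] is the image under [weyl G w] of [e (x *: - V v)]; this moves
   the expansion in [x] to the origin, where [jet1_expv] applies. *)
have hAW : bounded_op (A \o weyl G w).
  by apply: bounded_comp => //; apply: weyl_bounded.
have [M2 [M20 hM2]] := ip_bounded_map (C (e 0)) hAW.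
have antihol : exists a b, jet1 (fun x => conjc (g x)) a b.
  eexists; eexists.
  apply: (@jet1_eq _ (fun x => cexp (`|w| ^+ 2 / 2) *
    (cexp (x * - ip w (V v)) * ip (C (e 0)) ((A \o weyl G w) (e (x *: - V v)))))).
    move=> x; rewrite /g /f -ip_conj /= weyl_expv (linear_mapZ _ _ hA.1) ipZr.
    rewrite [cexp _ * (cexp _ * _)]mulrA -cexpD [_ * (weyl_phase _ _ * _)]mulrA.
    rewrite /weyl_phase -cexpD scalerN ipNr ipZr.
    by rewrite (_ : _ + _ = 0) ?cexp0 ?mul1r //; ring.
  apply: jet1M; first exact: jet1_cst.
  apply: jet1M; first exact: jet1_cexp.
  apply: (@jet1_expv (fun z => ip (C (e 0)) ((A \o weyl G w) z)) M2 _ M20) => // a x y.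
  by rewrite hAW.1 ipDr ipZr.
have [a [b ab]] := antihol.
have b0 := jet1_antiholomorphic hol ab.
have [D [D0 hD]] := hol; exists D => t t1.
have := hD t%:C; rewrite nrmR => /(_ t1).
by rewrite b0 mulr0 subr0 mul1r real_normK ?num_real.
Qed.

(** [f_flat] is available at every base point, so [f] has zero derivative along the real segment
    from [w + V v] to [w]. *)
Lemma weyl_form_shift w v : f (w + V v) = f w.
Proof.
pose g (t : R) := f (w + V v - t%:C *: V v).
have := @flat_cst _ g _ 0 1; rewrite /g scale0r scale1r subr0 addrK; apply.
move=> s; have [D hD] := f_flat (w + V v - s%:C *: V v) v.
exists D => t /hD; rewrite /g.
by rewrite -[X in f X - _]addrA -opprD -scalerDl -rcD.
Qed.

Lemma weyl_form_expv w v : ip (A (e w)) (C (e v)) = cexp (ip w (V v)) * f w.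
Proof.
rewrite form_expv; congr (_ * _).
by rewrite -[in RHS](subrK (V v) w) weyl_form_shift.
Qed.

End Rigidity.

(** * Finite rank operators and normality *)

Section NormalEndomorphisms.
Variables (R : realType) (H : hilbertType R).
Implicit Types (x y z : H) (T : H -> H).

Definition rank1 x y : H -> H := fun z => ip y z *: x.

Lemma rank1_bounded x y : bounded_op (rank1 x y).
Proof.
apply/bounded_opE; split=> [a u v|].
  by rewrite /rank1 ipDr ipZr scalerDl scalerA.
exists (nrm y * nrm x); split=> [|z]; first by rewrite mulr_ge0 ?nrm_ge0.
by rewrite /rank1 nrmZ mulrAC ler_wpM2r ?nrm_ge0 // CauchySchwarz.
Qed.

Lemma adjoint_rank1 x y : adjoint (rank1 x y) = rank1 y x.
Proof.
apply: adjoint_unique => u v; rewrite /rank1 ipZl ipZr -ip_conj mulrC //.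
Qed.

Lemma comp_rank1 T x y : linear T -> T \o rank1 x y = rank1 (T x) y.
Proof. by move=> lT; apply/funext => z; rewrite /rank1 /= linear_mapZ. Qed.

Lemma rank1_comp x y z w : rank1 x y \o rank1 z w = ip y z *: rank1 x w.
Proof.
by apply/funext => u; rewrite /rank1 /= ipZr !fctE /= scalerA mulrC.
Qed.

Lemma rank1_linear (c : R[i]) x x' y :
  rank1 (c *: x + x') y = c *: rank1 x y + rank1 x' y.
Proof.
apply/funext => z; rewrite /rank1 !fctE /= scalerDr !scalerA.
by rewrite mulrC.
Qed.

Inductive finite_rank : (H -> H) -> Prop :=
| finite_rank0 : finite_rank 0
| finite_rankD c x y T : finite_rank T -> finite_rank (c *: rank1 x y + T).

Lemma finite_rank_bounded T : finite_rank T -> bounded_op T.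
Proof.
elim=> [|c x y S _ hS]; first exact: bounded0.
by apply: bounded_lin => //; apply: rank1_bounded.
Qed.

(** Gram-Schmidt, adding at each stage the projection onto the component [z] of the next vector
    orthogonal to the current range. Symmetry and idempotence are carried along because they give
    the contraction bound. *)
Lemma finite_rank_projections (eta : nat -> H) (k : nat) : exists P : H -> H,
  [/\ finite_rank P, forall u, nrm (P u) <= nrm u &
      forall j, (j < k)%N -> P (eta j) = eta j].
Proof.
suff [P [fP aP iP eP]] : exists P : H -> H,
    [/\ finite_rank P, forall u v, ip (P u) v = ip u (P v),
        forall u, P (P u) = P u & forall j, (j < k)%N -> P (eta j) = eta j].
  exists P; split=> // u.
  have [->|Pu0] := eqVneq (P u) 0; first by rewrite nrm0 nrm_ge0.
  have p : 0 < nrm (P u).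
    by rewrite lt_neqAle nrm_ge0 andbT eq_sym; apply: contra Pu0 => /eqP/nrm_eq0 ->.
  rewrite -(ler_pM2r p) -expr2.
  have -> : nrm (P u) ^+ 2 = nrm (ip u (P u)).
    by rewrite -{2}iP -aP ipnn nrmR ger0_norm // sqr_ge0.
  exact: CauchySchwarz.
elim: k => [|k [P [fP aP iP eP]]].
  exists 0; split=> //; first exact: finite_rank0.
  by move=> u v; rewrite -[(0 : H -> H) u]/(0 : H) -[(0 : H -> H) v]/(0 : H) ip0l ip0r.
have lP := (finite_rank_bounded fP).1.
pose z := eta k - P (eta k).
have Pz : P z = 0 by rewrite /z linear_mapB // iP subrr.
have [z0|z0] := eqVneq z 0.
  exists P; split=> // j; rewrite ltnS leq_eqVlt => /orP[/eqP ->|]; last exact: eP.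
  by apply/eqP; rewrite eq_sym -subr_eq0 -/z z0.
have zz : ip z z != 0 by apply: contra z0 => /eqP/ipnn_eq0 ->.
pose c := (ip z z)^-1.
have cc : conjc c = c by rewrite /c ipnn -rcV conjR.
have E u : (c *: rank1 z z + P) u = (c * ip z u) *: z + P u.
  by rewrite !fctE /= /rank1 scalerA.
have zP u : ip z (P u) = 0 by rewrite -aP Pz ip0l.
exists (c *: rank1 z z + P); split.
- exact: finite_rankD.
- move=> u v; rewrite !E ipDl ipDr ipZl ipZr rmorphM /= cc -ip_conj aP.
  by congr (_ + _); rewrite mulrAC.
- move=> u; rewrite !E ipDr ipZr zP addr0 lP iP Pz scaler0 add0r.
  by rewrite mulrAC [c * ip z z]mulVf // mul1r.
- move=> j; rewrite ltnS leq_eqVlt E => /orP[/eqP ->|jk].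
    have -> : ip z (eta k) = ip z z.
      by rewrite {3}/z ipBr zP subr0.
    by rewrite /c mulVf // scale1r /z subrK.
  by rewrite eP // -(eP _ jk) zP mulr0 scale0r add0r.
Qed.

Lemma series_real (a : nat -> R) :
  cvgn (series (fun n => (a n)%:C : R[i]^o)) -> cvgn (series a).
Proof.
move=> /cvg_ex[l /(@cvgn_conv _ R[i]^o) hl].
have [h _] := (conv_complex _ _).1 hl.
apply/cvg_ex; exists (complex.Re l).
suff <- : (fun n => complex.Re (series (fun k => (a k)%:C : R[i]^o) n)) = series a.
  exact: h.
by apply/funext => n; rewrite /series /= raddf_sum.
Qed.

Variable a : (H -> H) -> H -> H.
Hypothesis ha : normal_star_endomorphism a.

Lemma endo_linear (c : R[i]) S T : bounded_op S -> bounded_op T ->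
  a (c *: S + T) = c *: a S + a T.
Proof. by have [_ h _ _ _] := ha; apply: h. Qed.

Lemma endo0 : a 0 = 0.
Proof.
have h := endo_linear 1 (bounded0 H) (bounded0 H).
rewrite !scale1r addr0 in h; apply: (addrI (a 0)).
by rewrite addr0 -h.
Qed.

Lemma endoZ (c : R[i]) T : bounded_op T -> a (c *: T) = c *: a T.
Proof.
by move=> hT; rewrite -[c *: T]addr0 endo_linear ?endo0 ?addr0 //; apply: bounded0.
Qed.

Lemma endo_comp S T : bounded_op S -> bounded_op T -> a (S \o T) = a S \o a T.
Proof. by have [_ _ h _ _] := ha; apply: h. Qed.

Lemma endo_adjoint T : bounded_op T -> a (adjoint T) = adjoint (a T).
Proof. by have [_ _ _ h _] := ha; apply: h. Qed.

Hypothesis a1 : a idfun = idfun.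

(* Normality: [T |-> <y, a T y>] is given by sequences [xi] and [eta], and the
   finite rank projections of [eta] approximate the identity on them. *)
Lemma normal_endo_nondegenerate y :
  (forall x z, a (rank1 x z) y = 0) -> y = 0.
Proof.
move=> hy.
have hfr T : finite_rank T -> ip y (a T y) = 0.
  elim=> [|c x z S fS IH]; first by rewrite endo0 -[(0 : H -> H) y]/(0 : H) ip0r.
  rewrite endo_linear; [|exact: rank1_bounded|exact: finite_rank_bounded].
  by rewrite !fctE hy scaler0 add0r.
have [xi [eta [cxi ceta hs]]] : normal_functional ((fun T => ip y (T y)) \o a).
  have [_ _ _ _] := ha; apply.
  (* The vector functional of [y], written with the sequence [y, 0, 0, ...]. *)
  pose s n := if n is 0%N then y else 0.
  have sc : cvgn (series (fun n => `|s n| ^+ 2 : R[i]^o)).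
    apply/cvg_ex; exists (`|y| ^+ 2); apply/(@cvgn_conv _ R[i]^o).
    apply/convP => d d0; exists 1%N => -[//|n] _.
    rewrite /series /= big_nat_recl // big1_seq; last first.
      by move=> i _ /=; rewrite normr0 expr0n.
    by rewrite /= addr0 subrr nrm0.
  exists s, s; split; [exact: sc|exact: sc|move=> T hT].
  suff h : nconv (series (fun n => ip (s n) (T (s n)))) (ip y (T y)).
    exact: (cvgn_conv (V := R[i]^o) _ _).2 h.
  apply/convP => d d0; exists 1%N => -[//|n] _.
  rewrite /series /= big_nat_recl // big1_seq; last first.
    by move=> i _ /=; rewrite ip0l.
  by rewrite /= addr0 subrr nrm0.
pose b n := nrm (xi n) ^+ 2 + nrm (eta n) ^+ 2.
have cb : cvgn (series b).
  have -> : series b =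
     series (fun n => nrm (xi n) ^+ 2) + series (fun n => nrm (eta n) ^+ 2).
    by apply/funext => n; rewrite fctE /series /= big_split.
  apply: is_cvgD; apply: series_real.
    by move: cxi; under eq_fun do rewrite nrmE -rcX.
  by move: ceta; under eq_fun do rewrite nrmE -rcX.
have [X hX] := (cvg_ex _).1 cb.
(* The projection [P] contributes [0], so [ip y y] is the sum of the terms
   [ip (xi n) (eta n - P (eta n))]. The first [k] of them vanish, and the others are dominated by
   the tail of [b]. *)
have bound k : nrm (ip y y) <= X - series b k.
  have [P [fP cP eP]] := finite_rank_projections eta k.
  have h1 : nconv (series (fun n => ip (xi n) (eta n))) (ip y y).
    apply/(@cvgn_conv _ R[i]^o); have := hs idfun (bounded_id H).
    by rewrite /= a1.
  have h2 : nconv (series (fun n => ip (xi n) (P (eta n)))) 0.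
    rewrite -(hfr P fP); apply/(@cvgn_conv _ R[i]^o).
    exact: hs (finite_rank_bounded fP).
  have h3 := conv_nrm (convB h1 h2); rewrite subr0 in h3.
  have h4 : (fun n => series b n - series b k) @ \oo --> X - series b k.
    by apply: cvgB => //; apply: cvg_cst.
  apply: (ler_cvg_to h3 h4); exists k => // n /= kn.
  rewrite /series /= -sumrB (big_cat_nat (n := k)) //= big_nat big1 ?add0r; last first.
    by move=> i /andP[_ ik]; rewrite eP // subrr.
  rewrite [X in _ <= X - _](big_cat_nat (n := k)) //= addrAC subrr add0r.
  apply: (le_trans (nrm_sum _ _ _)); apply: ler_sum => i _; rewrite -ipBr.
  apply: (le_trans (CauchySchwarz _ _)).
  have h5 : nrm (eta i - P (eta i)) <= 2 * nrm (eta i).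
    apply: (le_trans (ler_nrmB _ _)); rewrite mulr_natl mulr2n lerD2l; exact: cP.
  have h6 := nrm_ge0 (xi i); have h7 := nrm_ge0 (eta i).
  apply: (@le_trans _ _ (nrm (xi i) * (2 * nrm (eta i)))); first by rewrite ler_wpM2l.
  rewrite /b; have := sqr_ge0 (nrm (xi i) - nrm (eta i)); rewrite sqrrB; lra.
apply: ipnn_eq0; apply: nrm_eq0; apply/le_anti; rewrite nrm_ge0 andbT.
have h : (fun k => X - series b k) @ \oo --> (0 : R).
  by rewrite -(subrr X); apply: cvgB => //; apply: cvg_cst.
have h0 : (fun=> nrm (ip y y)) @ \oo --> nrm (ip y y) by apply: cvg_cst.
by apply: (ler_cvg_to h0 h); apply: nearW => k; apply: bound.
Qed.

End NormalEndomorphisms.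

(** * From Weyl operators to all bounded operators *)

Section Intertwining.
Variables (R : realType) (K : hilbertType R) (G : symFock K).
Variables (a : (G -> G) -> G -> G) (V : K -> K) (B : G -> G).
Hypotheses (ha : normal_star_endomorphism a) (a1 : a idfun = idfun).
Hypothesis (aW : forall u, a (weyl G u) = weyl G (V u)).
Hypotheses (hB : bounded_op B)
  (BW : forall u x, B (weyl G u x) = weyl G (V u) (B x)).

Local Notation e := (expv G).
Local Notation vac := (expv G 0).

Let E := rank1 vac vac.

(* [lift l] intertwines the identity representation with [a]; these maps play
   the role of the isometries [G -> G (x) l] when [a T = T (x) 1]. *)
Let lift l x := a (rank1 x vac) l.

Let lift_intertwines l T x : bounded_op T -> a T (lift l x) = lift l (T x).
Proof.
move=> hT; rewrite /lift -(comp_rank1 _ _ hT.1) (endo_comp ha) //.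
exact: rank1_bounded.
Qed.

(** Composing the adjoint of [a (rank1 x vac)] with it gives [|x|^2] times [a E], so [lift l] is a
    scalar multiple of an isometry. *)
Let lift_bounded l : bounded_op (lift l).
Proof.
have ab x y : bounded_op (a (rank1 x y)).
  by have [h _ _ _ _] := ha; apply: h; apply: rank1_bounded.
apply/bounded_opE; split=> [c x y|].
  by rewrite /lift rank1_linear (endo_linear ha) //; exact: rank1_bounded.
pose N := nrm (ip l (a E l)).
have N0 : 0 <= N by apply: nrm_ge0.
exists (1 + N); split=> [|x]; first by rewrite addr_ge0.
rewrite -(@ler_pXn2r _ 2) ?nnegrE ?nrm_ge0 ?mulr_ge0 ?nrm_ge0 ?addr_ge0 //.
have -> : nrm (lift l x) ^+ 2 = nrm x ^+ 2 * N.
  have : ip (lift l x) (lift l x) = ip x x * ip l (a E l).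
    rewrite /lift adjointP // -(endo_adjoint ha); last exact: rank1_bounded.
    rewrite adjoint_rank1 -[a _ (a _ _)]/((a _ \o a _) l).
    rewrite -(endo_comp ha); [|exact: rank1_bounded..].
    rewrite rank1_comp (endoZ ha); last exact: rank1_bounded.
    by rewrite !fctE ipZr.
  move/(congr1 (@nrm R _)); rewrite nrmM !ipnn !nrmR !ger0_norm ?sqr_ge0 //.
rewrite exprMn mulrC ler_wpM2r ?sqr_ge0 //; nra.
Qed.

Lemma normal_endo_intertwines T : bounded_op T -> a T \o B = B \o T.
Proof.
move=> hT.
pose l0 := B vac.
(* If [B] is some [lift l], then [a E l] is [B vac], so [l0] is the natural candidate; the rest of
   the proof shows that [D] vanishes. *)
pose D x := -1 *: lift l0 x + B x.
have hD : bounded_op D.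
  by apply: (@bounded_lin _ _ (-1) (lift l0) B).
have vac1 : ip vac vac = 1 by rewrite ip_expv ip0l cexp0.
have aE l x : ip (a E l) x = ip l (a E x).
  have hE : bounded_op E by apply: rank1_bounded.
  rewrite adjointP; last by have [h _ _ _ _] := ha; apply: h.
  by rewrite -(endo_adjoint ha) // adjoint_rank1.
have aEE x : a E (a E x) = a E x.
  rewrite -[a E (a E x)]/((a E \o a E) x) -(endo_comp ha); [|exact: rank1_bounded..].
  by rewrite rank1_comp vac1 scale1r.
have formW l v x y : ip (lift l (weyl G v x)) (D (weyl G v y)) = ip (lift l x) (D y).
  rewrite /D -!(lift_intertwines _ _ (weyl_bounded G v)) aW BW.
  by rewrite -(weyl_isometry G (V v)).1 isometry_ip //; apply: weyl_isometry.
have hid : isometry_op (idfun : K -> K) by [].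
have D0 v : D (e v) = 0.
  apply: (normal_endo_nondegenerate ha a1) => x z.
  (* Rigidity with the identity as isometry reduces these inner products to the vacuum pair, where
     the value is [ip l (a E (l0 - a E l0))], zero because [a E] is idempotent. *)
  have orth l w : ip (lift l w) (D (e v)) = 0.
    suff h : adjoint (lift l) (D (e v)) = 0 by rewrite adjointP // h ip0r.
    apply: expv_ip_ext => u; rewrite ip0r -adjointP //.
    rewrite (weyl_form_expv hid (lift_bounded l) hD (formW l)) -[u]add0r.
    rewrite (weyl_form_shift hid (lift_bounded l) hD (formW l) 0 u) /D.
    rewrite ipDr ipZr /lift -/E !aE aEE /l0.
    by rewrite mulN1r addNr mulr0.
  have h : a (rank1 vac z) (D (e v)) = 0.
    apply: ip_ext => l; rewrite ip0r -adjoint_rank1 (endo_adjoint ha).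
      rewrite -adjointP; first exact: orth.
      by have [h _ _ _ _] := ha; apply: h; apply: rank1_bounded.
    exact: rank1_bounded.
  (* Factoring through the vacuum leaves only [a (rank1 vac z)], whose adjoint is a [lift] and hence
     has range orthogonal to [D (e v)]. *)
  have -> : rank1 x z = rank1 x vac \o rank1 vac z.
    by rewrite rank1_comp vac1 scale1r.
  rewrite (endo_comp ha) /=; [|exact: rank1_bounded..].
  rewrite h linear_map0 //.
  have [hb _ _ _ _] := ha; exact: (hb _ (rank1_bounded _ _)).1.
have Bl : B = lift l0.
  apply: expv_bounded_ext => // v; apply/eqP; rewrite -subr_eq0; apply/eqP.
  by rewrite -(D0 v) /D scaleN1r addrC.
apply/funext => x /=; rewrite Bl lift_intertwines //.
Qed.

End Intertwining.

(** * Characters of the cone *)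

Section SequentialContinuity.
Variables (R : realType) (d : nat) (P : set 'rV[R]_d).

Lemma within_continuous_seq (V : normedModType R[i]) (f : 'rV[R]_d -> V) :
  {within P, continuous f} <->
  forall (x : 'rV[R]_d) (s : nat -> 'rV[R]_d), P x -> (forall n, P (s n)) ->
    s @ \oo --> x -> nconv (fun n => f (s n)) (f x).
Proof.
split.
  move=> /subspace_continuousP fc x s Px Ps sx; apply/cvgn_conv.
  apply: (cvg_comp _ _ _ (fc x Px)) => B /= hB.
  have [N _ hN] := sx _ hB; exists N => // n /hN /=; exact.
move=> hf; apply/subspace_continuousP => x Px; apply/cvgrPdist_lt => e e0.
apply: contrapT => h.
have [s hs] : exists s : nat -> 'rV[R]_d, forall n,
    [/\ P (s n), ball x n.+1%:R^-1 (s n) & ~ `|f x - f (s n)| < e].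
  suff /choice[s hs] : forall n : nat, exists y,
      [/\ P y, ball x (n.+1%:R^-1 : R) y & ~ `|f x - f y| < e] by exists s.
  move=> n; apply: contrapT => h'; apply: h.
  apply/nbhs_ballP; exists (n.+1%:R^-1) => /=; first by rewrite invr_gt0.
  move=> y xy Py; apply: contrapT => h''; apply: h'; by exists y.
have sx : s @ \oo --> x.
  move=> B /nbhs_ballP[r /= r0 rB].
  have /cvgrPdist_lt/(_ _ r0)[N _ hN] := @cvg_harmonic R.
  exists N => // n /hN /=; rewrite sub0r normrN ger0_norm ?invr_ge0 // => hn.
  by apply: rB; have [_ hb _] := hs n; apply: le_ball hb; apply: ltW.
have Ps n : P (s n) by case: (hs n).
have /cvgn_conv/cvgrPdist_lt/(_ _ e0)[N _ hN] := hf x s Px Ps sx.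
by have [_ _] := hs N; apply; apply: hN => /=.
Qed.

Lemma cvg_rV_coord (s : nat -> 'rV[R]_d) (x : 'rV[R]_d) (j : 'I_d) :
  s @ \oo --> x -> (fun n => s n 0 j) @ \oo --> x 0 j.
Proof.
by move=> h; apply: (cvg_comp _ _ h (@coord_continuous R 1 d 0 j x)).
Qed.

Lemma cvg_scale_rV (t : nat -> R) (u : R) (x : 'rV[R]_d) :
  t @ \oo --> u -> (fun n => t n *: x) @ \oo --> u *: x.
Proof.
move=> h B /nbhs_ballP[r /= r0 rB].
pose M := 1 + \sum_j `|x 0 j|.
have M0 : 0 < M by rewrite ltr_pwDl // sumr_ge0.
have rM : 0 < r / M by rewrite divr_gt0.
have /cvgrPdist_lt/(_ _ rM)[N _ hN] := h.
exists N => // n /hN /= hn; apply: rB; split=> // i j.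
rewrite -ball_normE /ball_ /= !mxE !ord1 -mulrBl normrM.
apply: (@le_lt_trans _ _ (`|u - t n| * M)); last by rewrite -ltr_pdivlMr.
rewrite ler_wpM2l // /M (bigD1 j) //= addrCA lerDl.
by rewrite addr_ge0 // sumr_ge0.
Qed.

Lemma conv_pairing (s : nat -> 'rV[R]_d) (x : 'rV[R]_d) (mu : 'rV[R[i]]_d) :
  s @ \oo --> x -> nconv (fun n => pairing (s n) mu) (pairing x mu).
Proof.
move=> sx; rewrite /pairing; elim: (index_enum _) => [|j r IH].
  by under eq_fun do rewrite big_nil; rewrite big_nil; apply: conv_cst.
under eq_fun do rewrite big_cons; rewrite big_cons; apply: convD => //.
apply: convM (conv_cst _).
apply/conv_complex; split; last exact: cvg_cst.
exact: cvg_rV_coord.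
Qed.

End SequentialContinuity.

(** Heine-Cantor with the modulus indexed by the mesh [1 / (n + 1)] of the equal partitions into
    [n.+1] steps. *)
Lemma uniform_continuity01 (R : realType) (N : R -> R) :
  (forall (x : R) (s : nat -> R), 0 <= x <= 1 -> (forall n, 0 <= s n <= 1) ->
    s @ \oo --> x -> (fun n => N (s n)) @ \oo --> N x) ->
  forall e : R, 0 < e -> exists m, forall n, (m <= n)%N -> forall s t,
    0 <= s <= 1 -> 0 <= t <= 1 -> `|s - t| <= n.+1%:R^-1 -> `|N s - N t| < e.
Proof.
move=> hN e e0.
have loc x : 0 <= x <= 1 -> exists2 r : R, 0 < r &
    forall t, 0 <= t <= 1 -> `|x - t| < r -> `|N x - N t| < e / 2.
  move=> x01; apply: contrapT => h.
  have /choice[s hs] : forall n : nat, exists t,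
      [/\ 0 <= t <= 1, `|x - t| < n.+1%:R^-1 & ~ `|N x - N t| < e / 2].
    move=> n; apply: contrapT => h'; apply: h; exists n.+1%:R^-1.
      by rewrite invr_gt0.
    by move=> t t01 xt; apply: contrapT => h''; apply: h'; exists t.
  have sx : s @ \oo --> x.
    apply/cvgrPdist_lt => r r0.
    have /cvgrPdist_lt/(_ _ r0)[M _ hM] := @cvg_harmonic R.
    exists M => // n /hM /=; rewrite sub0r normrN ger0_norm ?invr_ge0 // => hn.
    by have [_ hb _] := hs n; apply: lt_trans hn.
  have s01 n : 0 <= s n <= 1 by case: (hs n).
  have e2 : 0 < e / 2 by rewrite divr_gt0.
  have /cvgrPdist_lt/(_ _ e2)[M _ hM] := hN x s x01 s01 sx.
  by have [_ _] := hs M; apply; apply: hM => /=.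
have /compact_near_coveringP cover := @segment_compact R 0 1.
have [|M _ hM] := cover nat \oo (fun n s => 0 <= s <= 1 -> forall t,
    0 <= t <= 1 -> `|s - t| <= n.+1%:R^-1 -> `|N s - N t| < e).
  move=> x /=; rewrite in_itv /= => x01; have [r r0 hr] := loc x x01.
  have r2 : 0 < r / 2 by rewrite divr_gt0.
  have /cvgrPdist_lt/(_ _ r2)[M _ hM] := @cvg_harmonic R.
  exists (ball x (r / 2), [set n | (M <= n)%N]) => /=.
    by split; [apply: nbhsx_ballx | exists M].
  move=> [s n] [/= xs Mn] s01 t t01 st.
  have := hM n Mn; rewrite /= sub0r normrN ger0_norm ?invr_ge0 // => hn.
  rewrite -ball_normE /ball_ /= in xs.
  have h1 : `|N x - N s| < e / 2 by apply: hr => //; apply: lt_trans xs _; lra.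
  have h2 : `|N x - N t| < e / 2.
    apply: hr => //; rewrite -(subrKA s x); apply: le_lt_trans (ler_normD _ _) _.
    have := le_lt_trans st hn; lra.
  rewrite -(subrKA (N x)); apply: le_lt_trans (ler_normD _ _) _.
  by rewrite distrC; lra.
by exists M => n /hM h s t s01 t01 st; apply: h => //=.
Qed.

(** * Logarithms and one-parameter characters *)

Section ComplexLog.
Variable R : realType.

(** The principal logarithm, with argument [asin (Im w / |w|)] since the real part is positive. The
    bound on the imaginary part keeps all fractions of [z] in the half plane where [cexp] has
    positive real part. *)
Lemma cexp_log (w : R[i]) : 0 < complex.Re w ->
  exists2 z, cexp z = w & - (pi / 2) < complex.Im z < pi / 2.
Proof.
move=> wp.
have n0 : 0 < nrm w by apply: lt_le_trans wp (Re_le w).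
pose s := complex.Im w / nrm w.
have sq : complex.Re w ^+ 2 + complex.Im w ^+ 2 = nrm w ^+ 2 by rewrite nrm_sqrE.
have s1 : s ^+ 2 < 1.
  rewrite /s expr_div_n ltr_pdivrMr ?exprn_gt0 // mul1r -sq ltrDr exprn_gt0 //.
have /andP[sl su] : -1 < s < 1.
  by rewrite -ltr_norml -(@ltr_pXn2r _ 2) ?nnegrE // real_normK ?num_real // expr1n.
exists (ln (nrm w) +i* asin s) => /=; last first.
  by rewrite asin_gtNpi2 ?sl ?(ltW su) // asin_ltpi2 // su (ltW sl).
rewrite /cexp /= lnK ?posrE //.
have s11 : -1 <= s <= 1 by rewrite !ltW.
rewrite cos_asin // asinK ?in_itv //=.
have -> : Num.sqrt (1 - s ^+ 2) = complex.Re w / nrm w.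
  have -> : 1 - s ^+ 2 = (complex.Re w / nrm w) ^+ 2.
    rewrite /s !expr_div_n -sq; field; rewrite sq.
    by rewrite expf_neq0 // gt_eqF.
  by rewrite sqrtr_sqr ger0_norm // divr_ge0 // ltW.
apply/eqP; rewrite eq_complex /= /s; apply/andP; split; apply/eqP; field;
  by rewrite gt_eqF.
Qed.

(** One value determines the exponent only modulo [2 pi i]. Equality along a half line gives
    [cexp (t d) = 1] for small [t], and then the second-order estimate forces [d = 0]. *)
Lemma cexp_line_eq (z w : R[i]) :
  (forall t : R, 0 <= t -> cexp (t%:C * z) = cexp (t%:C * w)) -> z = w.
Proof.
move=> h; apply/eqP; rewrite -subr_eq0; apply/eqP/nrm_eq0.
set d := z - w.
apply: (@quadratic_small _ _ (nrm d ^+ 2 * expR (nrm d))); first exact: nrm_ge0.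
move=> t t0 t1.
have := nrm_cexp_sub2 (t%:C * d).
have -> : cexp (t%:C * d) = 1.
  by rewrite /d mulrBr cexpD h ?(ltW t0) // -cexpD addrN cexp0.
rewrite subrr sub0r nrmN nrmM nrmR (ger0_norm (ltW t0)) => /le_trans; apply.
rewrite exprMn [leRHS]mulrC -mulrA ler_wpM2l ?sqr_ge0 // ler_wpM2l ?sqr_ge0 //.
by rewrite ler_expR ler_piMl ?nrm_ge0.
Qed.

(** Near [0] the real part of [g] is positive, so at a small time [r] the principal logarithm exists
    and square roots with positive real part are unique. This fixes [g] at [r / 2 ^+ n], then at
    dyadic multiples of [r], and by continuity everywhere. *)
Lemma one_parameter_exp (g : R -> R[i]) : g 0 = 1 ->
  (forall s t, 0 <= s -> 0 <= t -> g (s + t) = g s * g t) ->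
  (forall (x : R) (s : nat -> R), 0 <= x -> (forall n, 0 <= s n) ->
     s @ \oo --> x -> nconv (fun n => g (s n)) (g x)) ->
  exists z, forall t, 0 <= t -> g t = cexp (t%:C * z).
Proof.
move=> g0 gD gc.
have [r r0 hr] : exists2 r : R, 0 < r & forall t, 0 <= t <= r -> 0 < complex.Re (g t).
  apply: contrapT => h.
  have /choice[s hs] : forall n : nat, exists t : R,
      0 <= t <= n.+1%:R^-1 /\ ~ 0 < complex.Re (g t).
    move=> n; apply: contrapT => h'; apply: h; exists n.+1%:R^-1.
      by rewrite invr_gt0.
    by move=> t ht; apply: contrapT => h''; apply: h'; exists t.
  have sx : s @ \oo --> (0 : R).
    apply: (@squeeze0 _ s (@harmonic R)); last exact: cvg_harmonic.
      by move=> n; have [/andP[]] := hs n.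
    by move=> n; have [/andP[]] := hs n.
  have s0 n : 0 <= s n by have [/andP[]] := hs n.
  have /conv_complex[hre _] := gc 0 s (lexx _) s0 sx; rewrite g0 /= in hre.
  have /cvgrPdist_lt/(_ _ ltr01)[M _ hM] := hre.
  have [_] := hs M; apply; have := hM M (leqnn _) => /=.
  by rewrite ltr_norml => /andP[_]; lra.
have rr : 0 <= r <= r by rewrite (ltW r0) lexx.
have [z0 hz0 /andP[zl zu]] := cexp_log (hr r rr).
have half n : g (r / (2 ^+ n)) = cexp ((2 ^- n : R)%:C * z0).
  elim: n => [|n IH]; first by rewrite expr0 divr1 invr1 mul1r hz0.
  set a := g _; set b := cexp _.
  have p0 m : 0 < (2 : R) ^+ m by rewrite exprn_gt0.
  have rn0 m : 0 <= r / 2 ^+ m by rewrite divr_ge0 // ltW.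
  have hh : r / 2 ^+ n = r / 2 ^+ n.+1 + r / 2 ^+ n.+1.
    by rewrite exprS; field; rewrite gt_eqF.
  have hh2 : (2 ^- n : R) = 2 ^- n.+1 + 2 ^- n.+1.
    by rewrite exprS; field; rewrite gt_eqF.
  have ab : a ^+ 2 = b ^+ 2.
    by rewrite !expr2 /a /b -gD // -cexpD -hh IH -mulrDl -rcD -hh2.
  have le1 m : (2 ^- m : R) <= 1.
    by rewrite invf_le1 // exprn_ege1 // ler1n.
  have ap : 0 < complex.Re a.
    by apply: hr; rewrite rn0 /= ler_piMr // ltW.
  have bp : 0 < complex.Re b.
    rewrite /b /cexp; set y := _ * z0.
    have yi : complex.Im y = 2 ^- n.+1 * complex.Im z0.
      by rewrite /y; case: (z0) => ? ? /=; rewrite mul0r addr0.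
    have -> : complex.Re ((expR (complex.Re y))%:C *
        (cos (complex.Im y) +i* sin (complex.Im y)))
      = expR (complex.Re y) * cos (complex.Im y) by rewrite /= mul0r subr0.
    rewrite mulr_gt0 ?expR_gt0 // cos_gt0_pihalf // yi.
    have k0 : 0 < (2 ^- n.+1 : R) by rewrite invr_gt0.
    have k1 := le1 n.+1; have ph : 0 < pi / 2 :> R by rewrite divr_gt0 ?pi_gt0.
    move: k0 k1 zl zu ph; move: (2 ^- n.+1 : R) (complex.Im z0) (pi / 2 : R).
    move=> k u q k0 k1 zl zu q0; apply/andP; split; nra.
  (* The root [a = - b] is excluded by the positive real parts. *)
  move/eqP: ab; rewrite eqf_sqr => /orP[/eqP //|/eqP ab].
  by move: ap; rewrite ab raddfN /= oppr_gt0 => /(lt_trans bp); rewrite ltxx.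
have mult n k : g (k%:R * (r / 2 ^+ n)) = cexp ((k%:R * 2 ^- n : R)%:C * z0).
  have rn0 : 0 <= r / 2 ^+ n by rewrite divr_ge0 ?exprn_ge0 // ltW.
  elim: k => [|k IH]; first by rewrite !mul0r g0 cexp0.
  have kq : 0 <= k%:R * (r / 2 ^+ n) by rewrite mulr_ge0.
  rewrite -natr1 [in LHS]mulrDl mul1r (gD _ _ kq rn0) IH half -cexpD -mulrDl.
  by rewrite -rcD mulrDl mul1r.
exists ((r^-1)%:C * z0) => t t0.
(* Dyadic approximation of [t] from below, in units of [r / 2 ^+ n]. *)
pose k n := Num.truncn (t * 2 ^+ n / r).
pose s n := (k n)%:R * (2 ^- n : R).
have sb n : s n * r <= t /\ t <= s n * r + r * 2 ^- n.
  have p0 : 0 < (2 : R) ^+ n by rewrite exprn_gt0.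
  have x0 : 0 <= t * 2 ^+ n / r by rewrite !mulr_ge0 ?invr_ge0 // ltW.
  have /andP[h1 h2] := truncn_itv x0.
  rewrite -/(k n) in h1 h2; rewrite /s; split.
    by rewrite mulrAC ler_pdivrMr // -ler_pdivlMr.

  have -> : (k n)%:R / 2 ^+ n * r + r * 2 ^- n = ((k n)%:R + 1) * r / 2 ^+ n by ring.
  rewrite ler_pdivlMr // -ler_pdivrMr //.
  by rewrite natr1 ltW.
have geo : (fun n => r * 2 ^- n) @ \oo --> (0 : R).
  rewrite (_ : (fun n => _) = geometric r (2^-1)); last first.
    by apply/funext => n; rewrite /geometric /= exprVn.
  by apply: cvg_geometric; rewrite ger0_norm ?invr_ge0 // invf_lt1 // ltr1n.
have scv : (fun n => s n * r) @ \oo --> t.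
  apply: (@squeeze_cvgr _ _ _ _ (fun n => t - r * 2 ^- n) (fun=> t)).
  - by apply: nearW => n; have [h1 h2] := sb n; rewrite h1 lerBlDr h2.
  - by rewrite -[X in _ --> X]subr0; apply: cvgB => //; apply: cvg_cst.
  - exact: cvg_cst.
have sr0 n : 0 <= s n * r by rewrite !mulr_ge0 ?invr_ge0 ?exprn_ge0 // ltW.
apply: (conv_unique (gc t _ t0 sr0 scv)).
have -> : (fun n => g (s n * r)) = fun n => cexp ((s n * r)%:C * ((r^-1)%:C * z0)).
  apply/funext => n; rewrite mulrA -rcM mulfK ?gt_eqF // -mult; congr (g _).
  by rewrite /s; ring.
apply: conv_cexp; apply: convM (conv_cst _).
by apply/conv_complex; split; [exact: scv | exact: cvg_cst].
Qed.

End ComplexLog.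

Section Characters.
Variables (R : realType) (d : nat) (P : set 'rV[R]_d).
Hypotheses (Pcone : closed_convex_cone P) (Pspan : spanning_cone P).

Lemma pairingD (x y : 'rV[R]_d) mu :
  pairing (x + y) mu = pairing x mu + pairing y mu.
Proof.
rewrite /pairing -big_split; apply: eq_bigr => j _.
by rewrite mxE rcD mulrDl.
Qed.

Lemma pairingZ (t : R) (x : 'rV[R]_d) mu :
  pairing (t *: x) mu = t%:C * pairing x mu.
Proof.
by rewrite /pairing mulr_sumr; apply: eq_bigr => j _; rewrite mxE rcM mulrA.
Qed.

Lemma cexp_pairing_inj (mu nu : 'rV[R[i]]_d) :
  (forall x, P x -> cexp (pairing x mu) = cexp (pairing x nu)) -> mu = nu.
Proof.
move=> h; have [_ _ _ PZ] := Pcone.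
have hP x : P x -> pairing x mu = pairing x nu.
  by move=> Px; apply: cexp_line_eq => t t0; rewrite -!pairingZ h //; apply: PZ.
have hall x : pairing x mu = pairing x nu.
  have [y [z [Py Pz ->]]] := Pspan x.
  by rewrite -scaleN1r !pairingD !pairingZ !hP.
apply/rowP => j; have := hall (delta_mx 0 j).
have e (l : 'rV[R[i]]_d) : pairing (delta_mx 0 j : 'rV[R]_d) l = l 0 j.
  rewrite /pairing (bigD1 j) //= mxE !eqxx mul1r big1 ?addr0 // => k kj.
  by rewrite mxE eqxx (negPf kj) mul0r.
by rewrite !e.
Qed.

(** On each ray [chi] is an exponential with exponent [Z x], and [Z] is additive and positively
    homogeneous on the cone. Spanning writes each basis vector as [p j - q j] with both terms in
    [P], so the linear extension of [Z] must have coordinates [Z (p j) - Z (q j)]. *)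
Lemma cone_character (chi : 'rV[R]_d -> R[i]) : chi 0 = 1 ->
  (forall x y, P x -> P y -> chi (x + y) = chi x * chi y) ->
  (forall (x : 'rV[R]_d) (s : nat -> 'rV[R]_d), P x -> (forall n, P (s n)) ->
    s @ \oo --> x -> nconv (fun n => chi (s n)) (chi x)) ->
  exists mu, forall x, P x -> chi x = cexp (pairing x mu).
Proof.
move=> chi0 chiD chic; have [_ P0 PD PZ] := Pcone.
have /choice[Z hZ] : forall x, exists z, P x ->
    forall t : R, 0 <= t -> chi (t *: x) = cexp (t%:C * z).
  move=> x; have [Px|Px] := pselect (P x); last by exists 0.
  have [|||z hz] := @one_parameter_exp _ (fun t => chi (t *: x)).
  - by rewrite scale0r.
  - by move=> s t s0 t0; rewrite scalerDl chiD //; apply: PZ.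
  - move=> t s t0 s0 st; apply: chic => [|n|]; [exact: PZ|exact: PZ|].
    exact: cvg_scale_rV.
  by exists z.
have ZD x y : P x -> P y -> Z (x + y) = Z x + Z y.
  move=> Px Py; apply: cexp_line_eq => t t0.
  rewrite -hZ ?scalerDr //; last exact: PD.
  by rewrite chiD; [rewrite !hZ // -cexpD mulrDr|exact: PZ|exact: PZ].
have ZZ (c : R) x : 0 <= c -> P x -> Z (c *: x) = c%:C * Z x.
  move=> c0 Px; apply: cexp_line_eq => t t0.
  rewrite -hZ //; last exact: PZ.
  by rewrite scalerA hZ ?mulr_ge0 // rcM mulrA.
have Z0 : Z 0 = 0 by have := ZZ 0 0 (lexx _) P0; rewrite scale0r mul0r.
have Zsum (r : seq 'I_d) (c : 'I_d -> R) (p : 'I_d -> 'rV[R]_d) :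
    (forall j, 0 <= c j) -> (forall j, P (p j)) ->
    P (\sum_(j <- r) c j *: p j) /\
    Z (\sum_(j <- r) c j *: p j) = \sum_(j <- r) (c j)%:C * Z (p j).
  move=> c0 pP; elim: r => [|j r [IH1 IH2]]; first by rewrite !big_nil.
  by rewrite !big_cons ZD ?ZZ ?IH2 //; [split=> //; apply: PD => //|]; apply: PZ.
have /choice[pq hpq] : forall j : 'I_d, exists pq : 'rV[R]_d * 'rV[R]_d,
    [/\ P pq.1, P pq.2 & delta_mx 0 j = pq.1 - pq.2].
  by move=> j; have [p [q [Pp Pq h]]] := Pspan (delta_mx 0 j); exists (p, q).
pose p j := (pq j).1; pose q j := (pq j).2.
have Pp j : P (p j) by case: (hpq j).
have Pq j : P (q j) by case: (hpq j).
exists (\row_j (Z (p j) - Z (q j))) => x Px.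
(* [Z] obeys its linear rules only with nonnegative coefficients, so coordinates are split into
   positive and negative parts. *)
pose a j := Num.max (x 0 j) 0; pose b j := Num.max (- x 0 j) 0.
have a0 j : 0 <= a j by rewrite le_max lexx orbT.
have b0 j : 0 <= b j by rewrite le_max lexx orbT.
have ab j : x 0 j = a j - b j.
  rewrite /a /b; case: (leP 0 (x 0 j)) => h; case: (leP 0 (- x 0 j)) => h'; lra.
have xE : x = \sum_j (a j - b j) *: (p j - q j).
  rewrite {1}(row_sum_delta x); apply: eq_bigr => j _.
  by have [_ _ ->] := hpq j; rewrite -ab.
pose s1 := \sum_j a j *: p j; pose s2 := \sum_j b j *: q j.
pose s3 := \sum_j a j *: q j; pose s4 := \sum_j b j *: p j.
have [Ps1 Z1] : P s1 /\ Z s1 = _ := Zsum _ _ _ a0 Pp.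
have [Ps2 Z2] : P s2 /\ Z s2 = _ := Zsum _ _ _ b0 Pq.
have [Ps3 Z3] : P s3 /\ Z s3 = _ := Zsum _ _ _ a0 Pq.
have [Ps4 Z4] : P s4 /\ Z s4 = _ := Zsum _ _ _ b0 Pp.
(* All subtracted terms are moved to the left, so that both sides are sums of elements of [P] and
   additivity of [Z] applies. *)
have hx : x + (s3 + s4) = s1 + s2.
  rewrite {1}xE /s1 /s2 /s3 /s4 -!big_split; apply: eq_bigr => j _ /=.
  rewrite !scalerBl !scalerBr opprB.
  move: (a j *: p j) (a j *: q j) (b j *: p j) (b j *: q j) => u v w z.
  by rewrite addrACA !subrK.
have hZx : Z x + (Z s3 + Z s4) = Z s1 + Z s2.
  by rewrite -!ZD ?hx //; apply: PD.
have -> : chi x = cexp (Z x).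
  by have := hZ x Px 1 ler01; rewrite scale1r mul1r.
congr cexp; apply: (addIr (Z s3 + Z s4)); rewrite hZx Z1 Z2 Z3 Z4 /pairing.
rewrite -!big_split; apply: eq_bigr => j _ /=.
by rewrite mxE ab rcB; ring.
Qed.

End Characters.

(** * Cocycles of exponential type *)

Section SmallSums.
Variables (R : realType) (K : hilbertType R) (G : symFock K).
Local Notation e := (expv G).

Definition expv_remainder v : G := e v - e 0 - one G v.

Lemma nrm_expv_remainder (M : R) v : nrm v ^+ 2 <= M ->
  nrm (expv_remainder v) <= nrm v ^+ 2 * expR M.
Proof.
move=> vM; have M0 : 0 <= M by apply: le_trans vM; rewrite sqr_ge0.
have b0 : 0 <= nrm v ^+ 2 * expR M by apply: mulr_ge0; rewrite ?sqr_ge0 ?expR_ge0.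
rewrite -(@ler_pXn2r _ 2) ?nnegrE ?nrm_ge0 //.
apply: (le_trans (nrm_expv_sub2 _ _)).
rewrite exprMn -exprM; apply: ler_wpM2l; first by rewrite exprn_ge0 ?nrm_ge0.
apply: (@le_trans _ _ (expR M)); first by rewrite ler_expR.
by rewrite expr2; apply: ler_peMr; rewrite ?expR_ge0 // -expR0 ler_expR.
Qed.

Variables (w : nat -> nat -> K) (M : R).
Hypothesis wM : forall n, \sum_(k < n.+1) nrm (w n k) ^+ 2 <= M.
Hypothesis w0 : forall y,
  (fun n => \sum_(k < n.+1) nrm (ip (w n k) y) ^+ 2) @ \oo --> (0 : R).

Let w_le n (k : 'I_n.+1) : nrm (w n k) ^+ 2 <= M.
Proof.
apply: le_trans (wM n); rewrite (bigD1 k) //= lerDl.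
by apply: sumr_ge0 => i _; rewrite sqr_ge0.
Qed.

(* The conclusion is stable under norm limits in [z] because the remainders are
   summable uniformly in [n], so it suffices to check exponential vectors. *)
Lemma remainder_sum_small z :
  (fun n => \sum_(k < n.+1) nrm (ip (expv_remainder (w n k)) z)) @ \oo --> (0 : R).
Proof.
have M0 : 0 <= M by apply: le_trans (wM 0); apply: sumr_ge0 => i _; rewrite sqr_ge0.
pose Q := [set z : G |
  (fun n => \sum_(k < n.+1) nrm (ip (expv_remainder (w n k)) z)) @ \oo --> (0 : R)].
have s0 n (y : G) : 0 <= \sum_(k < n.+1) nrm (ip (expv_remainder (w n k)) y).
  by apply: sumr_ge0 => i _; apply: nrm_ge0.
suff : closure (lin_span (range e)) `<=` Q by rewrite expv_total; apply.
apply: clspan_min.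
  split; first split.
  - rewrite /Q /=; under eq_fun do under eq_bigr do rewrite ip0r nrm0.
    by under eq_fun do rewrite big1 //; apply: cvg_cst.
  - move=> c x y hx hy.
    apply: (@squeeze0 _ _ (fun n =>
      nrm c * \sum_(k < n.+1) nrm (ip (expv_remainder (w n k)) x) +
      \sum_(k < n.+1) nrm (ip (expv_remainder (w n k)) y))) => // [n|].
      rewrite mulr_sumr -big_split; apply: ler_sum => k _.
      by rewrite ipDr ipZr /= -nrmM ler_nrmD.
    have c0 : nrm c * 0 + 0 = 0 :> R by rewrite mulr0 addr0.
    rewrite -[X in _ --> X]c0.
    by apply: cvgD; [apply: cvgM; [exact: cvg_cst | exact: hx] | exact: hy].
  - move=> u l hu ul; apply/cvgrPdist_lt => r r0.
    pose C := M * expR M + 1.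
    have C0 : 0 < C by rewrite ltr_wpDl // mulr_ge0 ?expR_ge0.
    have rC : 0 < r / (2 * C) by rewrite divr_gt0 // mulr_gt0.
    have [m hm] := (convP _ _).1 ul _ rC.
    have r2 : 0 < r / 2 by rewrite divr_gt0.
    have /cvgrPdist_lt/(_ _ r2) [N _ hN] := hu m.
    exists N => // n /hN /=; rewrite !sub0r !normrN !ger0_norm ?s0 // => hn.
    have h1 : \sum_(k < n.+1) nrm (ip (expv_remainder (w n k)) l) <=
       \sum_(k < n.+1) nrm (ip (expv_remainder (w n k)) (u m)) +
       M * expR M * nrm (u m - l).
      apply: (@le_trans _ _ (\sum_(k < n.+1) (nrm (ip (expv_remainder (w n k)) (u m)) +
         nrm (w n k) ^+ 2 * expR M * nrm (u m - l)))).
        apply: ler_sum => k _.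
        have -> : l = u m - (u m - l) by rewrite opprB addrC subrK.
        rewrite ipBr; apply: (le_trans (ler_nrmB _ _)).
        have -> : u m - (u m - (u m - l)) = u m - l.
          by rewrite [in LHS]opprB addrC subrK.
        rewrite lerD2l; apply: (le_trans (CauchySchwarz _ _)).
        by rewrite ler_wpM2r ?nrm_ge0 // nrm_expv_remainder.
      rewrite big_split /= lerD2l -!mulr_suml.
      by rewrite ler_wpM2r ?nrm_ge0 // ler_wpM2r ?expR_ge0 ?wM.
    apply: (le_lt_trans h1).
    have h2 : M * expR M * nrm (u m - l) <= r / 2.
      have h3 := hm m (leqnn m).
      apply: (@le_trans _ _ (C * (r / (2 * C)))); last first.
        by rewrite le_eqVlt; apply/orP; left; apply/eqP; field; rewrite gt_eqF.
      by apply: ler_pM; rewrite ?nrm_ge0 ?mulr_ge0 ?expR_ge0 // ?lerDl // ltW.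
    lra.
move=> _ [v _ <-]; rewrite /Q /=.
(* [1 + M] bounds the norm of each [w n k], because its square is at most [M]. *)
pose B := expR ((1 + M) * nrm v).
have small n : \sum_(k < n.+1) nrm (ip (expv_remainder (w n k)) (e v)) <=
    B * \sum_(k < n.+1) nrm (ip (w n k) v) ^+ 2.
  rewrite mulr_sumr; apply: ler_sum => k _.
  rewrite /expv_remainder !ipBl !ip_expv ip_one_expv ip0l cexp0.
  apply: (le_trans (nrm_cexp_sub2 _)).
  rewrite mulrC ler_wpM2r ?sqr_ge0 // /B ler_expR.
  apply: (le_trans (CauchySchwarz _ _)); rewrite ler_wpM2r ?nrm_ge0 //.
  by have := w_le k; have := nrm_ge0 (w n k); nra.
apply: (squeeze0 _ small) => [n|]; first exact: s0.
by rewrite -[X in _ --> X](mulr0 B); apply: cvgM; [exact: cvg_cst | exact: w0].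
Qed.

End SmallSums.

Section Defect.
Variables (R : realType) (K : hilbertType R) (T : K -> K).
Hypothesis hT : isometry_op T.

Let bT := isometry_bounded hT.

(** The orthogonal projection of [y] onto the kernel of [adjoint T], for an isometry [T]. *)
Definition defect y := y - T (adjoint T y).

Lemma adjoint_defect y : adjoint T (defect y) = 0.
Proof.
rewrite /defect (linear_mapB _ _ (bounded_adjoint bT).1).
by rewrite isometry_adjointK // subrr.
Qed.

Lemma ip_defect y z : ip (defect y) (defect z) = ip (defect y) z.
Proof.
by rewrite {2}/defect ipBr -(adjointP' _ _ bT) adjoint_defect ip0l subr0.
Qed.

Lemma nrm_defect y : nrm (defect y) ^+ 2 = nrm y ^+ 2 - nrm (adjoint T y) ^+ 2.
Proof.
apply: complexI; rewrite -ipnn ip_defect /defect ipBl (adjointP _ _ bT) !ipnn.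
by rewrite -rcB.
Qed.

End Defect.

(** * Subdividing a ray of the cone *)

Section ConeRepresentations.
Variables (R : realType) (d : nat) (P : set 'rV[R]_d).
Variables (K : hilbertType R) (V : 'rV[R]_d -> K -> K).
Hypotheses (Pcone : closed_convex_cone P) (Vrep : isometric_rep P V).

Let P0 : P 0. Proof. by case: Pcone. Qed.
Let PD x y : P x -> P y -> P (x + y). Proof. by case: Pcone => ? ? h ?; apply: h. Qed.
Let PZ (t : R) x : 0 <= t -> P x -> P (t *: x).
Proof. by case: Pcone => ? ? ? h; apply: h. Qed.

Lemma rep_isometry x : P x -> isometry_op (V x).
Proof. by case: Vrep => h _ _; apply: h. Qed.

Lemma rep_bounded x : P x -> bounded_op (V x).
Proof. by move=> Px; apply/isometry_bounded/rep_isometry. Qed.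

Lemma repD x y u : P x -> P y -> V (x + y) u = V x (V y u).
Proof. by case: Vrep => _ h _ Px Py; rewrite h. Qed.

Lemma rep0 u : V 0 u = u.
Proof.
have h0 := rep_isometry P0.
have := repD u P0 P0; rewrite addr0 => h.
apply/eqP; rewrite eq_sym -subr_eq0; apply/eqP/nrm_eq0.
by rewrite -(isometry_nrm _ h0) (linear_mapB _ _ h0.1) -h subrr nrm0.
Qed.

Lemma rep_adjointD x y u : P x -> P y ->
  adjoint (V (x + y)) u = adjoint (V y) (adjoint (V x) u).
Proof.
move=> Px Py; apply: ip_ext => v.
rewrite -adjointP; last exact/rep_bounded/PD.
by rewrite repD // adjointP ?adjointP //; apply: rep_bounded.
Qed.

Lemma rep_adjoint0 u : adjoint (V 0) u = u.
Proof. by rewrite -{1}(rep0 u) isometry_adjointK //; apply: rep_isometry. Qed.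

Hypothesis Vstrict : strictly_continuous P V.
Variables (G : symFock K) (z : 'rV[R]_d -> G).
Local Notation e := (expv G).
(** For a unit [u], the vector [z x] is [u x (e 0)] divided by its character; the three hypotheses
    on [F] are all that the exponential form uses about the unit. *)
Let F x w := ip (e w) (z x).
Hypothesis F0 : forall x, P x -> F x 0 = 1.
Hypothesis Fshift : forall x w v, P x -> F x (w + V x v) = F x w.
Hypothesis FD : forall x y w, P x -> P y ->
  F (x + y) w = F x w * F y (adjoint (V x) w).

Section FixedTime.
Variables (x : 'rV[R]_d) (k0 : K).
Hypotheses (Px : P x) (hk0 : forall w, ip (one G w) (z x) = ip w k0).

Let F_expand v : F x v = 1 + (ip v k0 + ip (expv_remainder G v) (z x)).
Proof.
rewrite /expv_remainder !ipBl hk0 -/(F x v) -/(F x 0) F0 //; ring.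
Qed.

(** [F x] is constant along the range of [V x], so its first-order term there, which is
    [ip (V x v) k0], has to vanish. *)
Lemma cocycle_vector_ker : adjoint (V x) k0 = 0.
Proof.
apply: ip_ext => v; rewrite ip0r -adjointP; last exact: rep_bounded.
apply: nrm_eq0; pose y := V x v.
pose C := nrm y ^+ 2 * expR (nrm y ^+ 2) * nrm (z x).
apply: (@quadratic_small _ _ C); first exact: nrm_ge0.
move=> t t0 t1.
have ht : nrm (t%:C : R[i]) <= 1 by rewrite nrmR (ger0_norm (ltW t0)).
have Ft : F x (t%:C *: y) = 1.
  rewrite -(F0 Px) -(Fshift 0 (t%:C *: v) Px) add0r.
  by rewrite (linear_mapZ _ _ (rep_isometry Px).1).
have : t%:C * ip y k0 = - ip (expv_remainder G (t%:C *: y)) (z x).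
  have := F_expand (t%:C *: y); rewrite Ft ipZl conjR => h.
  by apply/eqP; rewrite -addr_eq0 -(inj_eq (addrI 1)) -h addr0.
move/(congr1 (@nrm R _)); rewrite nrmM nrmN nrmR (ger0_norm (ltW t0)) => ->.
apply: (le_trans (CauchySchwarz _ _)); rewrite /C mulrAC.
rewrite ler_wpM2r ?nrm_ge0 // /expv_remainder oneZ.
apply: (le_trans (expv_first_order _ _ ht)).
by rewrite nrmR (ger0_norm (ltW t0)).
Qed.

Let step n := n.+1%:R^-1 *: x.
Let Vk n k := V (k%:R *: step n).
(** The component of [w] in the range of [V] at time [k] steps that is orthogonal to the range at
    time [k + 1] steps. *)
Let piece n k w := Vk n k (defect (V (step n)) (adjoint (Vk n k) w)).

Let Pstep n : P (step n). Proof. by apply: PZ; rewrite ?invr_ge0. Qed.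
Let Pk n k : P (k%:R *: step n). Proof. exact: PZ. Qed.
Let stepS n k : k.+1%:R *: step n = k%:R *: step n + step n.
Proof. by rewrite -natr1 scalerDl scale1r. Qed.
Let step_total n : n.+1%:R *: step n = x.
Proof. by rewrite /step scalerA mulfV ?scale1r // pnatr_eq0. Qed.

Let F_prod n m w : F (m%:R *: step n) w =
  \prod_(k < m) F (step n) (adjoint (Vk n k) w).
Proof.
elim: m => [|m IH].
  rewrite big_ord0 scale0r.
  have := Fshift 0 w P0; rewrite add0r rep0 => ->; exact: F0.
by rewrite stepS FD // IH big_ord_recr.
Qed.

(** Split [x] into [k] steps, one step and the rest. The piece lies in the range for the first part,
    and [adjoint] kills it after the second, so only the middle factor differs from [1]. Thus every
    factor of the product becomes a value of the single function [F x]. *)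
Let F_piece n (k : 'I_n.+1) w :
  F x (piece n k w) = F (step n) (adjoint (Vk n k) w).
Proof.
have hk : x = (k%:R *: step n + step n) + (n - k)%:R *: step n.
  by rewrite -stepS -scalerDl -natrD addSn subnKC ?step_total // -ltnS.
have Pks : P (k%:R *: step n + step n) by apply: PD.
have hVk := rep_isometry (Pk n k).
rewrite {1}hk FD // FD // rep_adjointD // /piece.
rewrite isometry_adjointK // adjoint_defect; last exact: rep_isometry.
rewrite (F0 (Pk _ _)) mulr1.
have := Fshift 0 (defect (V (step n)) (adjoint (Vk n k) w)) (Pk n k).
rewrite add0r -/(Vk n k) => ->; rewrite F0 // mul1r.
rewrite /defect -[- V _ _]scaleN1r -(linear_mapZ _ _ (rep_isometry (Pstep n)).1).
exact: Fshift.
Qed.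

Let pieceE n k w : piece n k w =
  Vk n k (adjoint (Vk n k) w) - Vk n k.+1 (adjoint (Vk n k.+1) w).
Proof.
have hVk := rep_isometry (Pk n k).
rewrite /piece /defect /Vk (linear_mapB _ _ hVk.1); congr (_ - _).
by rewrite stepS rep_adjointD // repD.
Qed.

Let ip_piece n k w y : ip (piece n k w) y = ip (piece n k w) (piece n k y).
Proof.
have hVk := rep_isometry (Pk n k).
rewrite {2 3}/piece isometry_ip // ip_defect; last exact: rep_isometry.
by rewrite -adjointP //; apply: isometry_bounded.
Qed.

Let nrm_piece n k w : nrm (piece n k w) ^+ 2 =
  nrm (adjoint (Vk n k) w) ^+ 2 - nrm (adjoint (Vk n k.+1) w) ^+ 2.
Proof.
rewrite /piece (isometry_nrm _ (rep_isometry (Pk n k))).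
rewrite nrm_defect; last exact: rep_isometry.
by rewrite /Vk stepS rep_adjointD.
Qed.

Let telescope_ord (A : zmodType) (f : nat -> A) n :
  \sum_(k < n) (f k - f k.+1) = f 0%N - f n.
Proof.
rewrite -(big_mkord predT (fun k => f k - f k.+1)) /=.
rewrite -[RHS]opprB -(telescope_sumr f (leq0n n)) -sumrN.
by apply: eq_bigr => k _; rewrite opprB.
Qed.

Let sum_nrm_piece n w : \sum_(k < n.+1) nrm (piece n k w) ^+ 2 <= nrm w ^+ 2.
Proof.
under eq_bigr do rewrite nrm_piece.
rewrite (telescope_ord (fun k => nrm (adjoint (Vk n k) w) ^+ 2)).
by rewrite /Vk scale0r rep_adjoint0 lerBlDr lerDl sqr_ge0.
Qed.

(** The pieces add up to [w] modulo the range of [V x], to which [k0] is orthogonal. *)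
Let sum_ip_piece n w : \sum_(k < n.+1) ip (piece n k w) k0 = ip w k0.
Proof.
under eq_bigr do rewrite pieceE ipBl.
rewrite (telescope_ord (fun k => ip (Vk n k (adjoint (Vk n k) w)) k0)).
rewrite /Vk scale0r rep_adjoint0 rep0 step_total adjointP; last exact: rep_bounded.
by rewrite cocycle_vector_ker ip0r subr0.
Qed.

(** The squared norm of a piece is the decrease of [t |-> |V_(t x)^* w|^2] over one step, and strict
    continuity makes this function uniformly continuous on the unit interval. *)
Let piece_small w (r : R) : 0 < r -> exists m, forall n, (m <= n)%N ->
  forall k : 'I_n.+1, nrm (piece n k w) ^+ 2 <= r.
Proof.
move=> r0; pose N (t : R) := nrm (adjoint (V (t *: x)) w) ^+ 2.
have [|m hm] := @uniform_continuity01 _ N _ _ r0.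
  move=> t s /andP[t0 _] s01 st; rewrite /N.
  have hc : nconv (fun n => adjoint (V (s n *: x)) w) (adjoint (V (t *: x)) w).
    have := (within_continuous_seq _ _).1 (@Vstrict w) (t *: x) (fun n => s n *: x).
    apply; [exact: PZ | | exact: cvg_scale_rV].
    by move=> n; have /andP[h _] := s01 n; apply: PZ.
  by apply: cvgM; apply: conv_nrm.
exists m => n mn k; rewrite nrm_piece /Vk /step !scalerA.
have n0 : (0 : R) < n.+1%:R by [].
have in01 (j : nat) : (j <= n.+1)%N -> 0 <= (j%:R / n.+1%:R : R) <= 1.
  by move=> jn; rewrite divr_ge0 //= ler_pdivrMr // mul1r ler_nat.
have := hm n mn _ _ (in01 k (ltnW (ltn_ord k))) (in01 k.+1 (ltn_ord k)).
rewrite /N -mulrBl -natr1 opprD addrA subrr add0r mulN1r normrN.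
rewrite ger0_norm ?invr_ge0 // => /(_ (lexx _)) h.
by apply/ltW/(le_lt_trans _ h)/ler_norm.
Qed.

(** A piece of [w] pairs with [y] only through the corresponding piece of [y]. The sum is therefore
    at most the largest squared piece of [w] times [|y|^2]. *)
Let sum_ip_sqr_small w y :
  (fun n => \sum_(k < n.+1) nrm (ip (piece n k w) y) ^+ 2) @ \oo --> (0 : R).
Proof.
apply/cvgrPdist_le => r r0.
pose D := nrm y ^+ 2 + 1.
have D0 : 0 < D by rewrite ltr_wpDl // sqr_ge0.
have rD : 0 < r / D by rewrite divr_gt0.
have [m hm] := piece_small w rD.
exists m => // n /= mn; rewrite sub0r normrN ger0_norm; last first.
  by apply: sumr_ge0 => i _; rewrite sqr_ge0.
apply: (@le_trans _ _ (\sum_(k < n.+1) r / D * nrm (piece n k y) ^+ 2)).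
  apply: ler_sum => k _; rewrite ip_piece.
  apply: (@le_trans _ _ ((nrm (piece n k w) * nrm (piece n k y)) ^+ 2)).
    by rewrite ler_pXn2r ?nnegrE ?mulr_ge0 ?nrm_ge0 // CauchySchwarz.
  by rewrite exprMn ler_wpM2r ?sqr_ge0 // hm.
rewrite -mulr_sumr -ler_pdivlMl // invf_div.
apply: (le_trans (sum_nrm_piece n y)).
by rewrite mulfVK ?gt_eqF // /D lerDl.
Qed.

Let sum_nrm_ip w y n :
  \sum_(k < n.+1) nrm (ip (piece n k w) y) <= nrm w ^+ 2 + nrm y ^+ 2.
Proof.
apply: (@le_trans _ _
  (\sum_(k < n.+1) (nrm (piece n k w) ^+ 2 + nrm (piece n k y) ^+ 2))).
  apply: ler_sum => k _; rewrite ip_piece; apply: (le_trans (CauchySchwarz _ _)).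
  have := nrm_ge0 (piece n k w); have := nrm_ge0 (piece n k y).
  by move: (nrm (piece n k w)) (nrm (piece n k y)) => a b; nra.
by rewrite big_split lerD.
Qed.

Lemma cocycle_exponential w : F x w = cexp (ip w k0).
Proof.
pose rho n k := ip (expv_remainder G (piece n k w)) (z x).
pose a n (k : 'I_n.+1) := ip (piece n k w) k0 + rho n k.
pose S n := \sum_(k < n.+1) nrm (rho n k).
pose T n := \sum_(k < n.+1) nrm (ip (piece n k w) k0) ^+ 2.
pose C := nrm w ^+ 2 + nrm k0 ^+ 2.
have hS : S @ \oo --> (0 : R).
  apply: (@remainder_sum_small _ _ G (fun n k => piece n k w) (nrm w ^+ 2)).
    by move=> n; apply: sum_nrm_piece.
  by move=> y; apply: sum_ip_sqr_small.
have hT : T @ \oo --> (0 : R) by apply: sum_ip_sqr_small.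
have prodE n : F x w = \prod_(k < n.+1) (1 + a n k).
  rewrite -{1}(step_total n) F_prod; apply: eq_bigr => k _.
  by rewrite -F_piece F_expand.
have sumE n : \sum_(k < n.+1) a n k = ip w k0 + \sum_(k < n.+1) rho n k.
  by rewrite /a big_split sum_ip_piece.
have S0 n : 0 <= S n by apply: sumr_ge0 => k _; apply: nrm_ge0.
have bnd n : nrm (F x w - cexp (\sum_(k < n.+1) a n k)) <=
    expR (C + S n) * (2 * T n + 2 * (S n * S n)).
  rewrite (prodE n); apply: (le_trans (prod_near_cexp _)).
  apply: ler_pM.
  - exact: expR_ge0.
  - by apply: sumr_ge0 => k _; rewrite sqr_ge0.
  - rewrite ler_expR; apply: (@le_trans _ _
      (\sum_(k < n.+1) (nrm (ip (piece n k w) k0) + nrm (rho n k)))).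
      by apply: ler_sum => k _; apply: ler_nrmD.
    by rewrite big_split lerD // sum_nrm_ip.
  (* From [(p + q)^2 <= 2 p^2 + 2 q^2], where one factor of [q = |rho n k|] is replaced by the whole
     sum [S n]. *)
  apply: (@le_trans _ _ (\sum_(k < n.+1) (2 * nrm (ip (piece n k w) k0) ^+ 2 +
      2 * (nrm (rho n k) * S n)))); last first.
    by rewrite big_split /= -!mulr_sumr -mulr_suml.
  apply: ler_sum => k _.
  have rS : nrm (rho n k) <= S n.
    rewrite /S (bigD1 k) //= lerDl; apply: sumr_ge0 => i _; exact: nrm_ge0.
  have h1 := ler_nrmD (ip (piece n k w) k0) (rho n k).
  have r0 := nrm_ge0 (rho n k); have a0 := nrm_ge0 (a n k).
  rewrite -/(a n k) in h1.
  move: rS h1 r0 a0 (S0 n); move: (nrm (rho n k)) (nrm (a n k)) (S n).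
  move: (nrm (ip (piece n k w) k0)) (nrm_ge0 (ip (piece n k w) k0)) => p p0 q b s.
  move=> qs bpq q0 b0 s0.
  have h2 : b ^+ 2 <= (p + q) ^+ 2 by rewrite ler_pXn2r ?nnegrE // addr_ge0.
  apply: (le_trans h2); have := sqr_ge0 (p - q); nra.
have lim1 : nconv (fun n => cexp (\sum_(k < n.+1) a n k)) (F x w).
  apply: (conv_squeeze (b := fun n => expR (C + S n) * (2 * T n + 2 * (S n * S n)))).
    by move=> n; rewrite nrmBC.
  have -> : (0 : R) = expR (C + 0) * (2 * 0 + 2 * (0 * 0)).
    by rewrite !mulr0 !addr0 mulr0.
  have hCS : (fun n => C + S n) @ \oo --> C + 0.
    by apply: cvgD; [exact: cvg_cst | exact: hS].
  apply: cvgM; first exact: (cvg_comp _ _ hCS (@continuous_expR R (C + 0))).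
  by apply: cvgD; apply: cvgM; [exact: cvg_cst | exact: hT | exact: cvg_cst |
    exact: cvgM].
apply: (conv_unique lim1); apply: conv_cexp.
(* The exponents differ from [ip w k0] exactly by the sum of the remainders [rho], which is bounded
   by [S n]. *)
apply: (conv_squeeze _ hS) => n.
rewrite sumE [X in X - _]addrC addrK; exact: nrm_sum.
Qed.

End FixedTime.

End ConeRepresentations.

(** * Units of the CCR flow *)

Section StrongLimits.
Variables (R : realType) (H : hilbertType R) (A : set H).
Hypothesis Atotal : closure (lin_span A) = setT.

(** The uniform bound is asked only from [N0] on, because for units it comes from the convergence of
    the norms. *)
Lemma strong_conv_total (Tn : nat -> H -> H) (T : H -> H) (C : R) (N0 : nat) :
  (forall n, linear (Tn n)) -> linear T ->
  (forall n x, (N0 <= n)%N -> nrm (Tn n x) <= C * nrm x) ->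
  (forall x, nrm (T x) <= C * nrm x) ->
  (forall a, A a -> nconv (fun n => Tn n a) (T a)) ->
  forall x, nconv (fun n => Tn n x) (T x).
Proof.
move=> lTn lT bTn bT hA.
suff : closure (lin_span A) `<=` [set x | nconv (fun n => Tn n x) (T x)].
  by rewrite Atotal => h x; apply: h.
apply: clspan_min => //; split; first split.
- rewrite /= linear_map0 //; under eq_fun do rewrite linear_map0 //.
  exact: conv_cst.
- move=> c x y /= hx hy; rewrite lT; under eq_fun do rewrite lTn.
  by apply: convD => //; apply: convZr.
move=> u l hu ul /=; apply/convP => r r0.
pose D : R := `|C| + 1.
have D0 : 0 < D by rewrite ltr_wpDl.
have CD (y : H) : C * nrm y <= D * nrm y.
  by rewrite ler_wpM2r ?nrm_ge0 // /D (le_trans (ler_norm C)) // lerDl.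
have rD : 0 < r / (3 * D) by rewrite divr_gt0 // mulr_gt0.
have [m hm] := (convP _ _).1 ul _ rD.
have r3 : 0 < r / 3 by rewrite divr_gt0.
have [N hN] := (convP _ _).1 (hu m) _ r3.
have hd : D * nrm (u m - l) < r / 3.
  have := hm m (leqnn m); rewrite -(ltr_pM2l D0).
  by congr (_ < _); field; rewrite gt_eqF.
exists (maxn N0 N) => n; rewrite geq_max => /andP[n0 nN].
have -> : Tn n l - T l = - (Tn n (u m - l)) + ((Tn n (u m) - T (u m)) + T (u m - l)).
  by rewrite (linear_mapB _ _ (lTn n)) (linear_mapB _ _ lT) opprB !subrKA.
apply: (le_lt_trans (ler_nrmD _ _)); rewrite nrmN.
have h1 := le_trans (bTn n (u m - l) n0) (CD _).
have h2 := ler_nrmD (Tn n (u m) - T (u m)) (T (u m - l)).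
have h3 := hN n nN; have h4 := le_trans (bT (u m - l)) (CD _).
lra.
Qed.

End StrongLimits.

Section CCRUnits.
Variables (R : realType) (d : nat) (P : set 'rV[R]_d).
Hypotheses (Pcone : closed_convex_cone P) (Pspan : spanning_cone P).
Variables (K : hilbertType R) (G : symFock K) (V : 'rV[R]_d -> K -> K).
Hypotheses (Vrep : isometric_rep P V) (Vstrict : strictly_continuous P V).
Variable alpha : 'rV[R]_d -> (G -> G) -> G -> G.
Hypothesis Halpha : is_ccr_flow G P V alpha.

Local Notation e := (expv G).

Let P0 : P 0. Proof. by case: Pcone. Qed.
Let PD x y : P x -> P y -> P (x + y). Proof. by case: Pcone => ? ? h ?; apply: h. Qed.

Let repB x : P x -> bounded_op (V x). Proof. exact: (rep_bounded Vrep). Qed.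
Let repI x : P x -> isometry_op (V x). Proof. exact: (rep_isometry Vrep). Qed.

Lemma ccr_unitE mu h x : P x ->
  ccr_unit G P V mu h x = cexp (pairing x mu) *: creation G (V x) (e (h x)).
Proof. by move=> Px; rewrite /ccr_unit mem_set. Qed.

Lemma ccr_unit_out mu h x : ~ P x -> ccr_unit G P V mu h x = 0.
Proof. by move=> Px; rewrite /ccr_unit memNset. Qed.

Lemma ccr_unit_expv mu h x v : P x -> additive_cocycles P V h ->
  ccr_unit G P V mu h x (e v) = cexp (pairing x mu) *: e (h x + V x v).
Proof.
move=> Px [_ hk _ _]; rewrite ccr_unitE // fctE creation_expv //; first exact: repI.
exact: hk.
Qed.

Lemma ccr_unit_bounded mu h x : P x -> additive_cocycles P V h ->
  bounded_op (ccr_unit G P V mu h x).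
Proof.
move=> Px [_ hk _ _]; rewrite ccr_unitE //; apply: bounded_scale.
by apply: creation_bounded; [apply: repI | apply: hk].
Qed.

Lemma nrm_ccr_unit mu h x y : P x -> additive_cocycles P V h ->
  nrm (ccr_unit G P V mu h x y) = nrm (cexp (pairing x mu)) * nrm (e (h x)) * nrm y.
Proof.
move=> Px [_ hk _ _]; rewrite ccr_unitE // fctE nrmZ nrm_creation ?mulrA //.
  exact: repI.
exact: hk.
Qed.

Lemma ccr_unit_continuous mu h y : additive_cocycles P V h ->
  {within P, continuous (fun x => ccr_unit G P V mu h x y)}.
Proof.
move=> hh; have [hc hk hD _] := hh; apply/within_continuous_seq => x s Px Ps sx.
have hs := (within_continuous_seq _ _).1 hc x s Px Ps sx.
have cp : nconv (fun n => cexp (pairing (s n) mu)) (cexp (pairing x mu)).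
  exact/conv_cexp/conv_pairing.
(* The unit at time [t] is [c t] times an isometry, so convergence of [c] along the sequence bounds
   the operators uniformly. *)
pose c (t : 'rV[R]_d) : R := nrm (cexp (pairing t mu)) * nrm (e (h t)).
have cc : (fun n => c (s n)) @ \oo --> c x.
  by apply: cvgM; apply: conv_nrm => //; apply: conv_expv_seq.
have [N0 hN0] : exists N, forall n, (N <= n)%N -> c (s n) <= c x + 1.
  have /cvgrPdist_lt/(_ _ ltr01)[N _ hN] := cc; exists N => n /hN /=.
  by rewrite ltr_norml => /andP[]; lra.
have c0 t : 0 <= c t by rewrite mulr_ge0 ?nrm_ge0.
apply: (@strong_conv_total _ _ _ (expv_total G)
  (fun n => ccr_unit G P V mu h (s n)) _ (c x + 1) N0).
- by move=> n; exact: (ccr_unit_bounded _ (Ps n) hh).1.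
- exact: (ccr_unit_bounded _ Px hh).1.
- by move=> n z hn; rewrite nrm_ccr_unit // ler_wpM2r ?nrm_ge0 // hN0.
- by move=> z; rewrite nrm_ccr_unit // ler_wpM2r ?nrm_ge0 // -/(c x) lerDl.
move=> _ [v _ <-]; rewrite ccr_unit_expv //.
under eq_fun do rewrite ccr_unit_expv //.
apply: convZ => //; apply: conv_expv_seq; apply: convD => //.
have [_ _ Vc] := Vrep.
exact: (within_continuous_seq _ _).1 (@Vc v) x s Px Ps sx.
Qed.

Lemma ccr_unit_weyl mu h x u y : P x -> additive_cocycles P V h ->
  ccr_unit G P V mu h x (weyl G u y) = weyl G (V x u) (ccr_unit G P V mu h x y).
Proof.
move=> Px hh; have [_ hk _ _] := hh; have bT := ccr_unit_bounded mu Px hh.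
suff E : ccr_unit G P V mu h x \o weyl G u = weyl G (V x u) \o ccr_unit G P V mu h x.
  exact: (congr1 (fun T => T y) E).
apply: expv_bounded_ext => [||v /=].
- by apply: bounded_comp => //; apply: weyl_bounded.
- by apply: bounded_comp => //; apply: weyl_bounded.
rewrite weyl_expv (linear_mapZ _ _ bT.1) !ccr_unit_expv //.
rewrite (linear_mapZ _ _ (weyl_bounded G _).1) weyl_expv !scalerA mulrC.
rewrite (linear_mapD _ _ (repI Px).1) [in RHS]addrCA; congr (_ * _ *: _).
(* The phases agree because [h x] lies in the kernel of the adjoint, so its inner product with
   [V x u] vanishes. *)
rewrite /weyl_phase; congr cexp.
rewrite ipDr isometry_ip ?(repI Px).2; last exact: repI.
by rewrite adjointP ?(hk x Px) ?ip0r ?add0r //; apply: repB.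
Qed.

Lemma ccr_unit_units mu h : additive_cocycles P V h ->
  units P alpha (ccr_unit G P V mu h).
Proof.
move=> hh; have [hc hk hD hout] := hh; have [[hend h0 hcomp _] hW] := Halpha.
split.
- split; first by move=> x Px; apply: ccr_unit_bounded.
  by move=> y; apply: ccr_unit_continuous.
- move=> x T Px bT; have [hn h1] := hend x Px.
  have aW v : alpha x (weyl G v) = weyl G (V x v) by apply: hW.
  have bW v y := ccr_unit_weyl mu v y Px hh.
  have bx := ccr_unit_bounded mu Px hh.
  exact: (normal_endo_intertwines hn h1 aW bx bW bT).
- move=> x y Px Py; have Pxy := PD Px Py.
  have bx := ccr_unit_bounded mu Px hh.
  apply: expv_bounded_ext => [||v /=]; first exact: ccr_unit_bounded.
    by apply: bounded_comp => //; apply: ccr_unit_bounded.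
  rewrite !ccr_unit_expv // (linear_mapZ _ _ bx.1) ccr_unit_expv // scalerA.
  rewrite -cexpD pairingD [pairing y mu + _]addrC -hD // (repD Vrep _ Px Py).
  by rewrite (linear_mapD _ _ (repI Px).1) addrA.
- exists 0 => // h00; have := ccr_unit_expv mu 0 P0 hh; rewrite h00.
  rewrite -[(0 : G -> G) _]/(0 : G) => /esym/eqP.
  by rewrite scaler_eq0 (negPf (cexp_neq0 _)) /= => /eqP/expv_neq0.
- by move=> x Px; apply: ccr_unit_out.
Qed.

(** Evaluate both units at the vacuum. The component along [e 0] isolates the character, and the
    remaining exponential vector determines the cocycle. *)
Lemma ccr_unit_inj mu nu h k :
  additive_cocycles P V h -> additive_cocycles P V k ->
  ccr_unit G P V mu h = ccr_unit G P V nu k -> mu = nu /\ h = k.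
Proof.
move=> hh kk E.
have Ee x : P x -> cexp (pairing x mu) *: e (h x) = cexp (pairing x nu) *: e (k x).
  move=> Px; have := congr1 (fun u => u x (e 0)) E; rewrite !ccr_unit_expv //.
  by rewrite (linear_map0 (repI Px).1) !addr0.
have Ec x : P x -> cexp (pairing x mu) = cexp (pairing x nu).
  move=> /Ee/(congr1 (ip (e 0))).
  by rewrite !ipZr !ip_expv !ip0l cexp0 !mulr1.
split; first exact: cexp_pairing_inj Ec.
apply/funext => x; have [Px|Px] := pselect (P x).
  apply: (@expv_inj _ _ G); have := Ee x Px; rewrite (Ec x Px).
  by move/(scalerI (cexp_neq0 _)).
by have [_ _ _ ->] := hh => //; have [_ _ _ ->] := kk.
Qed.

(** * From a unit to its character and cocycle *)

Section UnitAnalysis.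
Variable u : 'rV[R]_d -> G -> G.
Hypothesis Hu : units P alpha u.

Let ub x : P x -> bounded_op (u x). Proof. by case: Hu => [[h _]] *; apply: h. Qed.
Let uD x y : P x -> P y -> u (x + y) = u x \o u y.
Proof. by case: Hu => _ _ h *; apply: h. Qed.

Let f x w := ip (e w) (u x (e 0)).

Let form_weyl x v y z : P x ->
  ip (weyl G (V x v) y) (u x (weyl G v z)) = ip y (u x z).
Proof.
move=> Px; have [_ hint _ _ _] := Hu; have [_ hW] := Halpha.
have := hint x (weyl G v) Px (weyl_bounded G v); rewrite hW // => E.
have := congr1 (fun T => T z) E; rewrite /= => <-.
by rewrite isometry_ip //; apply: weyl_isometry.
Qed.

Let u_expv x w v : P x -> ip (e w) (u x (e v)) = cexp (ip w (V x v)) * f x w.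
Proof.
move=> Px; apply: (weyl_form_expv (repI Px) (bounded_id G) (ub Px)) => *.
exact: form_weyl.
Qed.

Let f_shift x w v : P x -> f x (w + V x v) = f x w.
Proof.
move=> Px; apply: (weyl_form_shift (repI Px) (bounded_id G) (ub Px)) => *.
exact: form_weyl.
Qed.

(** The adjoint of [u x] sends exponential vectors to multiples of exponential vectors; applied with
    [y] replaced by [u y (e 0)], this is the cocycle identity for [f]. *)
Let u_adjoint x w y : P x ->
  ip (e w) (u x y) = f x w * ip (e (adjoint (V x) w)) y.
Proof.
move=> Px.
have : adjoint (u x) (e w) = conjc (f x w) *: e (adjoint (V x) w).
  apply: expv_ip_ext => v; rewrite -(adjointP _ _ (ub Px)) ip_conj u_expv //.
  rewrite ipZr rmorphM mulrC; congr (_ * _).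
  rewrite ip_expv -[LHS]/(conjc (cexp _)) conj_cexp; congr cexp.
  by rewrite -ip_conj -(adjointP _ _ (repB Px)).
by rewrite -(adjointP' _ _ (ub Px)) => ->; rewrite ipZl conjcK.
Qed.

Let f_comp x y w : P x -> P y -> f (x + y) w = f x w * f y (adjoint (V x) w).
Proof. by move=> Px Py; rewrite /f uD //= u_adjoint. Qed.

(** As [alpha 0] is the identity, [u 0] commutes with rank one operators and is an idempotent
    scalar. The scalar [0] would annihilate every [u x = u x \o u 0]. This is what starts the
    character of the unit at [1]. *)
Let u0 y : u 0 y = y.
Proof.
have [_ hint _ [x Px ux0] _] := Hu; have [[_ a0 _ _] _] := Halpha.
have vac1 : ip (e 0) (e 0) = 1 by rewrite ip_expv ip0l cexp0.
pose c := ip (e 0) (u 0 (e 0)).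
have uc z : u 0 z = c *: z.
  have br := rank1_bounded z (e 0).
  have := hint 0 _ P0 br; rewrite a0 // => /(congr1 (fun T => T (e 0))).
  by rewrite /rank1 /= vac1 scale1r => <-.
have cc : c *: e 0 = (c * c) *: e 0.
  by rewrite -uc -{1}[0]addr0 uD //= !uc scalerA.
have : c * (c - 1) = 0.
  apply/eqP; rewrite mulrBr mulr1 subr_eq0; apply/eqP.
  by have := congr1 (ip (e 0)) cc; rewrite !ipZr vac1 !mulr1.
move/eqP; rewrite mulf_eq0 => /orP[/eqP c0|]; last first.
  by rewrite subr_eq0 uc => /eqP ->; rewrite scale1r.
case: ux0; apply/funext => z.
by rewrite -[x]addr0 uD //= uc c0 scale0r (linear_map0 (ub Px).1).
Qed.

Let character : exists mu, forall x, P x -> f x 0 = cexp (pairing x mu).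
Proof.
apply: (cone_character Pcone Pspan).
- by rewrite /f u0 ip_expv ip0l cexp0.
- move=> x y Px Py; rewrite f_comp // (linear_map0 (bounded_adjoint (repB Px)).1) //.
- move=> x s Px Ps sx; apply: conv_ip; first exact: conv_cst.
  have [[_ hc] _ _ _ _] := Hu.
  exact: (within_continuous_seq _ _).1 (@hc (e 0)) x s Px Ps sx.
Qed.

Lemma unit_ccr_unit : exists mu h, additive_cocycles P V h /\ ccr_unit G P V mu h = u.
Proof.
have [mu hmu] := character.
pose z x := cexp (- pairing x mu) *: u x (e 0).
have hF x w : ip (e w) (z x) = cexp (- pairing x mu) * f x w by rewrite /z ipZr.
have F0 x : P x -> ip (e 0) (z x) = 1.
  by move=> Px; rewrite hF hmu // -cexpD addNr cexp0.
have Fs x w v : P x -> ip (e (w + V x v)) (z x) = ip (e w) (z x).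
  by move=> Px; rewrite !hF f_shift.
have FD x y w : P x -> P y ->
    ip (e w) (z (x + y)) = ip (e w) (z x) * ip (e (adjoint (V x) w)) (z y).
  by move=> Px Py; rewrite !hF f_comp // pairingD opprD cexpD; ring.
(* The one-particle component of [z x] is read as a vector of [K] by representing the conjugate of
   the antilinear functional [w |-> ip (one G w) (z x)]. *)
have /choice[k0 hk0] : forall x, exists k, forall w, ip (one G w) (z x) = ip w k.
  move=> x; have [|w|k hk] := @riesz _ _ (fun w => ip (z x) (one G w)) (nrm (z x)).
  - by move=> a v w; rewrite one_linear ipDr ipZr.
  - by rewrite -(nrm_one G w) CauchySchwarz.
  - by exists k => w; rewrite ip_conj hk -ip_conj.
have Fexp x w : P x -> ip (e w) (z x) = cexp (ip w (k0 x)).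
  by move=> Px; apply: (cocycle_exponential Pcone Vrep Vstrict F0 Fs FD Px (hk0 x)).
have zE x : P x -> z x = e (k0 x).
  by move=> Px; apply: expv_ip_ext => w; rewrite Fexp // ip_expv.
pose h x := if pselect (P x) is left _ then k0 x else 0.
have hP x : P x -> h x = k0 x by rewrite /h; case: pselect.
have hN x : ~ P x -> h x = 0 by rewrite /h; case: pselect.
have hh : additive_cocycles P V h.
  split.
  - apply/within_continuous_seq => x s Px Ps sx; rewrite hP //.
    under eq_fun do rewrite hP //.
    have zc : nconv (fun n => z (s n)) (z x).
      apply: convZ.
        apply: conv_cexp; apply: convN; exact: conv_pairing.
      have [[_ hc] _ _ _ _] := Hu.
      exact: (within_continuous_seq _ _).1 (@hc (e 0)) x s Px Ps sx.
    (* Since [one] is isometric, pairing [z (s n) - z x] with [one G v] gives [|v|^2] on one side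
       and at most [|v|] times the distance of the [z] on the other. *)
    apply: (conv_squeeze _ zc) => n; set v := k0 (s n) - k0 x.
    have [->|v0] := eqVneq v 0; first by rewrite nrm0 nrm_ge0.
    have vp : 0 < nrm v.
      by rewrite lt_neqAle nrm_ge0 andbT eq_sym; apply: contra v0 => /eqP/nrm_eq0 ->.
    rewrite -(ler_pM2l vp) -{3}(nrm_one G v).
    apply: le_trans (CauchySchwarz _ _); rewrite ipBr !hk0 -ipBr -/v ipnn nrmR.
    by rewrite expr2 ler_norm.
  - move=> x Px; rewrite hP //.
    exact: (cocycle_vector_ker Vrep F0 Fs Px (hk0 x)).
  - move=> x y Px Py; have Pxy := PD Px Py; rewrite !hP //.
    (* Comparing exponential vectors rather than exponents turns the multiplicative identity for [z]
       into the additive one without logarithms. *)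
    apply: (@expv_inj _ _ G); apply: expv_ip_ext => w.
    rewrite -zE // FD // !Fexp // ip_expv ipDr cexpD; congr (_ * cexp _).
    by rewrite adjointP' //; apply: repB.
  - exact: hN.
exists mu, h; split => //; apply/funext => x.
have [Px|Px] := pselect (P x); last first.
  by rewrite ccr_unit_out //; case: Hu => _ _ _ _ ->.
apply: expv_bounded_ext => [||v]; first exact: ccr_unit_bounded.
  exact: ub.
rewrite ccr_unit_expv //; apply: expv_ip_ext => w.
rewrite u_expv // hP // ipZr ip_expv ipDr cexpD -Fexp // hF.
rewrite mulrA mulrA -cexpD addrN cexp0 mul1r mulrC //.
Qed.

End UnitAnalysis.

End CCRUnits.

Theorem theorem5p10 (R : realType) (d : nat) (P : set 'rV[R]_d)
  (Pcone : closed_convex_cone P) (Pspan : spanning_cone P)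
  (Ppointed : pointed_cone P)
  (K : hilbertType R) (Ksep : separable K) (G : symFock K)
  (V : 'rV[R]_d -> K -> K)
  (Vrep : isometric_rep P V) (Vstrict : strictly_continuous P V)
  (Vpure : pure P V)
  (alpha : 'rV[R]_d -> (G -> G) -> G -> G) (Halpha : is_ccr_flow G P V alpha) :
  set_bij ([set: 'rV[R[i]]_d] `*` additive_cocycles P V) (units P alpha)
    (fun p => ccr_unit G P V p.1 p.2).
Proof.
split.
- by move=> [mu h] [_ hh]; apply: ccr_unit_units.
- move=> [mu h] [nu k] /set_mem[_ hh] /set_mem[_ kk] E.
  by have [/= -> ->] := ccr_unit_inj Pcone Pspan Vrep hh kk E.
- move=> u Hu; have [mu [h [hh <-]]] := unit_ccr_unit Pcone Pspan Vrep Vstrict Halpha Hu.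
  by exists (mu, h).
Qed.
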